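(* Let $\Lambda=K\Gamma/I$ be as in the context. **(I)** If $\Lambda$ has finite uniserial type, then the following condition (N) is satisfied: (N) Whenever $\alpha:e\to e'$ is an arrow in $\Gamma$ and $p:e\to e'$ is a mast of positive length, then $p\in K\Gamma\alpha\cup\alpha K\Gamma$; that is, $p=c'\alpha$ for some (possibly trivial) oriented cycle $c'$ at $e'$, or $p=\alpha c$ for some (possibly trivial) oriented cycle $c$ at $e$. **(II)** Condition (N), in turn, implies that: (a) $\Gamma$ has no double arrows (i.e. there are no two distinct arrows with the same starting vertex and the same terminal vertex). Hence each uniserial left $\Lambda$-module has a unique mast, and all the varieties $V_{\mathbb S}$, where $\mathbb S$ is a sequence of simple left $\Lambda$-modules, are uniquely determined, up to isomorphism, by the isomorphism type of $\Lambda$. (b) All halyards on masts of uniserial left $\Lambda$-modules are circular. In particular, given any repetition-free sequence $\mathbb S$ of simple left $\Lambda$-modules (i.e. with pairwise non-isomorphic entries), there is, up to isomorphism, at most one uniserial left $\Lambda$-module with composition series $\mathbb S$. (c) If $\gamma$ is a loop attached to a vertex $e$ of $\Gamma$ and $p:e\to e$ is a mast, then $p=\gamma^m$ for some $m\ge 0$; in coordinate-free terms: if there exists a uniserial left $\Lambda$-module $W$ of length $2$ with $\operatorname{top}W\cong\operatorname{soc}W\cong S$ (i.e. if $\operatorname{Ext}^1_\Lambda(S,S)\ne 0$), and if $U$ is any uniserial left $\Lambda$-module of length $l\ge 2$ with $\operatorname{top}U\cong\operatorname{soc}U\cong S$, then $J^iU/J^{i+2}U\cong W$ for all $0\le i\le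 l-2$. (d) Suppose that $\mathbb S=(S(0),S(1),\dots,S(l))$ is a sequence of simple left $\Lambda$-modules such that $V_{(S(1),\dots,S(l))}$ is finite. Then there are only finitely many uniserial left $\Lambda$-modules with composition series $\mathbb S$, up to isomorphism.
   Context: **Setting.** $K$ is an infinite field, $\Gamma$ a finite quiver, $I$ an admissible ideal of the path algebra $K\Gamma$, $\Lambda=K\Gamma/I$ (a finite dimensional split basic $K$-algebra), and $J$ its Jacobson radical. Vertices of $\Gamma$ are identified with the corresponding primitive idempotents of $\Lambda$. Paths are composed so that $qp$ means ''$q$ after $p$''; vertices are the paths of length $0$. A right subpath of a path $p$ is a path $u$ with $p=u'u$ in $K\Gamma$ for some path $u'$ (lengths $0$ allowed). An oriented cycle at $e$ is a path $e\to e$; it is trivial if it has length $0$. Modules are finitely generated left modules. **Uniserial modules, masts.** A module is uniserial if its submodules form a chain. A uniserial module $U$ of composition length $l+1$ has composition series $\mathbb S=(S(0),\dots,S(l))$ if $J^iU/J^{i+1}U\cong S(i)$ for all $i$. A mast of $U$ is a path $p$ in $K\Gamma$ of length $l$ with $pU\neq 0$; a path is called a mast if it is a mast of some uniserial left $\Lambda$-module. A top element of $U$ is an element $x\in U\setminus JU$ with $x=ex$ for a vertex $e$. $\Lambda$ has finite uniserial type if there are only finitely many isomorphism classes of uniserial left $\Lambda$-modules. **Detours and $V_p$.** Let $p$ be a path. A detour on $p$ is a pair $(\alpha,u)$ with $u$ a right subpath of $p$ and $\alpha$ an arrow such that $\alpha u$ is a path which is not a right subpath of $p$, but there is a right subpath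 of $p$ strictly longer than $u$ ending in the same vertex as $\alpha$. All right subpaths of $p$ that are longer than $u$ and end in the same vertex as $\alpha$ are denoted $v_i(\alpha,u)$, $i\in I(\alpha,u)$. Let $D$ be the (finite) set of triples $(\alpha,u,i)$ with $(\alpha,u)$ a detour on $p$ and $i\in I(\alpha,u)$, with corresponding independent variables $X_i(\alpha,u)$. $V_p\subseteq\mathbb A^D=K^D$ is the set of all points $k=(k_i(\alpha,u))$ for which there are a uniserial left $\Lambda$-module $U$ with mast $p$ and a top element $x$ of $U$ with $\alpha ux=\sum_{i\in I(\alpha,u)}k_i(\alpha,u)v_i(\alpha,u)x$ for all detours $(\alpha,u)$ on $p$; this set is known to be Zariski closed. $A_p$ is the coordinate ring of $V_p$, i.e. the polynomial ring in the $X_i(\alpha,u)$ modulo the ideal of polynomials vanishing on $V_p$. **$V_{\mathbb S}$.** Suppose $\Gamma$ has no double arrows. For a sequence $\mathbb S=(S(0),\dots,S(l))$ of simple left modules, with corresponding vertices $e(0),\dots,e(l)$ (so $S(i)\cong\Lambda e(i)/Je(i)$), there is at most one path $p$ of length $l$ passing through $e(0),\dots,e(l)$ in this order; set $V_{\mathbb S}=V_p$ (and $V_{\mathbb S}=\varnothing$ if no such path exists). **Halyards.** Let $p$ be a mast. A detour $(\alpha,u)$ on $p$ is a halyard on $p$ if some $X_j(\alpha,u)$ has nonzero image in $A_p$, equivalently, if there is a uniserial module $U$ with mast $p$ and top element $x$ with $\alpha ux\neq 0$. A halyard $(\alpha,u)$ on $p$, with $u$ ending in the vertex $e$, is circular if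 there are a uniserial module $U$ with mast $p$, a top element $x$ of $U$, and an oriented cycle $c:e\to e$ of positive length such that $\alpha cu$ is a right subpath of $p$, $\alpha ux\ne 0$, and $\Lambda\alpha ux=\Lambda\alpha cux$. *)

(* Defs.v *)
From HB Require Import structures.
From mathcomp Require Import all_boot all_order all_algebra.
From mathcomp Require Import finmap boolp.
From mathcomp Require Import monalg.
From mathcomp Require mpoly.

Set Implicit Arguments.
Unset Strict Implicit.
Unset Printing Implicit Defensive.

Import GRing.Theory.
Local Open Scope ring_scope.

(** * Quivers and paths *)

Record quiver := Quiver {
  vertex : finType;
  arrow : finType;
  src : arrow -> vertex;
  tgt : arrow -> vertex }.

Section Paths.
Variable G : quiver.

Fixpoint walk (x : vertex G) (s : seq (arrow G)) : bool :=
  if s is a :: s' then (src a == x) && walk (tgt a) s' else true.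

Definition walk_end (x : vertex G) (s : seq (arrow G)) : vertex G :=
  last x [seq tgt a | a <- s].

(* The arrows are listed in the order in which they are traversed, so that the
   word a_l ... a_1 of the right-to-left convention is the list
   [:: a_1; ...; a_l]. *)
Record qpath := QPath {
  qpath_val :> vertex G * seq (arrow G);
  _ : walk qpath_val.1 qpath_val.2 }.

HB.instance Definition _ := [isSub for qpath_val].
HB.instance Definition _ := [Countable of qpath by <:].

Definition pstart (p : qpath) : vertex G := (qpath_val p).1.
Definition parrows (p : qpath) : seq (arrow G) := (qpath_val p).2.
Definition pend (p : qpath) : vertex G := walk_end (pstart p) (parrows p).
Definition plen (p : qpath) : nat := size (parrows p).
Definition pvertices (p : qpath) : seq (vertex G) :=
  pstart p :: [seq tgt a | a <- parrows p].

Lemma walk_cat x s t : walk x (s ++ t) = walk x s && walk (walk_end x s) t.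
Proof. by elim: s x => [|a s IHs] x //=; rewrite IHs andbA. Qed.

Lemma walk_end_cat x s t : walk_end x (s ++ t) = walk_end (walk_end x s) t.
Proof. by rewrite /walk_end map_cat last_cat. Qed.

Lemma qpathP (p : qpath) : walk (pstart p) (parrows p).
Proof. by case: p. Qed.

Lemma qpath_inj (p q : qpath) :
  pstart p = pstart q -> parrows p = parrows q -> p = q.
Proof.
move=> e1 e2; apply: val_inj.
by rewrite /= [LHS]surjective_pairing [RHS]surjective_pairing; congr (_, _).
Qed.

Definition pvertex (x : vertex G) : qpath := @QPath (x, [::]) isT.

Lemma parrow_subproof (a : arrow G) : walk (src a) [:: a].
Proof. by rewrite /= eqxx. Qed.
Definition parrow (a : arrow G) : qpath :=
  @QPath (src a, [:: a]) (parrow_subproof a).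

(* [pcomp q p] is the path qp, "q after p", when it is defined. *)
Definition pcomp (q p : qpath) : option qpath :=
  if pend p == pstart q then insub (pstart p, parrows p ++ parrows q)
  else None.

Lemma pcomp_someP (q p r : qpath) :
  pcomp q p = Some r <->
  [/\ pend p = pstart q, pstart r = pstart p
    & parrows r = parrows p ++ parrows q].
Proof.
rewrite /pcomp; case: eqP => [e|ne]; last by split=> // -[].
case: insubP => [r' _ def_r'|/negP[]] /=; last first.
  by rewrite walk_cat qpathP -/(pend p) e qpathP.
split=> [[<-]|[_ r1 r2]].
  by split=> //; rewrite /pstart /parrows ?def_r'.
congr Some; apply: qpath_inj; first by rewrite r1 /pstart def_r'.
by rewrite r2 /parrows def_r'.
Qed.

Lemma pcomp_defined (q p : qpath) :
  pend p = pstart q -> exists r, pcomp q p = Some r.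
Proof.
move=> e.
have wr : walk (pstart p, parrows p ++ parrows q).1
               (pstart p, parrows p ++ parrows q).2.
  by rewrite /= walk_cat qpathP -/(pend p) e qpathP.
by exists (QPath wr); apply/pcomp_someP; split.
Qed.

Lemma pcomp_undefined (q p : qpath) : pend p != pstart q -> pcomp q p = None.
Proof. by rewrite /pcomp => /negPf->. Qed.

Lemma pend_comp (q p r : qpath) : pcomp q p = Some r -> pend r = pend q.
Proof.
case/pcomp_someP=> e e1 e2.
by rewrite /pend e1 e2 walk_end_cat -/(pend p) e.
Qed.

Lemma pcompA (r q p : qpath) :
  obind (fun s => pcomp s p) (pcomp r q) =
  obind (fun s => pcomp r s) (pcomp q p).
Proof.
have [rq|nrq] := eqVneq (pend q) (pstart r); last first.
  rewrite (pcomp_undefined nrq) /=; case e: (pcomp q p) => [s|] //=.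
  by rewrite pcomp_undefined // (pend_comp e).
have [t et] := pcomp_defined rq; rewrite et /=.
have /pcomp_someP[_ t1 t2] := et.
have [qp|nqp] := eqVneq (pend p) (pstart q); last first.
  by rewrite (pcomp_undefined nqp) pcomp_undefined // t1.
have [s es] := pcomp_defined qp; rewrite es /=.
have /pcomp_someP[_ s1 s2] := es.
have [u eu] : exists u, pcomp t p = Some u by apply: pcomp_defined; rewrite t1.
rewrite eu; apply/esym/pcomp_someP.
have /pcomp_someP[_ u1 u2] := eu.
by split; rewrite ?(pend_comp es) ?u1 ?s1 // u2 t2 s2 catA.
Qed.

Lemma pcomp_vertexl x (p : qpath) :
  pcomp (pvertex x) p = if pend p == x then Some p else None.
Proof.
case: eqP => [e|ne]; first by apply/pcomp_someP; split; rewrite ?cats0.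
by rewrite /pcomp; case: eqP.
Qed.

Lemma pcomp_vertexr x (p : qpath) :
  pcomp p (pvertex x) = if x == pstart p then Some p else None.
Proof.
case: eqP => [e|ne]; first by apply/pcomp_someP; split.
by rewrite /pcomp; case: eqP.
Qed.

(* [right_subpath u p] : p = u'u for some path u'; see [right_subpathP]. *)
Definition right_subpath (u p : qpath) : bool :=
  (pstart u == pstart p) && prefix (parrows u) (parrows p).

Lemma right_subpathP (u p : qpath) :
  reflect (exists u', pcomp u' u = Some p) (right_subpath u p).
Proof.
apply: (iffP andP) => [[/eqP e /prefixP[s es]]|[u' /pcomp_someP[_ e es]]].
  have ws : walk (pend u, s).1 (pend u, s).2.
    by have := qpathP p; rewrite es -e walk_cat => /andP[].
  by exists (QPath ws); apply/pcomp_someP.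
by split; [rewrite e | rewrite es prefix_prefix].
Qed.

Lemma pinit_subproof (p : qpath) j : walk (pstart p) (take j (parrows p)).
Proof.
by have := qpathP p; rewrite -{1}(cat_take_drop j (parrows p)) walk_cat
  => /andP[].
Qed.
Definition pinit (p : qpath) (j : nat) : qpath :=
  @QPath (pstart p, take j (parrows p)) (pinit_subproof p j).

Definition right_subpaths (p : qpath) : seq qpath :=
  [seq pinit p j | j <- iota 0 (plen p).+1].

Lemma mem_right_subpaths (u p : qpath) :
  (u \in right_subpaths p) = right_subpath u p.
Proof.
apply/mapP/andP => [[j _ ->]|[/eqP e pr]].
  by split=> //; apply: prefix_take.
exists (plen u); last first.
  by apply: qpath_inj => //; move: pr; rewrite prefixE => /eqP.
by rewrite mem_iota add0n ltnS size_prefix.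
Qed.

Definition cycle_at (x : vertex G) (c : qpath) : Prop :=
  pstart c = x /\ pend c = x.

(** ** Detours *)

(* v is one of the v_i(a, u). *)
Definition detour_target (p : qpath) (a : arrow G) (u v : qpath) : bool :=
  [&& right_subpath v p, plen u < plen v & pend v == tgt a]%N.

Definition detour (p : qpath) (a : arrow G) (u : qpath) : bool :=
  [&& right_subpath u p,
      (if pcomp (parrow a) u is Some w then ~~ right_subpath w p else false)
    & has (detour_target p a u) (right_subpaths p)].

(* The index set D of the coordinates: the triples (a, u, i), where the index
   i is represented by the path v_i(a, u). *)
Definition detour_triples (p : qpath) : seq (arrow G * qpath * qpath) :=
  [seq t <- [seq (au, v) | au <- [seq (a, u) | a <- enum (arrow G),
                                               u <- right_subpaths p],
                           v <- right_subpaths p]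
  | detour p t.1.1 t.1.2 && detour_target p t.1.1 t.1.2 t.2].

Definition detour_index (p : qpath) : finType := seq_sub (detour_triples p).

Lemma mem_detour_triples (p : qpath) a u v :
  ((a, u, v) \in detour_triples p) = detour p a u && detour_target p a u v.
Proof.
rewrite mem_filter; apply/andb_idr => /andP[/and3P[ru _ _] /and3P[rv _ _]].
apply/allpairsPdep; exists (a, u), v; split; rewrite ?mem_right_subpaths //.
by apply/allpairsPdep; exists a, u; rewrite mem_enum mem_right_subpaths.
Qed.

Definition dt_arrow (p : qpath) (d : detour_index p) : arrow G := (val d).1.1.
Definition dt_base (p : qpath) (d : detour_index p) : qpath := (val d).1.2.
Definition dt_target (p : qpath) (d : detour_index p) : qpath := (val d).2.

Definition no_double_arrows : Prop :=
  forall a b : arrow G, src a = src b -> tgt a = tgt b -> a = b.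

End Paths.

(** * The path algebra *)

Definition path_algebra (K : fieldType) (G : quiver) : Type :=
  {malg K[qpath G]}.

HB.instance Definition _ (K : fieldType) (G : quiver) :=
  GRing.Lmodule.copy (path_algebra K G) {malg K[qpath G]}.

Section PathAlgebra.
Variables (K : fieldType) (G : quiver).
Local Notation KG := (path_algebra K G).

Definition path_elt (p : qpath G) : KG := mkmalgU p 1.

Definition coef (f : KG) (p : qpath G) : K := mcoeff p f.

(* The linear extension to KG of a map on paths. *)
Definition lin_ext (V : lmodType K) (F : qpath G -> V) (f : KG) : V :=
  \sum_(p <- msupp f) coef f p *: F p.

Lemma lin_extEw (V : lmodType K) (F : qpath G -> V) (f : KG)
    (d : {fset qpath G}) : (msupp f `<=` d)%fset ->
  lin_ext F f = \sum_(p <- d) coef f p *: F p.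
Proof.
move=> sub; rewrite /lin_ext (big_fset_incl _ sub) // => p _ np.
by rewrite /coef mcoeff_outdom // scale0r.
Qed.

Lemma lin_ext_is_linear (V : lmodType K) (F : qpath G -> V) :
  linear (lin_ext F).
Proof.
move=> c f g.
pose d : {fset qpath G} :=
  (msupp f `|` msupp g `|` msupp (c *: f + g : KG))%fset.
have sf : (msupp f `<=` d)%fset by rewrite /d -fsetUA fsubsetUl.
have sg : (msupp g `<=` d)%fset.
  by rewrite /d [(msupp f `|` _)%fset]fsetUC -fsetUA fsubsetUl.
have sh : (msupp (c *: f + g : KG) `<=` d)%fset by rewrite fsubsetUr.
rewrite (lin_extEw F sf) (lin_extEw F sg) (lin_extEw F sh).
rewrite scaler_sumr -big_split; apply: eq_bigr => p _ /=.
by rewrite /coef mcoeffD mcoeffZ scalerDl scalerA.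
Qed.

HB.instance Definition _ (V : lmodType K) (F : qpath G -> V) :=
  GRing.isLinear.Build K KG V *:%R (lin_ext F) (lin_ext_is_linear F).

Lemma lin_ext_path (V : lmodType K) (F : qpath G -> V) p :
  lin_ext F (path_elt p) = F p.
Proof.
have sub : (msupp (path_elt p) `<=` [fset p])%fset by apply: msuppU_le.
by rewrite (lin_extEw F sub) big_seq_fset1 /coef mcoeffUU scale1r.
Qed.

Lemma path_algebraE (f : KG) : f = lin_ext path_elt f.
Proof.
rewrite [LHS]monalgE /lin_ext; apply: eq_bigr => p _.
apply/malgP => q; rewrite mcoeffZ /path_elt !mcoeffU.
by case: eqP; rewrite ?mulr0n ?mulr0 ?mulr1n ?mulr1.
Qed.

Lemma lin_ext_uniq (V : lmodType K) (h1 h2 : {linear KG -> V}) :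
  (forall p, h1 (path_elt p) = h2 (path_elt p)) -> h1 =1 h2.
Proof.
move=> e f; rewrite (path_algebraE f) /lin_ext !linear_sum.
by apply: eq_bigr => p _; rewrite !linearZ e.
Qed.

Lemma eq_lin_ext (V : lmodType K) (F F' : qpath G -> V) f :
  F =1 F' -> lin_ext F f = lin_ext F' f.
Proof. by move=> e; apply: eq_bigr => p _; rewrite e. Qed.

(* Product of two paths in KG: qp if it is defined, and 0 otherwise. *)
Definition path_mul (q p : qpath G) : KG :=
  if pcomp q p is Some r then path_elt r else 0.

Definition palg_mul (f g : KG) : KG :=
  lin_ext (fun q => lin_ext (path_mul q) g) f.

Definition palg_one : KG := \sum_(x : vertex G) path_elt (pvertex x).

Lemma palg_mulUU q p : palg_mul (path_elt q) (path_elt p) = path_mul q p.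
Proof. by rewrite /palg_mul !lin_ext_path. Qed.

Lemma palg_mul_is_linearl g : linear (palg_mul^~ g).
Proof. by move=> c f f'; rewrite /palg_mul linearP. Qed.

Lemma palg_mul_is_linearr f : linear (palg_mul f).
Proof.
move=> c g g'; rewrite /palg_mul /lin_ext scaler_sumr -big_split.
apply: eq_bigr => q _ /=; rewrite -!/(lin_ext _ _) linearP scalerDr.
by rewrite !scalerA mulrC.
Qed.

HB.instance Definition _ f :=
  GRing.isLinear.Build K KG KG *:%R (palg_mul f) (palg_mul_is_linearr f).

Definition palg_mulr (g f : KG) : KG := palg_mul f g.
HB.instance Definition _ g :=
  GRing.isLinear.Build K KG KG *:%R (palg_mulr g) (palg_mul_is_linearl g).

Lemma palg_mulDl : left_distributive palg_mul +%R.
Proof. by move=> f g h; rewrite -!/(palg_mulr h _) linearD. Qed.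

Lemma palg_mulDr : right_distributive palg_mul +%R.
Proof. by move=> f g h; rewrite linearD. Qed.

Lemma palg_mulA : associative palg_mul.
Proof.
move=> f g h; move: f.
pose h1 : {linear KG -> KG} := palg_mulr (palg_mul g h).
pose h2 : {linear KG -> KG} := palg_mulr h \o palg_mulr g.
apply: (@lin_ext_uniq KG h1 h2) => r; rewrite {}/h1 {}/h2 /= /palg_mulr; move: g.
pose h3 : {linear KG -> KG} := palg_mul (path_elt r) \o palg_mulr h.
pose h4 : {linear KG -> KG} := palg_mulr h \o palg_mul (path_elt r).
apply: (@lin_ext_uniq KG h3 h4) => q; rewrite {}/h3 {}/h4 /= /palg_mulr; move: h.
pose h5 : {linear KG -> KG} := palg_mul (path_elt r) \o palg_mul (path_elt q).
pose h6 : {linear KG -> KG} := palg_mul (palg_mul (path_elt r) (path_elt q)).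
apply: (@lin_ext_uniq KG h5 h6) => p; rewrite /h5 /h6 /= !palg_mulUU.
have := pcompA r q p; rewrite /path_mul.
case: (pcomp q p) => [s|]; case: (pcomp r q) => [t|] /=;
  rewrite ?palg_mulUU ?linear0 -?/(palg_mulr _ 0) ?linear0 // /path_mul.
- by move->.
- by move<-.
- by move->.
Qed.

Lemma palg_mul1l : left_id palg_one palg_mul.
Proof.
pose h1 : {linear KG -> KG} := palg_mul palg_one.
apply: (@lin_ext_uniq KG h1 idfun) => p; rewrite /h1 /= -/(palg_mulr _ _).
rewrite /palg_one linear_sum (bigD1 (pend p)) //= big1 ?addr0.
  by rewrite /palg_mulr palg_mulUU /path_mul pcomp_vertexl eqxx.
move=> x ne; rewrite /palg_mulr palg_mulUU /path_mul pcomp_vertexl.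
by rewrite eq_sym (negPf ne).
Qed.

Lemma palg_mul1r : right_id palg_one palg_mul.
Proof.
pose h1 : {linear KG -> KG} := palg_mulr palg_one.
apply: (@lin_ext_uniq KG h1 idfun) => p; rewrite /h1 /= /palg_mulr.
rewrite /palg_one linear_sum (bigD1 (pstart p)) //= big1 ?addr0.
  by rewrite palg_mulUU /path_mul pcomp_vertexr eqxx.
by move=> x ne; rewrite palg_mulUU /path_mul pcomp_vertexr (negPf ne).
Qed.

HB.instance Definition _ := GRing.Zmodule_isPzRing.Build KG
  palg_mulA palg_mul1l palg_mul1r palg_mulDl palg_mulDr.

Lemma path_eltM q p : path_elt q * path_elt p = path_mul q p.
Proof. exact: palg_mulUU. Qed.

Lemma coef_path_elt q p : coef (path_elt q) p = (q == p)%:R.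
Proof. by rewrite /coef /path_elt mcoeffU. Qed.

Lemma coef_lin_ext (F : qpath G -> KG) f p :
  coef (lin_ext F f) p = \sum_(r <- msupp f) coef f r * coef (F r) p.
Proof.
rewrite /coef /lin_ext; elim: (enum_fset (msupp f)) => [|r s IHs].
  by rewrite !big_nil; apply: mcoeff0.
by rewrite !big_cons -IHs -mcoeffZ -mcoeffD.
Qed.

Lemma coef_path_mul q r p :
  coef (path_mul q r) p = (pcomp q r == Some p)%:R.
Proof.
rewrite /path_mul; case: (pcomp q r) => [s|]; first by rewrite coef_path_elt.
exact: mcoeff0.
Qed.

Lemma path_elt_mull (p q : qpath G) (f : KG) :
  path_elt p = f * path_elt q -> exists r, pcomp r q = Some p.
Proof.
move=> e; apply: contrapT => none.
have := congr1 (coef^~ p) e; rewrite coef_path_elt eqxx coef_lin_ext big1.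
  by move/eqP; rewrite oner_eq0.
move=> r _; rewrite lin_ext_path coef_path_mul.
by case: eqP => [er|_]; [case: none; exists r | rewrite mulr0].
Qed.

Lemma path_elt_mulr (p q : qpath G) (f : KG) :
  path_elt p = path_elt q * f -> exists r, pcomp q r = Some p.
Proof.
move=> e; apply: contrapT => none.
have := congr1 (coef^~ p) e; rewrite [_ * _]lin_ext_path.
rewrite coef_path_elt eqxx coef_lin_ext big1.
  by move/eqP; rewrite oner_eq0.
move=> r _; rewrite coef_path_mul.
by case: eqP => [er|_]; [case: none; exists r | rewrite mulr0].
Qed.

Definition two_sided_ideal (I : KG -> Prop) : Prop :=
  [/\ I 0, (forall f g, I f -> I g -> I (f + g))
    & (forall f g h, I g -> I (f * g * h))].

(* For some m, the ideal I lies between the m-th power and the square of the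
   ideal generated by the arrows; the m-th power of the arrow ideal is the span
   of the paths of length at least m. *)
Definition admissible (I : KG -> Prop) : Prop :=
  [/\ two_sided_ideal I,
      (forall f, I f -> forall p, coef f p != 0 -> (2 <= plen p)%N)
    & (exists m, forall p, (m <= plen p)%N -> I (path_elt p))].

End PathAlgebra.

(** * Modules over a ring *)

Section Modules.
Variable A : nzRingType.

Definition isom (M N : lmodType A) : Prop :=
  exists f : {linear M -> N}, bijective f.

Definition full (M : lmodType A) (x : M) : Prop := True.
Definition zero (M : lmodType A) (x : M) : Prop := x = 0.

Definition submodule (M : lmodType A) (N : M -> Prop) : Prop :=
  N 0 /\ (forall (a : A) (x y : M), N x -> N y -> N (a *: x + y)).

Definition generated (M : lmodType A) (P : M -> Prop) (x : M) : Prop :=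
  forall N : M -> Prop, submodule N -> (forall y, P y -> N y) -> N x.

(* X / Y is isomorphic to W, for submodules Y <= X of M: there is an
   epimorphism X -> W with kernel Y. *)
Definition factor_isom (M : lmodType A) (X Y : M -> Prop) (W : lmodType A)
    : Prop :=
  (forall x, Y x -> X x) /\
  exists f : M -> W,
    [/\ (forall (a : A) x y, X x -> X y -> f (a *: x + y) = a *: f x + f y),
        (forall w, exists2 x, X x & f x = w)
      & (forall x, X x -> (f x = 0 <-> Y x))].

Definition fin_gen (M : lmodType A) : Prop :=
  exists (n : nat) (g : 'I_n -> M),
    forall x, exists c : 'I_n -> A, x = \sum_(i < n) c i *: g i.

Definition simple_sub (M : lmodType A) (N : M -> Prop) : Prop :=
  [/\ submodule N, (exists2 x, N x & x != 0)
    & forall N' : M -> Prop, submodule N' -> (forall x, N' x -> N x) ->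
        (forall x, N' x -> x = 0) \/ (forall x, N x -> N' x)].

Definition simple (M : lmodType A) : Prop := simple_sub (@full M).

Definition comp_length (M : lmodType A) (n : nat) : Prop :=
  exists F : nat -> M -> Prop,
    [/\ (forall i, (i <= n)%N -> submodule (F i)),
        (forall x, F 0%N x <-> x = 0), (forall x, F n x)
      & (forall i, (i < n)%N ->
           exists2 S, simple S & factor_isom (F i.+1) (F i) S)].

Definition maximal_left_ideal (L : A^o -> Prop) : Prop :=
  [/\ submodule L, (exists x, ~ L x)
    & forall L' : A^o -> Prop, submodule L' -> (forall x, L x -> L' x) ->
        (forall x, L' x -> L x) \/ (forall x, L' x)].

Definition jacobson (a : A) : Prop :=
  forall L, maximal_left_ideal L -> L a.

(* The submodule JN. *)
Definition rad_mul (M : lmodType A) (N : M -> Prop) : M -> Prop :=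
  generated (fun y => exists a x, [/\ jacobson a, N x & y = a *: x]).

(* The submodule J^i M. *)
Definition rad_pow (M : lmodType A) (i : nat) : M -> Prop :=
  iter i (@rad_mul M) (@full M).

Definition socle (M : lmodType A) : M -> Prop :=
  generated (fun x => exists2 N : M -> Prop, simple_sub N & N x).

(* The zero module, which has no composition length of the form l + 1, is not
   counted as uniserial. *)
Definition uniserial (U : lmodType A) : Prop :=
  [/\ fin_gen U, (exists x : U, x != 0)
    & forall N N' : U -> Prop, submodule N -> submodule N' ->
        (forall x, N x -> N' x) \/ (forall x, N' x -> N x)].

Definition comp_series (n : nat) (S : 'I_n -> lmodType A) (U : lmodType A)
    : Prop :=
  comp_length U n /\
  forall i : 'I_n, factor_isom (@rad_pow U i) (@rad_pow U i.+1) (S i).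

Definition finitely_many_up_to_isom (P : lmodType A -> Prop) : Prop :=
  exists (n : nat) (M : 'I_n -> lmodType A),
    forall U, P U -> exists i, isom U (M i).

Definition finite_uniserial_type : Prop := finitely_many_up_to_isom uniserial.

Definition top_isom (U S : lmodType A) : Prop :=
  factor_isom (@full U) (@rad_pow U 1) S.
Definition soc_isom (U S : lmodType A) : Prop :=
  factor_isom (@socle U) (@zero U) S.

(* Ext^1(S, T) <> 0, in Yoneda's description: there is a non-split short exact
   sequence 0 -> T -> E -> S -> 0. *)
Definition ext1_nonzero (S T : lmodType A) : Prop :=
  exists (E : lmodType A) (f : {linear T -> E}) (g : {linear E -> S}),
    [/\ injective f, (forall s, exists x, g x = s),
        (forall x, g x = 0 <-> exists t, f t = x)
      & ~ exists h : {linear S -> E}, forall s, g (h s) = s].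

End Modules.

(** * Affine varieties *)

Section Affine.
Variable K : fieldType.

(* A subset of the affine space with coordinates indexed by a finite type. *)
Record affine_set := AffineSet {
  coord : finType;
  points : {ffun coord -> K} -> Prop }.

Definition poly_on (T : finType) : Type := mpoly.mpoly #|T| K.

Definition poly_eval (T : finType) (f : poly_on T) (k : {ffun T -> K}) : K :=
  mpoly.meval (fun i => k (enum_val i)) f.

Definition poly_var (T : finType) (t : T) : poly_on T :=
  mpoly.mpolyX K (mpoly.mnm1 (enum_rank t)).

Definition poly_map (T T' : finType) (F : T' -> poly_on T)
    (k : {ffun T -> K}) : {ffun T' -> K} := [ffun t => poly_eval (F t) k].

Definition vanishes_on (V : affine_set) (f : poly_on (coord V)) : Prop :=
  forall k, points k -> poly_eval f k = 0.

Definition affine_isom (V W : affine_set) : Prop :=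
  exists (F : coord W -> poly_on (coord V)) (H : coord V -> poly_on (coord W)),
    [/\ (forall k, points k -> points (poly_map F k)),
        (forall k, points k -> points (poly_map H k)),
        (forall k : {ffun coord V -> K}, points k ->
           poly_map H (poly_map F k) = k)
      & (forall k : {ffun coord W -> K}, points k ->
           poly_map F (poly_map H k) = k)].

Definition affine_finite (V : affine_set) : Prop :=
  exists s : seq {ffun coord V -> K}, forall k, points k -> k \in s.

Definition affine_empty : affine_set :=
  @AffineSet void (fun _ => False).

End Affine.

(** * Uniserial modules over KG/I *)

(* A quotient map KG -> L with kernel I, i.e. an identification L = KG/I of
   K-algebras. Composing with an isomorphism L' -> L turns a presentation of L'
   into one of L, so a construction depends on the isomorphism type of L alone
   if it agrees for any two presentations of L. *)
Definition quotient_map (K : fieldType) (G : quiver)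
    (I : path_algebra K G -> Prop) (L : algType K) (pi : {rmorphism path_algebra K G -> L}) : Prop :=
  [/\ scalable pi, (forall a, exists f, pi f = a)
    & (forall f, pi f = 0 <-> I f)].

Section Uniserial.
Variables (K : fieldType) (G : quiver) (L : algType K).
Variable pi : {rmorphism path_algebra K G -> L}.

Definition path_in (p : qpath G) : L := pi (path_elt K p).

Definition mast_of (p : qpath G) (U : lmodType L) : Prop :=
  [/\ uniserial U, comp_length U (plen p).+1
    & exists x : U, path_in p *: x != 0].

Definition is_mast (p : qpath G) : Prop := exists U, mast_of p U.

Definition top_element (U : lmodType L) (x : U) : Prop :=
  ~ rad_pow 1 x /\ exists e : vertex G, x = path_in (pvertex e) *: x.

Definition var_of_path (p : qpath G) : affine_set K :=
  @AffineSet K (detour_index p) (fun k =>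
    exists (U : lmodType L) (x : U),
      [/\ mast_of p U, top_element x
        & forall a u, detour p a u ->
            path_in (parrow a) *: (path_in u *: x) =
            \sum_(d : detour_index p | (dt_arrow d == a) && (dt_base d == u))
               (k d *: path_in (dt_target d)) *: x]).

(* S is isomorphic to Le/Je. *)
Definition simple_at (e : vertex G) (S : lmodType L) : Prop :=
  let eL := path_in (pvertex e) in
  @factor_isom L L^o
    (fun a => exists b : L, a = b * eL)
    (fun a => exists2 b : L, jacobson b & a = b * eL) S.

Definition passes_through (n : nat) (S : 'I_n -> lmodType L) (p : qpath G)
    : Prop :=
  (plen p).+1 = n /\
  forall i : 'I_n, simple_at (nth (pstart p) (pvertices p) i) (S i).

(* V_S, with S listing n = l + 1 modules. If G has no double arrows, there is at
   most one path through S, and the choice made here is vacuous. *)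
Definition var_of_series (n : nat) (S : 'I_n -> lmodType L) : affine_set K :=
  if pselect (exists p, passes_through S p) is left ex_p
  then var_of_path (projT1 (cid ex_p)) else affine_empty K.

(* X_j(a, u) has nonzero image in the coordinate ring of V_p, that is, it does
   not belong to the ideal of the polynomials vanishing on V_p. *)
Definition halyard (p : qpath G) (a : arrow G) (u : qpath G) : Prop :=
  detour p a u /\
  exists d : detour_index p,
    [/\ dt_arrow d = a, dt_base d = u
      & ~ @vanishes_on K (var_of_path p) (poly_var K d)].

Definition circular (p : qpath G) (a : arrow G) (u : qpath G) : Prop :=
  exists (U : lmodType L) (x : U) (c cu acu : qpath G),
    [/\ mast_of p U /\ top_element x,
        cycle_at (pend u) c /\ (0 < plen c)%N,
        [/\ pcomp c u = Some cu, pcomp (parrow a) cu = Some acu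
          & right_subpath acu p],
        path_in (parrow a) *: (path_in u *: x) != 0
      & forall y : U,
          (exists b : L, y = b *: (path_in (parrow a) *: (path_in u *: x))) <->
          (exists b : L,
             y = b *: (path_in (parrow a) *: (path_in c *: (path_in u *: x))))].

Definition condition_N : Prop :=
  forall (a : arrow G) (p : qpath G),
    is_mast p -> (0 < plen p)%N -> pstart p = src a -> pend p = tgt a ->
    (exists2 c', cycle_at (tgt a) c' & pcomp c' (parrow a) = Some p) \/
    (exists2 c, cycle_at (src a) c & pcomp (parrow a) c = Some p).

End Uniserial.

(* The alternatives of [condition_N] amount to membership in (KG)a and a(KG). *)
Lemma condition_NP (K : fieldType) (G : quiver) (L : algType K)
    (pi : {rmorphism path_algebra K G -> L}) :
  condition_N pi <->
  (forall (a : arrow G) (p : qpath G),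
    is_mast pi p -> (0 < plen p)%N -> pstart p = src a -> pend p = tgt a ->
    (exists f, path_elt K p = f * path_elt K (parrow a)) \/
    (exists f, path_elt K p = path_elt K (parrow a) * f)).
Proof.
split=> N a p mp lp sp ep.
  by case: (N a p mp lp sp ep) => -[c _ e]; [left | right];
    exists (path_elt K c); rewrite path_eltM /path_mul e.
case: (N a p mp lp sp ep) => -[f];
  [case/path_elt_mull | case/path_elt_mulr] => c e.
  left; exists c => //; have /pcomp_someP[e1 _ _] := e.
  by split; rewrite -?e1 // -(pend_comp e).
right; exists c => //; have /pcomp_someP[e1 e2 _] := e.
by split; rewrite -?e2.
Qed.

(* Main.v *)
(* The paths of length at most one give coordinates on L = KG/I, since I lives on
   longer paths; hence the Jacobson radical J is spanned by the paths of positive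
   length, and a uniserial module with mast p and top element x has the basis of
   all v x, v a right subpath of p. Its structure constants are polynomials in
   the point of V_p, so that this point determines the annihilator of x.

   (I) Take a mast p of minimal length that violates (N) for an arrow al. By
   minimality the top element x can be chosen with al x in K p x. Adding t p x to
   al x gives again a uniserial module with mast p, and different values of t
   give non-isomorphic modules.

   (II) Under (N) every target of a detour (al, u) has the form al c u for a
   cycle c of positive length. This yields (a), (b) and (c) directly. In (d) let
   a be the first arrow of the mast: replacing x by x minus multiples of the c x
   makes al x vanish for all arrows al other than a, and then the annihilator of
   x is determined by that of a x, hence by a point of V_(S(1), ..., S(l)).

   For two presentations of L, choose g and h in L with g h = e', h g = e for the
   idempotents e, e' at the starting points of the masts. Then x |-> g x identifies
   the pairs (U, x) that define the two varieties. The matrix that passes from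
   the basis v x to the basis v' g x has polynomial entries; it is triangular for
   the radical filtration, and without double arrows its diagonal is constant, so
   its inverse is polynomial as well. *)

Require Import Defs.
From HB Require Import structures.
From mathcomp Require Import all_boot all_order all_algebra.
From mathcomp Require Import finmap boolp.
From mathcomp Require Import monalg.
From mathcomp Require mpoly.

Set Implicit Arguments.
Unset Strict Implicit.
Unset Printing Implicit Defensive.

Import GRing.Theory.
Local Open Scope ring_scope.

(** Every new module is a quotient of [L] by a left ideal, and modules are compared through
    annihilators of generators; [presents] is the common interface. The obstacle in (I) is that
    changing the action of one arrow on one vector has to leave a module. The coefficient [cf al]
    obeys a Leibniz rule with respect to the characters [eps], and J annihilates p x. Hence a |-> a
    x + t cf(a) p x commutes with left multiplication wherever [eps (src al)] vanishes, in
    particular on its kernel, which is therefore a left ideal. Another choice of top element might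
    still absorb t. Minimality is used a second time to exclude this: for r in J the vector al r x
    has no component along p x. In (II) the cycles c matter because c x lies at the same vertex as
    x, so that x - k c x is again a top element. The constant diagonal comes from the layers:
    without double arrows, a path of length i that survives in layer i must be the initial subpath
    of the mast. *)

Local Notation pcomp := Defs.pcomp.
Local Notation "c *.: x" := ((c%:A : _) *: x) (at level 40).

(** * Quotients by left ideals *)

Section LeftIdeal.
Local Open Scope quotient_scope.
Variables (A : nzRingType) (N : A^o -> Prop).
Hypothesis subN : submodule N.

Lemma submod0 : N 0. Proof. by case: subN. Qed.
Lemma submodD a b : N a -> N b -> N (a + b).
Proof. by case: subN => _ h ha hb; rewrite -[a]scale1r; apply: h. Qed.
Lemma submodM c a : N a -> N (c * a).
Proof. by case: subN => n0 h ha; rewrite -[c * a]addr0; apply: (h c a 0). Qed.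
Lemma submodN a : N a -> N (- a).
Proof. by move/(submodM (-1)); rewrite mulN1r. Qed.

Let e (a b : A) := `[< N (a - b) >].

Let e_equiv : equiv_class_of e.
Proof.
split=> [a|a b|b a c]; rewrite /e.
- by apply/asboolP; rewrite subrr; exact: submod0.
- by apply: asbool_equiv_eq; split=> /submodN; rewrite opprB.
move=> /asboolP ab /asboolP bc; apply/asboolP.
by rewrite -[a](subrK b) -addrA; exact: submodD.
Qed.

(** Source of every new module below: the simple modules, the modules of length two attached to
    arrows, the subquotients and the twisted modules are all given by a left ideal. *)
Lemma left_ideal_quotient : exists (M : lmodType A) (x : M),
  (forall y, exists a : A, y = a *: x) /\
  (forall a : A, a *: x = 0 <-> N a).
Proof.
pose r := EquivRelPack e_equiv; pose Q : choiceType := {eq_quot r}.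
pose pr (a : A) : Q := \pi_Q a; pose rp (x : Q) : A := repr x.
have prE a b : pr a = pr b <-> N (a - b).
  by split=> [/eqmodP/asboolP|h] //; apply/eqmodP/asboolP.
have rpK x : pr (rp x) = x by apply: reprK.
have rpr (a : A) : N (rp (pr a) - a) by apply/prE; rewrite rpK.
have prP x : exists a, x = pr a by exists (rp x).
pose add (x y : Q) : Q := pr (rp x + rp y).
pose opp (x : Q) : Q := pr (- rp x).
pose scl (a : A) (x : Q) : Q := pr (a * rp x).
have addE a b : add (pr a) (pr b) = pr (a + b).
  by apply/prE; rewrite opprD addrACA; apply: submodD.
have oppE a : opp (pr a) = pr (- a).
  by apply/prE; rewrite -opprD; apply: submodN.
have sclE c a : scl c (pr a) = pr (c * a).
  by apply/prE; rewrite -mulrBr; apply: submodM.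
have addQA : associative add.
  move=> x y z; have [a ->] := prP x; have [b ->] := prP y.
  by have [c ->] := prP z; rewrite !addE addrA.
have addQC : commutative add.
  move=> x y; have [a ->] := prP x; have [b ->] := prP y.
  by rewrite !addE addrC.
have add0Q : left_id (pr 0) add.
  by move=> x; have [a ->] := prP x; rewrite addE add0r.
have addNQ : left_inverse (pr 0) opp add.
  by move=> x; have [a ->] := prP x; rewrite oppE addE addNr.
pose zm := GRing.isZmodule.Build Q addQA addQC add0Q addNQ.
pose Z : zmodType := HB.pack (Choice.sort Q) zm.
have sclDr c (x y : Q) : scl c (add x y) = add (scl c x) (scl c y).
  have [a ->] := prP x; have [b ->] := prP y.
  by rewrite !(addE, sclE) mulrDr.
have sclDl (x : Q) a b : scl (a + b) x = add (scl a x) (scl b x).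
  by have [c ->] := prP x; rewrite !(addE, sclE) mulrDl.
have sclA a b (x : Q) : scl a (scl b x) = scl (a * b) x.
  by have [c ->] := prP x; rewrite !sclE mulrA.
have scl1 (x : Q) : scl 1 x = x by have [c ->] := prP x; rewrite sclE mul1r.
pose lm := GRing.Zmodule_isLmodule.Build A Z sclA scl1 sclDr sclDl.
pose M : lmodType A := HB.pack (GRing.Zmodule.sort Z) lm.
exists M, (pr 1); split=> [y|a].
  by have [a ->] := prP y; exists a; rewrite [RHS]sclE mulr1.
by rewrite [_ *: _]sclE mulr1 -{2}[a]subr0; apply: prE.
Qed.

End LeftIdeal.

(** * Submodules and cyclic modules over a ring *)

Section Generalities.
Variable A : nzRingType.
Implicit Types M W : lmodType A.

Lemma geometric_sum (r : A) n : (\sum_(i < n) r ^+ i) * (1 - r) = 1 - r ^+ n.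
Proof.
elim: n => [|n IHn]; first by rewrite big_ord0 mul0r expr0 subrr.
by rewrite big_ord_recr mulrDl IHn mulrBr mulr1 -exprSr addrA subrK.
Qed.

Lemma submodule0 M (N : M -> Prop) : submodule N -> N 0.
Proof. by case. Qed.
Lemma submoduleZ M (N : M -> Prop) a x : submodule N -> N x -> N (a *: x).
Proof. by case=> N0 NP Nx; rewrite -[_ *: _]addr0; apply: NP. Qed.
Lemma submoduleD M (N : M -> Prop) x y : submodule N -> N x -> N y -> N (x + y).
Proof. by case=> N0 NP Nx Ny; rewrite -[x]scale1r; apply: NP. Qed.
Lemma submoduleN M (N : M -> Prop) x : submodule N -> N x -> N (- x).
Proof. by move=> sN Nx; rewrite -scaleN1r; apply: submoduleZ. Qed.
Lemma submoduleB M (N : M -> Prop) x y : submodule N -> N x -> N y -> N (x - y).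
Proof. by move=> sN Nx Ny; apply: submoduleD => //; apply: submoduleN. Qed.
Lemma submodule_sum M (N : M -> Prop) (T : Type) (r : seq T) (F : T -> M) :
  submodule N -> (forall i, N (F i)) -> N (\sum_(i <- r) F i).
Proof.
move=> sN NF; elim/big_rec: _ => [|i x _ Nx]; first exact: submodule0.
exact: submoduleD.
Qed.

Lemma generated_submodule M (P : M -> Prop) : submodule (generated P).
Proof.
split=> [N sN _|a x y gx gy N sN PN]; first exact: submodule0.
by apply: (proj2 sN); [apply: gx | apply: gy].
Qed.

Lemma submodule_zero M : submodule (@zero A M).
Proof. by split=> // a x y -> ->; rewrite scaler0 addr0. Qed.

Lemma submodule_cyclic M (x : M) : submodule (fun y => exists a : A, y = a *: x).
Proof.
split=> [|a y z [b ->] [c ->]]; first by exists 0; rewrite scale0r.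
by exists (a * b + c); rewrite scalerDl scalerA.
Qed.

(* M is A / N, with x corresponding to 1 + N. *)
Definition presents M (x : M) (N : A -> Prop) : Prop :=
  (forall y, exists a : A, y = a *: x) /\ (forall a : A, a *: x = 0 <-> N a).

Lemma factor_isom_presents M W (X Y : M -> Prop) x (w : W) (N : A -> Prop) :
  submodule Y -> (forall y, Y y -> X y) ->
  (forall y, X y <-> exists a : A, y = a *: x) ->
  (forall a, Y (a *: x) <-> N a) -> presents w N -> factor_isom X Y W.
Proof.
move=> sY YX gX YN [gW NW].
(* [factor_isom] asks for a total function; the default 0 is only met outside [X]. *)
pose f (y : M) : W :=
  if pselect (exists a : A, y = a *: x) is left e
  then projT1 (cid e) *: w else 0.
have fE y a : y = a *: x -> f y = a *: w.
  move=> e; rewrite /f; case: pselect => [ey|[]]; last by exists a.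
  case: cid => b /= eb; apply/eqP; rewrite -subr_eq0 -scalerBl; apply/eqP.
  by apply/NW/YN; rewrite scalerBl -eb -e subrr; apply: submodule0.
split=> //; exists f; split.
- move=> a y z /gX[b eb] /gX[c ec]; rewrite (fE y b) // (fE z c) //.
  by rewrite (fE _ (a * b + c)) ?eb ?ec scalerDl scalerA.
- move=> z; have [a ->] := gW z; exists (a *: x); first by apply/gX; exists a.
  exact: fE.
by move=> y /gX[a ->]; rewrite (fE _ a) // NW YN.
Qed.

(** All isomorphisms constructed below come from here, so comparing two modules means comparing the
    annihilators of two generators. *)
Lemma isom_presents M W (x : M) (w : W) (N : A -> Prop) :
  presents x N -> presents w N -> isom M W.
Proof.
move=> pM pW; have [gM NM] := pM.
have [||||_ [f [fP fs f0]]] := @factor_isom_presents M W (@full A M) (@zero A M) x w N _ _ _ _ pW.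
- exact: submodule_zero.
- by [].
- by move=> y; split=> // _; apply: gM.
- by move=> a; rewrite -NM.
have fl : linear f by move=> a y z; apply: fP.
pose F : {linear M -> W} := HB.pack f (GRing.isLinear.Build A M W *:%R f fl).
exists F; have inj : injective f.
  move=> y z e; apply/eqP; rewrite -subr_eq0; apply/eqP/f0 => //.
  by rewrite -scaleN1r addrC fP // e scaleN1r addNr.
exists (fun z => sval (cid2 (fs z))) => y; last by case: cid2.
by apply: inj; case: cid2.
Qed.

Lemma presents_factor_isom M W (X Y : M -> Prop) x :
  factor_isom X Y W -> (forall y, X y <-> exists a : A, y = a *: x) ->
  exists w : W, presents w (fun a => Y (a *: x)).
Proof.
move=> [YX [f [fP fs f0]]] gX.
have Xx a : X (a *: x) by apply/gX; exists a.
have X1 : X x by rewrite -[x]scale1r.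
have X0 : X 0 by rewrite -[0](scale0r x).
have f00 : f 0 = 0.
  have := fP 1 0 0 X0 X0; rewrite scaler0 addr0 scale1r => /eqP.
  by rewrite eq_sym -subr_eq0 addrK => /eqP.
have fE a : f (a *: x) = a *: f x.
  by rewrite -[a *: x]addr0 fP // f00 addr0.
exists (f x); split=> [z|a]; last by rewrite -fE; apply: f0.
have [y Xy <-] := fs z; have [a ->] := (gX y).1 Xy.
by exists a.
Qed.

Lemma presents_isom M W (x : M) : isom M W -> (forall y, exists a : A, y = a *: x) ->
  exists w : W, presents w (fun a : A => a *: x = 0).
Proof.
move=> [f [g fg gf]] gx; exists (f x); split=> [z|a].
  by have [a e] := gx (g z); exists a; rewrite -linearZ -e gf.
by rewrite -linearZ; split=> [/(congr1 g)|->]; rewrite ?raddf0 // fg => ->; rewrite -(raddf0 f) fg.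
Qed.

Lemma presents_eq M x (N N' : A -> Prop) :
  presents (M := M) x N -> (forall a, N a <-> N' a) -> presents x N'.
Proof. by move=> [g h] e; split=> // a; rewrite h. Qed.

Lemma simple_cyclic M x : simple M -> x != 0 -> forall y : M, exists a : A, y = a *: x.
Proof.
move=> [_ _ h] x0 y; have [z|c] := h _ (submodule_cyclic x) (fun _ _ => Logic.I); last exact: c.
by case/eqP: x0; apply: z; exists 1; rewrite scale1r.
Qed.

End Generalities.

(** * Initial and final parts of paths *)

Section Paths.
Variable G : quiver.
Implicit Types (p q r u v : qpath G) (a : arrow G) (x : vertex G).

Lemma qpathE p q : (p == q) = (pstart p == pstart q) && (parrows p == parrows q).
Proof.
by apply/eqP/andP => [->|[/eqP e /eqP e']]; [split | apply: qpath_inj].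
Qed.

Definition psplit_subproof p n :
  walk (pend (pinit p n)) (drop n (parrows p)).
Proof.
have := qpathP p; rewrite -{1}(cat_take_drop n (parrows p)) walk_cat.
by case/andP.
Qed.
Definition pfinal p n : qpath G :=
  @QPath G (pend (pinit p n), drop n (parrows p)) (psplit_subproof p n).

Lemma pcomp_split p n : pcomp (pfinal p n) (pinit p n) = Some p.
Proof. by apply/pcomp_someP; split; rewrite //= [RHS]cat_take_drop. Qed.

Lemma plen_pinit p n : (n <= plen p)%N -> plen (pinit p n) = n.
Proof. by rewrite /plen /= size_take_min => /minn_idPl. Qed.

Lemma plen_pfinal p n : plen (pfinal p n) = (plen p - n)%N.
Proof. by rewrite /plen /= size_drop. Qed.

Lemma plen_comp q p r : pcomp q p = Some r -> plen r = (plen p + plen q)%N.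
Proof. by case/pcomp_someP=> _ _; rewrite /plen => ->; rewrite size_cat. Qed.

Lemma right_subpathE u p : right_subpath u p ->
  u = pinit p (plen u) /\ (plen u <= plen p)%N.
Proof.
case/andP=> /eqP e pr; split; last exact: size_prefix.
by apply: qpath_inj => //; move: pr; rewrite prefixE => /eqP.
Qed.

Lemma pinit_right_subpath p i : right_subpath (pinit p i) p.
Proof. by rewrite /right_subpath eqxx; apply: prefix_take. Qed.

Lemma right_subpath_trans u v p :
  right_subpath u v -> right_subpath v p -> right_subpath u p.
Proof.
case/andP=> /eqP e1 h1 /andP[/eqP e2 h2]; rewrite /right_subpath e1 e2 eqxx.
exact: prefix_trans h2.
Qed.

Lemma right_subpath_le u v p : right_subpath u p -> right_subpath v p ->
  (plen u <= plen v)%N -> right_subpath u v.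
Proof.
move=> /right_subpathE[eu lu] /right_subpathE[ev lv] le.
have -> : u = pinit v (plen u); last exact: pinit_right_subpath.
apply: qpath_inj; first by rewrite eu ev.
have eu' : parrows u = take (plen u) (parrows p) by rewrite {1}eu.
have ev' : parrows v = take (plen v) (parrows p) by rewrite {1}ev.
have -> : parrows (pinit v (plen u)) = take (plen u) (parrows v) by [].
by rewrite ev' take_takel.
Qed.

Lemma pcomp_right_subpath q u p : pcomp q u = Some p -> right_subpath u p.
Proof. by move=> e; apply/right_subpathP; exists q. Qed.

Lemma pinit_all p : pinit p (plen p) = p.
Proof. by apply: qpath_inj => //; apply: take_size. Qed.

Lemma pinit0 p : pinit p 0 = pvertex (pstart p).
Proof. by apply: qpath_inj => //; apply: take0. Qed.

Lemma pinit_comp q p r i : pcomp q p = Some r -> (i <= plen p)%N ->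
  pinit r i = pinit p i.
Proof.
move=> /pcomp_someP[e1 e2 e3] ip; apply: qpath_inj => //.
have -> : parrows (pinit r i) = take i (parrows r) by [].
rewrite e3 take_cat -/(plen p); case: ltngtP ip => // -> _.
by rewrite subnn take0 cats0; apply/esym/take_size.
Qed.

Lemma pinit_comp_add w u p t i : pcomp w u = Some t -> right_subpath t p ->
  (i <= plen w)%N -> pcomp (pinit w i) u = Some (pinit p (plen u + i)).
Proof.
move=> ew rt iw; have /pcomp_someP[e1 e2 e3] := ew.
have [et lt] := right_subpathE rt; apply/pcomp_someP; split=> //.
  by rewrite -e2 et.
have -> : parrows (pinit p (plen u + i)) = take (plen u + i) (parrows t).
  rewrite et /= take_takel // (plen_comp ew) leq_add2l //.
by rewrite e3 take_cat -/(plen u) ltnNge leq_addr /= addKn.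
Qed.

Lemma pend_pinit e p i : (i <= plen p)%N ->
  pend (pinit p i) = nth e (pvertices p) i.
Proof.
rewrite /pend /walk_end /pvertices /plen.
have -> : parrows (pinit p i) = take i (parrows p) by [].
have -> : pstart (pinit p i) = pstart p by [].
elim: (parrows p) (pstart p) i => [|a s IHs] x [|i] //= ip.
exact: (IHs (tgt a) i ip).
Qed.

Lemma vertices_path_eq p q : no_double_arrows G ->
  pvertices p = pvertices q -> p = q.
Proof.
move=> nd [e1 e2]; apply: qpath_inj => //.
have := qpathP p; have := qpathP q; rewrite -e1.
elim: (parrows p) (parrows q) (pstart p) e2 => [|a s IHs] [|b t] //= x [eab est].
move=> /andP[/eqP eb wt] /andP[/eqP ea ws].
have eq_ab : a = b by apply: nd; rewrite ?ea ?eb.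
by rewrite eq_ab in ws *; rewrite (IHs t (tgt b)).
Qed.

Lemma pinit_take p i j : (i <= j)%N -> pinit (pinit p j) i = pinit p i.
Proof. by move=> ij; apply: qpath_inj => //; apply: take_takel. Qed.

Lemma pinit_succ p i : (i < plen p)%N ->
  exists al, pcomp (parrow al) (pinit p i) = Some (pinit p i.+1).
Proof.
move=> ip; have /pcomp_someP[e1 e2 e3] := pcomp_split (pinit p i.+1) i.
rewrite pinit_take // in e1 e2 e3; set w := pfinal _ i in e1 e3.
have: size (parrows w) = 1%N.
  by rewrite -/(plen w) plen_pfinal plen_pinit // subSnn.
case ew: (parrows w) => [|al [|//]] // _; exists al.
apply/pcomp_someP; split=> //; last by rewrite e3 ew.
by have := qpathP w; rewrite ew -e1 /= andbT => /eqP.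
Qed.

Lemma pend_path_eq p q : no_double_arrows G -> plen p = plen q ->
  (forall i, (i <= plen p)%N -> pend (pinit p i) = pend (pinit q i)) -> p = q.
Proof.
move=> nd lp h; apply: vertices_path_eq => //.
have sz r : size (pvertices r) = (plen r).+1 by rewrite /= size_map.
apply: (@eq_from_nth _ (pstart p)) => [|i]; rewrite !sz ?lp // ltnS => ip.
by rewrite -!pend_pinit ?h ?lp.
Qed.

End Paths.

(** * Polynomial functions on an affine space *)

Section RegularFunctions.
Import mpoly.
Variables (K : fieldType) (T : finType).
Implicit Types f g : {ffun T -> K} -> K.

(** Working with functions delays the choice of polynomials to the very end, where [rep_change]
    extracts one per coordinate. *)
Definition regular f : Prop := exists P : poly_on K T, forall k, poly_eval P k = f k.

Lemma regular_cst c : regular (fun=> c).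
Proof. by exists (mpoly.mpolyC _ c) => k; apply: mpoly.mevalC. Qed.

Lemma regular_var t : regular (fun k => k t).
Proof.
exists (poly_var K t) => k; rewrite /poly_eval /poly_var mpoly.mevalXU.
by rewrite enum_rankK.
Qed.

Lemma regularD f g : regular f -> regular g -> regular (fun k => f k + g k).
Proof.
move=> [P hP] [Q hQ].
by exists ((P : mpoly.mpoly #|T| K) + Q) => k; rewrite -hP -hQ; apply: mpoly.mevalD.
Qed.

Lemma regularM f g : regular f -> regular g -> regular (fun k => f k * g k).
Proof.
move=> [P hP] [Q hQ].
by exists ((P : mpoly.mpoly #|T| K) * Q) => k; rewrite -hP -hQ; apply: mpoly.mevalM.
Qed.

Lemma regular_eq f g : regular f -> f =1 g -> regular g.
Proof. by move=> [P hP] e; exists P => k; rewrite hP. Qed.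

Lemma regular_sum (R : Type) (r : seq R) (F : R -> {ffun T -> K} -> K) :
  (forall i, regular (F i)) -> regular (fun k => \sum_(i <- r) F i k).
Proof.
move=> rF; elim: r => [|i r IHr].
  by apply: regular_eq (regular_cst 0) _ => k; rewrite big_nil.
by apply: regular_eq (regularD (rF i) IHr) _ => k; rewrite big_cons.
Qed.

End RegularFunctions.

(* A sealed copy of [path_in]: unification would otherwise unfold it down to the
   monoid algebra. *)
Fact path_seal (K : fieldType) (G : quiver) (L : algType K)
  (pi : {rmorphism path_algebra K G -> L}) : {f | f = path_in pi}.
Proof. by exists (path_in pi). Qed.
Definition pth K G L pi := sval (@path_seal K G L pi).
Lemma pthE K G L pi : path_in pi = @pth K G L pi.
Proof. by rewrite /pth; case: path_seal. Qed.

(** * Coefficients at vertices and arrows, and the radical filtration *)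

Section Presentation.
Variables (K : fieldType) (G : quiver) (I : path_algebra K G -> Prop).
Variables (L : algType K) (pi : {rmorphism path_algebra K G -> L}).
Hypothesis I_admissible : admissible I.
Hypothesis pi_quotient : quotient_map I pi.
Implicit Types (p q r u v : qpath G) (al : arrow G) (e f : vertex G).
Implicit Types (a b : L).

Local Notation KG := (path_algebra K G).
Local Notation path_in := (pth pi).
Local Notation vx e := (path_in (pvertex e)).
Local Notation ar al := (path_in (parrow al)).

Lemma piZ c (g : KG) : pi (c *: g) = c *: pi g.
Proof. by have [h _ _] := pi_quotient; apply: h. Qed.

Lemma pi_surj a : exists g, pi g = a.
Proof. by have [_ h _] := pi_quotient. Qed.

Lemma pi_sum (g : KG) : pi g = \sum_(p <- msupp g) coef g p *: path_in p.
Proof.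
rewrite {1}(path_algebraE g) /lin_ext rmorph_sum; apply: eq_bigr => p _.
by rewrite -pthE; apply: piZ.
Qed.

(* The coefficients at paths of length at most one pass to L, since I is
   supported on longer paths. *)
Fact lowc_seal : {lc : qpath G -> L -> K |
  forall q (g : KG), (plen q < 2)%N -> lc q (pi g) = coef g q}.
Proof.
exists (fun q a => coef (projT1 (cid (pi_surj a))) q) => q g lq.
case: cid => h /= e; apply/eqP; rewrite -subr_eq0 -[_ - _]mcoeffB -/(coef _ _).
apply: contraLR lq => nz; rewrite -leqNgt.
have [_ I2 _] := I_admissible; apply: I2 nz.
by have [_ _ k] := pi_quotient; apply/k; rewrite raddfB /= e subrr.
Qed.
Definition lowc := sval lowc_seal.

Lemma lowcE q (g : KG) : (plen q < 2)%N -> lowc q (pi g) = coef g q.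
Proof. exact: (svalP lowc_seal). Qed.

Lemma lowcP q c a b : (plen q < 2)%N ->
  lowc q (c *: a + b) = c * lowc q a + lowc q b.
Proof.
move=> lq; have [g <-] := pi_surj a; have [h <-] := pi_surj b.
by rewrite -piZ -raddfD /= !lowcE // /coef mcoeffD mcoeffZ.
Qed.

Lemma lowc_path q p : (plen q < 2)%N -> lowc q (path_in p) = (p == q)%:R.
Proof. by move=> lq; rewrite -pthE lowcE // coef_path_elt. Qed.

(** The character of [L] at the vertex [e] (see [epsM]); its kernel is the annihilator of the simple
    module at [e]. *)
Definition eps e a := lowc (pvertex e) a.
(** Behaves like a derivation: [cfM] is a Leibniz rule twisted by the characters at the two ends of
    [al]. *)
Definition cf al a := lowc (parrow al) a.

Lemma epsP e c a b : eps e (c *: a + b) = c * eps e a + eps e b.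
Proof. exact: lowcP. Qed.
Lemma cfP al c a b : cf al (c *: a + b) = c * cf al a + cf al b.
Proof. exact: lowcP. Qed.
Lemma eps0 e : eps e 0 = 0.
Proof. by have := epsP e (-1) 0 0; rewrite scaler0 addr0 mulN1r addNr. Qed.
Lemma cf0 al : cf al 0 = 0.
Proof. by have := cfP al (-1) 0 0; rewrite scaler0 addr0 mulN1r addNr. Qed.
Lemma epsZ e c a : eps e (c *: a) = c * eps e a.
Proof. by have := epsP e c a 0; rewrite eps0 !addr0. Qed.
Lemma cfZ al c a : cf al (c *: a) = c * cf al a.
Proof. by have := cfP al c a 0; rewrite cf0 !addr0. Qed.
Lemma epsD e a b : eps e (a + b) = eps e a + eps e b.
Proof. by have := epsP e 1 a b; rewrite scale1r mul1r. Qed.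
Lemma cfD al a b : cf al (a + b) = cf al a + cf al b.
Proof. by have := cfP al 1 a b; rewrite scale1r mul1r. Qed.
Lemma epsN e a : eps e (- a) = - eps e a.
Proof. by rewrite -scaleN1r epsZ mulN1r. Qed.
Lemma cfN al a : cf al (- a) = - cf al a.
Proof. by rewrite -scaleN1r cfZ mulN1r. Qed.
Lemma epsB e a b : eps e (a - b) = eps e a - eps e b.
Proof. by rewrite epsD epsN. Qed.
Lemma cfB al a b : cf al (a - b) = cf al a - cf al b.
Proof. by rewrite cfD cfN. Qed.

Lemma eps_path e p : eps e (path_in p) = (p == pvertex e)%:R.
Proof. exact: lowc_path. Qed.
Lemma cf_path al p : cf al (path_in p) = (p == parrow al)%:R.
Proof. exact: lowc_path. Qed.

Lemma path_inM q p :
  path_in q * path_in p = if pcomp q p is Some r then path_in r else 0.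
Proof.
rewrite -pthE /Defs.path_in -rmorphM path_eltM /path_mul.
by case: (pcomp q p) => //; rewrite rmorph0.
Qed.

Lemma sum_vx : \sum_e vx e = 1.
Proof. by rewrite -pthE /Defs.path_in -rmorph_sum -[RHS](rmorph1 pi). Qed.

Lemma path_in_comp q p r : pcomp q p = Some r ->
  path_in q * path_in p = path_in r.
Proof. by rewrite path_inM => ->. Qed.

Lemma vx_mull e p : vx e * path_in p = if pend p == e then path_in p else 0.
Proof. by rewrite path_inM pcomp_vertexl; case: ifP. Qed.
Lemma vx_mulr e p : path_in p * vx e = if e == pstart p then path_in p else 0.
Proof. by rewrite path_inM pcomp_vertexr; case: ifP. Qed.

(** The image of the n-th power of the arrow ideal; it stands for the n-th power of J, and
    [jacobsonP] identifies [radn 1] with J. *)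
Definition radn n (a : L) : Prop := exists2 g : KG,
  (forall q, coef g q != 0 -> (n <= plen q)%N) & a = pi g.

Lemma radn_ind n (P : L -> Prop) :
  P 0 -> (forall c a b, P a -> P b -> P (c *: a + b)) ->
  (forall q, (n <= plen q)%N -> P (path_in q)) ->
  forall a, radn n a -> P a.
Proof.
move=> P0 PD Pq _ [g sg ->]; rewrite pi_sum big_seq.
elim/big_rec: _ => [//|p b]; rewrite -mcoeff_neq0 => /sg lp; apply: PD.
exact: Pq.
Qed.

Lemma radn_all a : radn 0 a.
Proof. by have [g <-] := pi_surj a; exists g. Qed.

Lemma radn_path n q : (n <= plen q)%N -> radn n (path_in q).
Proof.
move=> lq; exists (path_elt K q); last by rewrite -pthE.
move=> p; rewrite coef_path_elt; by have [<-|] := eqVneq q p; rewrite ?eqxx.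
Qed.

Lemma radn0 n : radn n 0.
Proof.
exists 0; last by rewrite raddf0.
by move=> q; rewrite /coef mcoeff0 eqxx.
Qed.

Lemma radnP n c a b : radn n a -> radn n b -> radn n (c *: a + b).
Proof.
move=> [g sg ->] [h sh ->]; exists (c *: g + h); last by rewrite raddfD /= piZ.
move=> q; apply: contraR; rewrite -ltnNge => lq.
have z (k : KG) : (forall q, coef k q != 0 -> (n <= plen q)%N) -> coef k q = 0.
  by move=> sk; apply/eqP; apply: contraLR lq => /sk; rewrite -leqNgt.
by rewrite /coef mcoeffD mcoeffZ -!/(coef _ _) !z // mulr0 addr0.
Qed.

Lemma radnZ n c a : radn n a -> radn n (c *: a).
Proof. by move=> ra; rewrite -[_ *: _]addr0; apply: radnP => //; apply: radn0. Qed.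
Lemma radnD n a b : radn n a -> radn n b -> radn n (a + b).
Proof. by rewrite -{2}[a]scale1r; apply: radnP. Qed.
Lemma radnN n a : radn n a -> radn n (- a).
Proof. by rewrite -scaleN1r; apply: radnZ. Qed.
Lemma radnB n a b : radn n a -> radn n b -> radn n (a - b).
Proof. by move=> ra /radnN; apply: radnD. Qed.

Lemma radn_le m n a : (m <= n)%N -> radn n a -> radn m a.
Proof. by move=> mn [g sg ->]; exists g => // q /sg; apply: leq_trans. Qed.

Lemma radnM m n a b : radn m a -> radn n b -> radn (m + n) (a * b).
Proof.
move=> ra rb; move: a ra; apply: radn_ind => [|c a a' h h'|q lq].
- by rewrite mul0r; apply: radn0.
- by rewrite mulrDl -scalerAl; apply: radnP.
move: b rb; apply: radn_ind => [|c b b' h h'|p lp].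
- by rewrite mulr0; apply: radn0.
- by rewrite mulrDr -scalerAr; apply: radnP.
rewrite path_inM; case e: (pcomp q p) => [r|]; last exact: radn0.
by apply: radn_path; rewrite (plen_comp e) addnC leq_add.
Qed.

Lemma radnMl n a b : radn n b -> radn n (a * b).
Proof. by move=> rb; have := radnM (radn_all a) rb. Qed.
Lemma radnMr n a b : radn n a -> radn n (a * b).
Proof. by move=> ra; have := radnM ra (radn_all b); rewrite addn0. Qed.

Lemma radnX n a : radn 1 a -> radn n (a ^+ n).
Proof.
move=> ra; elim: n => [|n IHn]; first exact: radn_all.
by rewrite exprS -add1n; apply: radnM.
Qed.

(** By admissibility all sufficiently long paths lie in [I]. *)
Lemma radn_nilpotent : exists n, forall a, radn n a -> a = 0.
Proof.
have [_ _ [m h]] := I_admissible; exists m.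
apply: radn_ind => // [c a b -> ->|q /h Iq]; first by rewrite scaler0 addr0.
by have [_ _ k] := pi_quotient; rewrite -pthE; apply/k.
Qed.

Lemma eps_radn e a : radn 1 a -> eps e a = 0.
Proof.
move: a; apply: radn_ind => [|c a b|q lq]; first exact: eps0.
  by rewrite epsP => -> ->; rewrite mulr0 addr0.
rewrite eps_path; case: eqP => // eq; move: lq; by rewrite eq.
Qed.

Lemma cf_radn al a : radn 2 a -> cf al a = 0.
Proof.
move: a; apply: radn_ind => [|c a b|q lq]; first exact: cf0.
  by rewrite cfP => -> ->; rewrite mulr0 addr0.
rewrite cf_path; case: eqP => // eq; move: lq; by rewrite eq.
Qed.

Lemma eps_decomp a : radn 1 (a - \sum_e eps e a *: vx e).
Proof.
move: a (radn_all a); apply: radn_ind => [|c a b ha hb|q _].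
- rewrite big1 ?subr0; first exact: radn0.
  by move=> e _; rewrite eps0 scale0r.
- under eq_bigr => e _ do rewrite epsP scalerDl -scalerA.
  by rewrite big_split /= -scaler_sumr opprD addrACA -scalerBr; apply: radnP.
case: (posnP (plen q)) => [q0|lq]; last first.
  apply: radnB; first exact: radn_path.
  rewrite big1; first exact: radn0.
  by move=> e _; rewrite eps_radn ?scale0r //; apply: radn_path.
have -> : q = pvertex (pstart q) by apply: qpath_inj => //; apply: size0nil.
move: (pstart q) => e; rewrite (bigD1 e) //= eps_path eqxx scale1r big1.
  by rewrite addr0 subrr; apply: radn0.
move=> f ne; rewrite eps_path qpathE /= /pstart /= [e == f]eq_sym (negPf ne).
by rewrite scale0r.
Qed.

Lemma radn1P a : radn 1 a <-> forall e, eps e a = 0.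
Proof.
split=> [ra e|z]; first exact: eps_radn.
have := eps_decomp a; rewrite big1 ?subr0 // => e _.
by rewrite z scale0r.
Qed.

Lemma path_trivial p : plen p = 0%N -> p = pvertex (pstart p).
Proof. by move=> p0; apply: qpath_inj => //; apply: size0nil. Qed.

Lemma eps_vx e f : eps e (vx f) = (f == e)%:R.
Proof. by rewrite eps_path qpathE andbT. Qed.

(** Bilinearity reduces the claim to two paths. A path of positive length contributes zero on both
    sides, and the vertices are orthogonal idempotents. *)
Lemma epsM e a b : eps e (a * b) = eps e a * eps e b.
Proof.
move: a (radn_all a); apply: radn_ind => [|c a a'|q _].
- by rewrite mul0r eps0 mul0r.
- by rewrite mulrDl -scalerAl !epsP => -> ->; rewrite mulrDl mulrA.
move: b (radn_all b); apply: radn_ind => [|c b b'|p _].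
- by rewrite mulr0 eps0 mulr0.
- by rewrite mulrDr -scalerAr !epsP => -> ->; rewrite mulrDr mulrCA.
have [q0|lq] := posnP (plen q); last first.
  by rewrite !(eps_radn _ (radnMr _ (radn_path lq))) eps_radn ?mul0r //; apply: radn_path.
have [p0|lp] := posnP (plen p); last first.
  by rewrite !(eps_radn _ (radnMl _ (radn_path lp))) (eps_radn _ (radn_path lp)) mulr0.
rewrite (path_trivial p0) (path_trivial q0) vx_mull !eps_vx.
have -> : pend (pvertex (pstart p)) = pstart p by [].
case: eqP => [<-|ne]; first by rewrite eps_vx -natrM mulnb andbb.
rewrite eps0 -natrM mulnb; case: andP => // -[/eqP e1 /eqP e2].
by case: ne; rewrite e1 e2.
Qed.

(** The path [al] factors only through a trivial path at its end or at its start; a product of two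
    paths of positive length has no coefficient at [al]. *)
Lemma cfM al a b :
  cf al (a * b) = eps (tgt al) a * cf al b + cf al a * eps (src al) b.
Proof.
have cfv f : cf al (vx f) = 0 by rewrite cf_path qpathE andbF.
move: a (radn_all a); apply: radn_ind => [|c a a'|q _].
- by rewrite mul0r eps0 cf0 !mul0r addr0.
- rewrite mulrDl -scalerAl epsP !cfP => -> ->; rewrite !mulrDl mulrDr !mulrA.
  by rewrite addrACA.
move: b (radn_all b); apply: radn_ind => [|c b b'|p _].
- by rewrite mulr0 eps0 cf0 !mulr0 addr0.
- rewrite mulrDr -scalerAr epsP !cfP => -> ->; rewrite !mulrDr.
  by rewrite -addrACA ![c * (_ * _)]mulrCA.
have [q0|lq] := posnP (plen q).
  rewrite (path_trivial q0); move: (pstart q) => f.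
  rewrite vx_mull eps_vx cfv mul0r addr0 cf_path.
  have [->|ne] := eqVneq p (parrow al).
    have -> : pend (parrow al) = tgt al by [].
    by rewrite eq_sym; case: eqP => _; rewrite ?cf_path ?eqxx ?mulr1 // cf0.
  by rewrite mulr0; case: eqP; rewrite ?cf0 // cf_path (negPf ne).
rewrite (eps_radn _ (radn_path lq)) mul0r add0r.
have [p0|lp] := posnP (plen p).
  rewrite (path_trivial p0); move: (pstart p) => f.
  rewrite vx_mulr eps_vx cf_path.
  have [->|ne] := eqVneq q (parrow al).
    have -> : pstart (parrow al) = src al by [].
    by case: eqP => _; rewrite ?cf_path ?eqxx ?mul1r // cf0.
  by rewrite mul0r; case: eqP; rewrite ?cf0 // cf_path (negPf ne).
rewrite (eps_radn _ (radn_path lp)) mulr0; apply: cf_radn.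
exact: (radnM (radn_path lq) (radn_path lp)).
Qed.

Lemma vx_vx e f : vx e * vx f = if f == e then vx e else 0.
Proof.
rewrite vx_mull; have -> : pend (pvertex f) = f by [].
by case: eqP => // ->.
Qed.

Lemma eps1 e : eps e 1 = 1.
Proof.
rewrite -sum_vx (bigD1 e) //= epsD eps_vx eqxx -[RHS]addr0; congr (_ + _).
elim/big_rec: _ => [|f a ne h]; first exact: eps0.
by rewrite epsD h eps_vx (negPf ne) addr0.
Qed.

Lemma cf_vx al e : cf al (vx e) = 0.
Proof. by rewrite cf_path qpathE andbF. Qed.

Lemma cf1 al : cf al 1 = 0.
Proof.
rewrite -sum_vx; elim/big_rec: _ => [|e a _ h]; first exact: cf0.
by rewrite cfD h cf_vx addr0.
Qed.

(** Splits the first arrow off every path; this is how one passes from a radical layer to the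
    next. *)
Lemma radn_arrows n a : radn n.+1 a ->
  exists b : arrow G -> L, (forall al, radn n (b al)) /\
    a = \sum_al b al * ar al.
Proof.
move: a; apply: radn_ind => [|c a a' [b [rb ->]] [b' [rb' ->]]|q lq].
- exists (fun=> 0); split=> [al|]; first exact: radn0.
  by rewrite big1 // => al _; rewrite mul0r.
- exists (fun al => c *: b al + b' al); split=> [al|]; first exact: radnP.
  by rewrite scaler_sumr -big_split; apply: eq_bigr => al _; rewrite mulrDl scalerAl.
have /pcomp_someP[e1 e2 e3] := pcomp_split q 1.
case E: (parrows q) lq => [|al s] lq; first by move: lq; rewrite /plen E.
have ea : pinit q 1 = parrow al.
  apply: qpath_inj; first by have := qpathP q; rewrite E /= => /andP[/eqP].
  have -> : parrows (pinit q 1) = take 1 (parrows q) by [].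
  by rewrite E /= take0.
exists (fun be => if be == al then path_in (pfinal q 1) else 0); split=> [be|].
  case: eqP => _; last exact: radn0.
  by apply: radn_path; rewrite plen_pfinal leq_subRL ?add1n //; apply: leq_trans lq.
rewrite (bigD1 al) //= eqxx big1 ?addr0 => [|be /negPf->]; last by rewrite mul0r.
by rewrite -ea (path_in_comp (pcomp_split q 1)).
Qed.

Lemma unit_plus_rad c a : c != 0 -> radn 1 a -> exists b, b * (c%:A + a) = 1.
Proof.
move=> c0 ra; have [n rn] := radn_nilpotent.
pose s : L := - (c^-1 *: a).
exists (c^-1 *: \sum_(i < n) s ^+ i).
have -> : c%:A + a = c *: (1 - s).
  by rewrite scalerBr /s scalerN opprK scalerA divff // scale1r.
rewrite -scalerAl -scalerAr scalerA mulVf // scale1r geometric_sum (rn (s ^+ n)) ?subr0 //.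
by apply: radnX; apply: radnN; apply: radnZ.
Qed.

(** The kernel of each [eps e] is a maximal left ideal, which bounds J from above. Conversely, if a
    maximal left ideal missed an [a] in [radn 1], it would contain some 1 - c a, which is left
    invertible because c a is nilpotent. *)
Lemma jacobsonP a : jacobson a <-> radn 1 a.
Proof.
split=> [ja|ra M [[M0 MP] [z nz] maxM]].
  apply/radn1P => e; apply: (ja (fun a => eps e a = 0)); split.
  - split=> [|x b y hb hy]; first exact: eps0.
    by rewrite epsD [x *: b]/(x * b) epsM hb hy mulr0 addr0.
  - by exists 1 => /eqP; rewrite eps1 oner_eq0.
  move=> M' [M0 MP] sM; case: (pselect (exists2 z, M' z & eps e z != 0)).
    case=> z Mz nz; right=> b; pose c := eps e b / eps e z.
    have -> : b = c%:A * z + (b - c%:A * z) by rewrite addrC subrK.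
    apply: MP => //; apply: sM; rewrite mulr_algl epsB epsZ.
    by rewrite mulrVK ?unitfE // subrr.
  move=> n; left=> x Mx; apply: contrapT => nx; apply: n; exists x => //.
  exact/eqP.
pose M' (x : L^o) := exists2 b, M b & exists c : L, x = b + c * a.
case: (maxM M'); first split.
- by exists 0 => //; exists 0; rewrite mul0r addr0.
- move=> x _ _ [b Mb [c ->]] [b' Mb' [c' ->]]; exists (x *: b + b'); first exact: MP.
  by exists (x * c + c'); rewrite scalerDr addrACA mulrDl -mulrA.
- by move=> x Mx; exists x => //; exists 0; rewrite mul0r addr0.
- by apply; exists 0 => //; exists 1; rewrite mul1r add0r.
case/(_ 1) => b Mb [c e]; case: nz; have [||d hd] := @unit_plus_rad 1 (- (c * a)).
- exact: oner_neq0.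
- by apply: radnN; apply: radnMl.
move: hd; rewrite scale1r {1}e addrK => hd.
have -> : z = ((z : L) * d) *: b + 0.
  rewrite addr0 -[LHS]mulr1 -hd mulrA; reflexivity.
exact: MP.
Qed.

(** * Modules *)

Lemma presents_exists (N : L -> Prop) : @submodule L L^o N ->
  exists (M : lmodType L) (x : M), presents x N.
Proof. by move/left_ideal_quotient=> [M [x h]]; exists M, x. Qed.

Section OneModule.
Variable U : lmodType L.
Implicit Types x y z : U.

Lemma scaleZl c a x : (c *: a) *: x = c *.: (a *: x).
Proof. by rewrite scalerA mulr_algl. Qed.

Lemma scaleCl c a x : a *: (c *.: x) = c *.: (a *: x).
Proof. by rewrite !scalerA mulr_algr mulr_algl. Qed.

Lemma scale0C x : 0 *.: x = 0. Proof. by rewrite !scale0r. Qed.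
Lemma scaleCD c d x : (c + d) *.: x = c *.: x + d *.: x.
Proof. by rewrite !scalerDl. Qed.
Lemma scaleCM c d x : (c * d) *.: x = c *.: (d *.: x).
Proof. by rewrite scalerA mulr_algl scalerA. Qed.

Lemma scaleVK c x : c != 0 -> c^-1 *.: (c *.: x) = x.
Proof. by move=> c0; rewrite scalerA mulr_algl scalerA mulVf // !scale1r. Qed.

Lemma scalePl c a b x : (c *: a + b) *: x = c *.: (a *: x) + b *: x.
Proof. by rewrite scalerDl scaleZl. Qed.

Lemma act_vx e x a : x = vx e *: x ->
  exists2 r, radn 1 r & a *: x = eps e a *.: x + r *: x.
Proof.
move=> ex; exists ((a - (eps e a)%:A) * vx e).
  apply/radn1P => f; rewrite epsM eps_vx; case: eqP => [<-|_]; last by rewrite mulr0.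
  by rewrite epsB epsZ eps1 !mulr1 subrr.
by rewrite -scalerA -ex -scalerDl addrC subrK.
Qed.

Definition in_rad x n y : Prop := exists2 a, radn n a & y = a *: x.

Lemma in_rad_submodule x n : submodule (in_rad x n).
Proof.
split=> [|a y z [b rb ->] [c rc ->]].
  by exists 0; rewrite ?scale0r //; apply: radn0.
exists (a * b + c); last by rewrite scalerDl scalerA.
by apply: radnD => //; apply: radnMl.
Qed.

Lemma in_rad_le x m n y : (m <= n)%N -> in_rad x n y -> in_rad x m y.
Proof. by move=> mn [a ra ->]; exists a => //; apply: radn_le ra. Qed.

Lemma in_radM x m n a y : radn m a -> in_rad x n y -> in_rad x (m + n) (a *: y).
Proof.
by move=> ra [b rb ->]; exists (a * b); rewrite ?scalerA //; apply: radnM.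
Qed.

Lemma in_rad_radn x n a : radn n a -> in_rad x n (a *: x).
Proof. by exists a. Qed.

Lemma in_rad0E x y : in_rad x 0 y <-> exists a, y = a *: x.
Proof. by split=> [[a _ e]|[a e]]; exists a => //; apply: radn_all. Qed.

Definition generator e x : Prop :=
  [/\ x = vx e *: x, x != 0 & forall y, exists a, y = a *: x].

(** Replaces the iterated submodules J(J(...U)) by J^n x, so that each member comes with an explicit
    element of [radn n]. *)
Lemma rad_powE e x n y : generator e x -> (rad_pow n y <-> in_rad x n y).
Proof.
move=> [_ _ gx]; elim: n y => [|n IHn] y.
  by split=> // _; apply/in_rad0E.
have sub : submodule (@rad_pow L U n.+1) by apply: generated_submodule.
split=> [h|[a ra ->]].
  apply: h; first exact: in_rad_submodule.
  move=> _ [a [z [/jacobsonP ra /IHn jz ->]]].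
  by rewrite -add1n; apply: in_radM.
move: a ra; apply: radn_ind => [|c a b ha hb|q lq].
- by rewrite scale0r; apply: submodule0.
- by rewrite scalerDl scaleZl; exact: (submoduleD sub (submoduleZ _ sub ha) hb).
(* The first [n] arrows of [q] land in J^n U by induction; the rest has positive length and supplies
   the factor from J. *)
rewrite -(path_in_comp (pcomp_split q n)) -scalerA.
move=> N sN h; apply: h; exists (path_in (pfinal q n)), (path_in (pinit q n) *: x).
split=> //; first by apply/jacobsonP/radn_path; rewrite plen_pfinal subn_gt0.
by apply/IHn/in_rad_radn/radn_path; rewrite plen_pinit // ltnW.
Qed.

(** Nakayama for a single vector: iterating x = a x reaches a power of [a] that vanishes. *)
Lemma radn_fix x a : radn 1 a -> x = a *: x -> x = 0.
Proof.
move=> ra ex; have [n rn] := radn_nilpotent.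
suff <- : a ^+ n *: x = x by rewrite (rn (a ^+ n)) ?scale0r //; apply: radnX.
by elim: n {rn} => [|n IHn]; rewrite ?scale1r // exprSr -scalerA -ex.
Qed.

Lemma generator_notin_rad e x : generator e x -> ~ in_rad x 1 x.
Proof. by move=> [_ /eqP x0 _] [a ra /(radn_fix ra)]. Qed.

Lemma generator_notin_radE e x a : generator e x -> in_rad x 1 (a *: x) <-> eps e a = 0.
Proof.
move=> gx; have [ex x0 _] := gx; have [r rr ea] := act_vx a ex.
split=> [h|z]; last by rewrite ea z scale0r scale0r add0r; apply: in_rad_radn.
apply/eqP; apply: contra_notT (generator_notin_rad gx) => nz.
have h' : in_rad x 1 (eps e a *.: x).
  rewrite -[_ *.: x](addrK (r *: x)) -ea; apply: submoduleB => //; first exact: in_rad_submodule.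
  exact: in_rad_radn.
have {2}-> : x = (eps e a)^-1 *.: (eps e a *.: x).
  by rewrite scaleVK.
exact: (submoduleZ _ (in_rad_submodule x 1) h').
Qed.

Lemma vx_generates e y a : y = vx e *: y -> eps e a != 0 ->
  exists b, y = b *: (a *: y).
Proof.
move=> ey nz; have [r rr ->] := act_vx a ey.
have [b eb] := unit_plus_rad nz rr.
by exists b; rewrite -scalerDl scalerA eb scale1r.
Qed.

Lemma generator_top e x y f : generator e x -> ~ in_rad x 1 y -> y = vx f *: y ->
  generator f y.
Proof.
move=> gx ny ey; have [ex x0 gg] := gx; split=> //.
  by apply: contra_notN ny => /eqP->; apply: submodule0; apply: in_rad_submodule.
have [a ea] := gg y; have nz : eps e a != 0.
  by apply/eqP => z; apply: ny; rewrite ea; apply/(generator_notin_radE a gx).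
have [b eb] := vx_generates ex nz; rewrite -ea in eb.
by move=> z; have [c ->] := gg z; exists (c * b); rewrite -scalerA -eb.
Qed.

(** The chain condition is used through this maximum: it selects a generator, the vertex of the
    generator, and each next arrow of a mast. *)
Lemma uniserial_max (s : seq U) : uniserial U -> s != [::] ->
  exists2 x, x \in s & forall y, y \in s -> exists a, y = a *: x.
Proof.
move=> [_ _ ch]; elim: s => // x s IHs _.
have [->|/IHs[y ys h]] := eqVneq s [::].
  exists x => [|y]; rewrite inE ?eqxx // => /eqP->.
  by exists 1; rewrite scale1r.
have [c|c] := ch _ _ (submodule_cyclic x) (submodule_cyclic y).
  exists y => [|z]; rewrite inE ?ys ?orbT // => /orP[/eqP->|/h//].
  by apply: c; exists 1; rewrite scale1r.
exists x => [|z]; rewrite inE ?eqxx // => /orP[/eqP->|/h[a ->]].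
  by exists 1; rewrite scale1r.
by apply: c; exists a.
Qed.

Lemma uniserial_generator : uniserial U -> exists e x, generator e x.
Proof.
move=> uU; have [[n [g gg]] [z0 nz0] _] := uU.
have sne (T : finType) (h : T -> U) (t : T) : [seq h t | t <- enum T] != [::].
  apply: contraTneq (mem_enum T t) => e; move/eqP: e.
  by rewrite -size_eq0 size_map => /nilP->.
have [x [gx x0]] : exists x, (forall y, exists a, y = a *: x) /\ x != 0.
  case: n g gg => [|n] g gg.
    by have [c] := gg z0; rewrite big_ord0 => e; rewrite e eqxx in nz0.
  have [x xs h] := uniserial_max uU (sne _ g ord0).
  have gx y : exists a, y = a *: x.
    have [c ->] := gg y; apply: (submodule_sum _ (submodule_cyclic x)) => i.
    apply: (submoduleZ _ (submodule_cyclic x)).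
    by apply: h; apply: map_f; rewrite mem_enum.
  exists x; split=> //; apply: contra_neq nz0 => x0.
  by have [a ->] := gx z0; rewrite x0 scaler0.
have [e0 _] : exists e0 : vertex G, True.
  apply: contrapT => ne; case/eqP: x0; rewrite -[x]scale1r -sum_vx big1 ?scale0r // => e.
  by case: ne; exists e.
have [y /mapP[e _ ey] h] := uniserial_max uU (sne _ (fun e => vx e *: x) e0).
exists e, y; have gy z : exists a, z = a *: y.
  have [a ->] := gx z; apply: (submoduleZ _ (submodule_cyclic y)).
  rewrite -[x]scale1r -sum_vx scaler_suml.
  apply: (submodule_sum _ (submodule_cyclic y)).
  by move=> f; apply: h; apply: map_f; rewrite mem_enum.
split=> //; first by rewrite {2}ey scalerA vx_vx eqxx.
by apply: contra_neq nz0 => y0; have [a ->] := gy z0; rewrite y0 scaler0.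
Qed.

Lemma generator_top_element e x : generator e x -> top_element pi x.
Proof.
move=> gx; split; first by move/(rad_powE 1 x gx); apply: generator_notin_rad gx.
by exists e; rewrite pthE; case: gx.
Qed.

Lemma top_element_generator x : uniserial U -> top_element pi x ->
  exists e, generator e x.
Proof.
move=> uU [nx [e ex]]; have [e0 [x0 gx0]] := uniserial_generator uU.
exists e; apply: (generator_top gx0); last by rewrite -pthE.
by move/(rad_powE 1 x gx0).
Qed.

Lemma path_in_start p e x : x = vx e *: x -> path_in p *: x != 0 -> pstart p = e.
Proof.
move=> ex; rewrite [in X in X -> _]ex scalerA vx_mulr.
by case: (eqVneq e) => // _; rewrite scale0r eqxx.
Qed.

Lemma path_in_src al e x : x = vx e *: x -> ar al *: x != 0 -> src al = e.
Proof. exact: (@path_in_start (parrow al)). Qed.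

(** * Masts and the basis attached to a top element *)

Local Notation vec p i x := (path_in (pinit p i) *: x).

Lemma vec_split p i x : path_in p *: x = path_in (pfinal p i) *: vec p i x.
Proof. by rewrite scalerA (path_in_comp (pcomp_split p i)). Qed.

(** The property that can be maintained while a mast is grown arrow by arrow in
    [uniserial_mast_at]. *)
Definition layered p x : Prop :=
  forall i a, (i <= plen p)%N -> radn i a -> exists b, a *: x = b *: vec p i x.

(* p is a mast of U and x is a top element of U. *)
Definition mast_at p x : Prop :=
  [/\ generator (pstart p) x, layered p x, path_in p *: x != 0
    & forall a, radn (plen p).+1 a -> a *: x = 0].

Lemma layered_succ p x a : layered p x -> radn (plen p).+1 a ->
  exists2 b, radn 1 b & a *: x = b *: (path_in p *: x).
Proof.
move=> lay; move: a; apply: radn_ind => [|c a a' [b rb e] [b' rb' e']|q lq].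
- by exists 0; rewrite ?scale0r //; apply: radn0.
- exists (c *: b + b'); first exact: radnP.
  by rewrite !scalePl e e'.
have [b e] := lay (plen p) _ (leqnn _) (radn_path (eq_leq (esym (plen_pinit (ltnW lq))))).
exists (path_in (pfinal q (plen p)) * b).
  by apply: radnMr; apply: radn_path; rewrite plen_pfinal subn_gt0.
by rewrite (vec_split q (plen p)) e scalerA pinit_all.
Qed.

(** Greedy construction: as long as some arrow does not annihilate p x, extend [p] by the arrow
    whose image of p x generates the images under all arrows. *)
Lemma uniserial_mast_at e x : uniserial U -> generator e x -> exists p, mast_at p x.
Proof.
move=> uU gx; have [n rn] := radn_nilpotent; have [ex x0 gg] := gx.
(* Either the growth has stopped or it has produced a path of the given length; the latter is absurd
   at the nilpotency index. *)
suff /(_ n)[//|[p [_ _ nz lp]]] : forall n, (exists p, mast_at p x) \/ exists p,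
    [/\ generator (pstart p) x, layered p x, path_in p *: x != 0 & plen p = n].
  case/eqP: nz; rewrite (rn (path_in p)) ?scale0r //.
  by apply: radn_path; rewrite lp.
elim=> [|{rn}n [?|[p [gp lay nz lp]]]]; [right | by left |].
  exists (pvertex e); split=> //; rewrite -?ex //.
  move=> i a; rewrite leqn0 => /eqP-> _; exists a.
  have -> : pinit (pvertex e) 0 = pvertex e by apply: qpath_inj.
  by rewrite -ex.
pose y := path_in p *: x; have ey : y = vx (pend p) *: y by rewrite scalerA vx_mull eqxx.
have [none|] := pselect (forall al, ar al *: y = 0).
  left; exists p; split=> // a /(layered_succ lay)[b /radn_arrows[d [_ ->]] ->].
  rewrite scaler_suml big1 // => al _.
  by rewrite -scalerA none scaler0.
move/existsNP=> [be /eqP nbe]; right.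
have [|z /mapP[al _ ez] h] := uniserial_max (s := [seq ar al *: y | al <- enum (arrow G)]) uU.
  apply: contraTneq (mem_enum (arrow G) be) => e1; move/eqP: e1.
  by rewrite -size_eq0 size_map => /nilP->.
have z0 : z != 0.
  apply: contra_neq nbe => z0; have [|a ->] := h (ar be *: y); last by rewrite z0 scaler0.
  by apply: map_f; rewrite mem_enum.
have sal : src al = pend p by apply: path_in_src ey _; rewrite -ez.
have [p' ep'] : exists p', pcomp (parrow al) p = Some p' by apply: pcomp_defined; rewrite -sal.
have [_ sp' _] := (pcomp_someP _ _ _).1 ep'.
have lp' : plen p' = n.+1 by rewrite (plen_comp ep') lp addn1.
have ez' : z = path_in p' *: x by rewrite ez scalerA (path_in_comp ep').
exists p'; split; rewrite ?sp' -?ez' // => i a; rewrite lp' leq_eqVlt => /orP[/eqP->|ip].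
  have -> : pinit p' n.+1 = p' by rewrite -lp' pinit_all.
  rewrite -ez' -lp; move/(layered_succ lay)=> [b /radn_arrows[d [_ ->]] ->].
  rewrite scaler_suml.
  apply: (submodule_sum _ (submodule_cyclic z)) => be'; rewrite -scalerA.
  apply: (submoduleZ _ (submodule_cyclic z)); apply: h.
  by apply: map_f; rewrite mem_enum.
by move=> ra; rewrite (pinit_comp ep') ?lp //; apply: lay; rewrite ?lp.
Qed.

(** The layer J^i x / J^(i+1) x is one-dimensional, so a vector with nonzero image in it is a
    nonzero multiple of the basis vector up to an action of J, and this can be inverted. *)
Lemma mast_generates p x i a c : mast_at p x -> radn i a -> ~ in_rad x i.+1 (a *: x) ->
  radn i c -> exists b, c *: x = b *: (a *: x).
Proof.
move=> [gx lay _ kill] ra na rc; have [ip|ip] := leqP i (plen p); last first.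
  by case: na; rewrite kill; [apply: submodule0; apply: in_rad_submodule | apply: radn_le ra].
have [b eb] := lay i a ip ra; have [d ed] := lay i c ip rc.
have ev : vec p i x = vx (pend (pinit p i)) *: vec p i x.
  by rewrite scalerA vx_mull eqxx.
have nz : eps (pend (pinit p i)) b != 0.
  apply/eqP => z; apply: na; rewrite eb.
  have [r rr ->] := act_vx b ev; rewrite z !scale0r add0r -add1n.
  by apply: in_radM => //; apply/in_rad_radn/radn_path; rewrite plen_pinit.
have [f ef] := vx_generates ev nz; exists (d * f).
by rewrite ed {1}ef -eb scalerA.
Qed.

(** Once [x] has some mast, the layer condition for another path [q] follows from
    [mast_generates]. *)
Lemma mast_change p q x : mast_at p x -> path_in q *: x != 0 ->
  (forall a, radn (plen q).+1 a -> a *: x = 0) -> mast_at q x.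
Proof.
move=> mp nz kill; have [gx _ _ _] := mp; have [ex _ _] := gx.
have sq := path_in_start ex nz; split=> //; first by rewrite sq.
move=> i a iq ra; apply: (mast_generates mp (i := i)) => //.
  by apply: radn_path; rewrite plen_pinit.
move=> [b rb eb]; case/eqP: nz; rewrite (vec_split q i) eb scalerA; apply: kill.
rewrite -(subnK iq) -addnS; apply: radnM => //.
by apply: radn_path; rewrite plen_pfinal.
Qed.

Lemma mast_vec_notin p x i : mast_at p x -> (i <= plen p)%N -> ~ in_rad x i.+1 (vec p i x).
Proof.
move=> [_ _ nz kill] ip [b rb eb]; case/eqP: nz.
rewrite (vec_split p i) eb scalerA; apply: kill.
rewrite -(subnK ip) -addnS; apply: radnM => //.
by apply: radn_path; rewrite plen_pfinal.
Qed.

Lemma mast_layer p x i a : mast_at p x -> (i <= plen p)%N -> radn i a ->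
  exists c (r : L), radn i.+1 r /\ a *: x = c *.: vec p i x + r *: x.
Proof.
move=> [gx lay _ _] ip ra; have [b ->] := lay i a ip ra.
have ev : vec p i x = vx (pend (pinit p i)) *: vec p i x.
  by rewrite scalerA vx_mull eqxx.
have [r rr ->] := act_vx b ev.
exists (eps (pend (pinit p i)) b), (r * path_in (pinit p i)); rewrite scalerA; split=> //.
by rewrite -add1n; apply: radnM => //; apply: radn_path; rewrite plen_pinit.
Qed.

Lemma mast_coord p x i a : mast_at p x -> radn i a ->
  exists c : nat -> K, a *: x = \sum_(i <= j < (plen p).+1) c j *.: vec p j x.
Proof.
move=> mp; have [_ _ _ kill] := mp.
have [n] := ubnP ((plen p).+1 - i); elim: n i a => // n IHn i a.
have [ip|ip] := leqP i (plen p); last first.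
  by move=> _ ra; exists (fun=> 0); rewrite big_geq // kill //; apply: radn_le ra.
rewrite subSn // ltnS => lt ra; have [c [r [rr ->]]] := mast_layer mp ip ra.
have [|d ->] := IHn i.+1 r _ rr; first by rewrite subSS.
exists (fun j => if j == i then c else d j).
rewrite [RHS]big_ltn // eqxx; congr (_ + _).
by apply: eq_big_nat => j /andP[ij _]; rewrite gtn_eqF.
Qed.

Lemma mast_indep p x i a (c : nat -> K) : mast_at p x -> radn i a ->
  a *: x = \sum_(0 <= j < (plen p).+1) c j *.: vec p j x ->
  forall j, (j < i)%N -> (j <= plen p)%N -> c j = 0.
Proof.
move=> mp ra ea j; have [_ _ nz kill] := mp.
elim/ltn_ind: j => j IHj ji jp; apply/eqP; apply: contra_notT (elimN eqP nz) => nc.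
(* The final part of [p] after position [j] sends the j-th basis vector to p x and annihilates all
   deeper layers; this isolates the lowest nonzero coordinate. *)
have k0 b m : (m > j)%N -> radn m b -> path_in (pfinal p j) *: (b *: x) = 0.
  move=> jm rb; rewrite scalerA; apply: kill; apply: (@radn_le _ (plen p - j + m)).
    by rewrite -{1}(subnK jp) -addnS leq_add2l.
  by apply: radnM => //; apply: radn_path; rewrite plen_pfinal.
have : path_in (pfinal p j) *: (a *: x) = 0 by apply: (k0 _ i).
rewrite ea scaler_sumr (bigD1_seq j) ?iota_uniq ?mem_index_iota //=.
rewrite big_seq_cond big1 ?addr0 => [|m /andP[]].
  by rewrite scaleCl -vec_split => e; rewrite -[LHS](scaleVK _ nc) e scaler0.
rewrite mem_index_iota /= ltnS => mp' ne; rewrite scaleCl.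
have [mj|jm|ejm] := ltngtP m j; last by rewrite ejm eqxx in ne.
  by rewrite IHj ?scale0r ?scale0r // (ltn_trans mj ji).
by rewrite (k0 _ m) ?scaler0 //; apply: radn_path; rewrite plen_pinit.
Qed.

(** Descend until [N] contains a vector of J^i x outside J^(i+1) x; by [mast_generates] this vector
    generates J^i x. *)
Lemma mast_submodule p x (N : U -> Prop) : mast_at p x -> submodule N ->
  exists i, (forall y, N y <-> in_rad x i y) /\ (i <= (plen p).+1)%N.
Proof.
move=> mp sN; have [[_ _ gx] _ _ kill] := mp.
suff [[i [ip h]]|h] : (exists i, (i <= plen p)%N /\ forall y, N y <-> in_rad x i y) \/
    (forall y, N y -> in_rad x (plen p).+1 y).
- by exists i; split=> //; apply: leqW.
- exists (plen p).+1; split=> // y; split=> [/h//|[a /kill z ->]].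
  by rewrite z; apply: submodule0.
suff H n : (n <= (plen p).+1)%N ->
  (exists i, (i <= plen p)%N /\ forall y, N y <-> in_rad x i y) \/
  (forall y, N y -> in_rad x n y) by exact: H.
elim: n => [_|n IHn np]; first by right=> y _; apply/in_rad0E.
have [|?|h] := IHn; [exact: ltnW | by left |].
have [|/existsNP[y /not_implyP[Ny ny]]] := pselect (forall y, N y -> in_rad x n.+1 y).
  by right.
left; exists n; split=> // z; split=> [/h//|[c rc ->]].
have [a ra ey] := h y Ny; rewrite ey in Ny ny.
by have [b ->] := mast_generates mp ra ny rc; apply: submoduleZ.
Qed.

Lemma mast_uniserial p x : mast_at p x -> uniserial U.
Proof.
move=> mp; have [[_ x0 gx] _ _ _] := mp; split; last first.
- move=> N N' sN sN'; have [i [hN _]] := mast_submodule mp sN.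
  have [j [hN' _]] := mast_submodule mp sN'.
  have [ij|ji] := leqP i j; [right|left] => y.
    by move/hN' => h; apply/hN; apply: in_rad_le h.
  by move/hN => h; apply/hN'; apply: in_rad_le h; apply: ltnW.
- by exists x.
exists 1%N, (fun=> x) => y; have [a ->] := gx y.
by exists (fun=> a); rewrite big_ord_recl big_ord0 addr0.
Qed.

End OneModule.

(** * Simple modules, layers and composition length *)

Local Notation vec p i x := (path_in (pinit p i) *: x).

(** The simple module at [e], as [L] modulo the kernel of a character; [simple_atP] links this form
    to Le/Je. *)
Definition line e (S : lmodType L) : Prop :=
  exists s : S, presents s (fun a => eps e a = 0).

Lemma presents_eps e (S : lmodType L) (s : S) : presents s (fun a => eps e a = 0) ->
  [/\ s != 0, forall y, exists c, y = c *.: s & forall a, a *: s = eps e a *.: s].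
Proof.
move=> [gs hs]; have act a : a *: s = eps e a *.: s.
  apply/eqP; rewrite -subr_eq0 -scalerBl; apply/eqP/hs.
  by rewrite epsB epsZ eps1 mulr1 subrr.
split=> // [|y]; last by have [a ->] := gs y; exists (eps e a).
apply/eqP => s0; have := (hs 1).1; rewrite s0 scaler0 eps1 => /(_ erefl)/eqP.
by rewrite oner_eq0.
Qed.

Lemma line_simple e (S : lmodType L) : line e S -> simple S.
Proof.
move=> [s /presents_eps[s0 gs act]]; split=> //; first by exists s.
move=> N sN _; have [z|/existsNP[y /not_implyP[Ny y0]]] := pselect (forall y, N y -> y = 0).
  by left.
right=> z _; have [c ec] := gs y; have [d ->] := gs z.
apply: (submoduleZ _ sN); have c0 : c != 0.
  by apply: contra_not_neq y0 => c0; rewrite ec c0 scale0r scale0r.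
have -> : s = c^-1 *.: y.
  by rewrite ec scaleVK.
exact: submoduleZ.
Qed.

Lemma line_isom e (S S' : lmodType L) : line e S -> line e S' -> isom S S'.
Proof. by move=> [s ps] [s' ps']; apply: isom_presents ps ps'. Qed.

Lemma line_exists e : exists S, line e S.
Proof.
have [|S [s ps]] := @presents_exists (fun a => eps e a = 0); last by exists S, s.
split=> [|a x y hx hy]; first exact: eps0.
by rewrite epsD [a *: x]/((a : L) * x) epsM hx hy mulr0 addr0.
Qed.

Lemma line_uniq e f (S : lmodType L) : line e S -> line f S -> e = f.
Proof.
move=> [s /presents_eps[s0 _ act]] [t /presents_eps[t0 gt actt]].
have [c ec] := gt s; have := act (vx f); rewrite {1}ec scaleCl actt -scaleCl -ec.
rewrite !eps_vx eqxx !scale1r; case: eqP => // _ /eqP.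
by rewrite !scale0r (negPf s0).
Qed.

(** J annihilates [S] by minimality and Nakayama, and some vertex does not; the action then factors
    through the character of that vertex. *)
Lemma simple_line S : simple S -> exists e, line e S.
Proof.
move=> sS; have [_ [x _ x0] minS] := sS.
have J0 (y : S) a : radn 1 a -> a *: y = 0.
  move=> ra; have [->|y0] := eqVneq y 0; first by rewrite scaler0.
  have [z|h] := minS _ (in_rad_submodule y 1) (fun _ _ => Logic.I).
    by apply: z; exists a.
  have [b rb eb] := h y Logic.I.
  by case/eqP: y0; apply: radn_fix rb eb.
have [e ne] : exists e, vx e *: x != 0.
  apply: contrapT => /forallNP h; case/eqP: x0.
  rewrite -[x]scale1r -sum_vx scaler_suml big1 // => e _.
  by apply/eqP; apply: contrapT => /negP; apply: h.
exists e, (vx e *: x); set s := vx e *: x in ne *.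
have es : s = vx e *: s by rewrite scalerA vx_vx eqxx.
split=> [|a]; first exact: simple_cyclic.
have [r rr ->] := act_vx a es; rewrite J0 // addr0; split=> [h|->]; last by rewrite !scale0r.
by apply/eqP; apply: contraNT ne => nz; rewrite -[s](scaleVK _ nz) h scaler0.
Qed.

Lemma simple_atP e S : simple_at pi e S <-> line e S.
Proof.
rewrite /simple_at pthE.
have gX (y : L^o) : (exists b, y = b * vx e) <-> exists a, y = a *: (vx e : L^o).
  by split=> -[b ->]; exists b.
have hY (a : L) : (exists2 b, jacobson b & a *: (vx e : L^o) = b * vx e) <-> eps e a = 0.
  split=> [[b /jacobsonP rb]|z].
    move/(congr1 (eps e)); rewrite [_ *: _]/(a * vx e) !epsM eps_vx eqxx !mulr1 => ->.
    exact: eps_radn.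
  exists (a * vx e); last by rewrite -mulrA vx_vx eqxx.
  apply/jacobsonP/radn1P => f; rewrite epsM eps_vx.
  by case: eqP => [<-|_]; rewrite ?mulr0 // z mul0r.
split=> [fS|[s ps]].
  have [s ps] := presents_factor_isom fS gX; exists s; exact: presents_eq ps hY.
apply: factor_isom_presents ps => //.
- split=> [|a x y [b rb ->] [c rc ->]]; first by exists 0; rewrite ?mul0r //; apply/jacobsonP/radn0.
  exists (a * b + c); last by rewrite mulrDl -mulrA.
  by apply/jacobsonP/radnD; [apply/radnMl/jacobsonP | apply/jacobsonP].
- by move=> y [b _ ->]; exists b.
Qed.

Section Masts.
Variable U : lmodType L.
Implicit Types x y z : U.

Lemma rad_pow_gen p x i y : mast_at p x -> (i <= plen p)%N ->
  (rad_pow i y <-> exists a, y = a *: vec p i x).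
Proof.
move=> [gx lay _ _] ip; split=> [/(rad_powE _ _ gx)[a ra ->]|[a ->]].
  exact: lay.
apply/(rad_powE _ _ gx); exists (a * path_in (pinit p i)); rewrite ?scalerA //.
by apply/radnMl/radn_path; rewrite plen_pinit.
Qed.

Lemma mast_eps p x i a : mast_at p x -> (i <= plen p)%N ->
  (in_rad x i.+1 (a *: vec p i x) <-> eps (pend (pinit p i)) a = 0).
Proof.
move=> mp ip.
have ev : vec p i x = vx (pend (pinit p i)) *: vec p i x.
  by rewrite scalerA vx_mull eqxx.
have [r rr er] := act_vx a ev.
have jr : in_rad x i.+1 (r *: vec p i x).
  by rewrite -add1n; apply: in_radM => //; apply/in_rad_radn/radn_path; rewrite plen_pinit.
split=> [h|z]; last by rewrite er z !scale0r add0r.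
apply/eqP; apply: contra_notT (mast_vec_notin mp ip) => nz.
rewrite -[vec p i x](scaleVK _ nz); apply: (submoduleZ _ (in_rad_submodule _ _)).
rewrite -[_ *.: _](addrK (r *: vec p i x)) -er.
exact: submoduleB (in_rad_submodule _ _) _ _.
Qed.

Lemma mast_factor_line p x i S : mast_at p x -> (i <= plen p)%N ->
  (factor_isom (@rad_pow L U i) (@rad_pow L U i.+1) S <-> line (pend (pinit p i)) S).
Proof.
move=> mp ip; have [gx _ _ _] := mp.
have gX y := rad_pow_gen y mp ip.
have hY a : rad_pow i.+1 (a *: vec p i x) <-> eps (pend (pinit p i)) a = 0.
  by rewrite (rad_powE _ _ gx); apply: mast_eps.
split=> [fS|[s ps]].
  by have [s ps] := presents_factor_isom fS gX; exists s; apply: presents_eq ps hY.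
apply: factor_isom_presents gX hY ps; first exact: generated_submodule.
move=> y /(rad_powE _ _ gx) h; apply/(rad_powE _ _ gx).
by apply: in_rad_le h.
Qed.

(** A composition series of [U] has to be the radical one: J annihilates each simple quotient, and a
    vector of J^k x outside J^(k+1) x already generates J^k x. *)
Lemma mast_comp_length p x n : mast_at p x -> (comp_length U n <-> n = (plen p).+1).
Proof.
move=> mp; have [gx _ nz kill] := mp; have [ex x0 gg] := gx.
have jl y : in_rad x (plen p).+1 y -> y = 0 by case=> a /kill z ->.
split=> [[F [sF F0 Fn fac]]|->]; last first.
  exists (fun i => @rad_pow L U ((plen p).+1 - i)); split.
  - move=> i ip; case: ((plen p).+1 - i)%N => [|k]; first by split.
    exact: generated_submodule.
  - move=> y; rewrite subn0 (rad_powE _ _ gx); split=> [/jl//|->].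
    by apply: submodule0; apply: in_rad_submodule.
  - by move=> y; rewrite subnn.
  move=> i ip; have [S lS] := line_exists (pend (pinit p (plen p - i))).
  exists S; first exact: line_simple lS.
  by rewrite subSS subSn //; apply/(mast_factor_line _ mp) => //; apply: leq_subr.
(* [F] grows with its index while J^k x shrinks, hence the reversed index. *)
have key k : (k <= n)%N -> forall y, F (n - k)%N y <-> in_rad x k y.
  elim: k => [_ y|k IHk kn y].
    by rewrite subn0; split=> // _; apply/in_rad0E/gg.
  pose i := (n - k.+1)%N; have ei : (n - k = i.+1)%N by rewrite /i subnSK.
  have lin : (i < n)%N by rewrite -ei leq_subr.
  have IH z : F i.+1 z <-> in_rad x k z by rewrite -ei; apply: IHk; apply: ltnW.
  have [S sS [sub [f [fP fs f0]]]] := fac i lin.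
  have [e [s /presents_eps[s0 gs act]]] := simple_line sS.
  have sFi : submodule (F i) by apply: sF; apply: ltnW.
  have F00 : F i.+1 0 by apply/IH; apply: submodule0; apply: in_rad_submodule.
  have f00 : f 0 = 0 by apply/f0 => //; apply: submodule0.
  have up z : in_rad x k.+1 z -> F i z.
    move/(rad_powE k.+1 _ gx); apply=> // _ [a [w [/jacobsonP ra /(rad_powE k _ gx)/IH Fw ->]]].
    have Faw : F i.+1 (a *: w).
      by apply/IH/(in_rad_le (leqnSn k)); rewrite -add1n; apply: in_radM => //; apply/IH.
    apply/f0 => //; rewrite -[a *: w]addr0 fP // f00 addr0.
    by have [c ->] := gs (f w); rewrite scaleCl act eps_radn // scale0r scale0r scaler0.
  split=> [Fy|/up//]; apply: contrapT => ny.
  have [a ra ey] := (IH y).1 (sub _ Fy); rewrite ey in Fy ny.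
  have [w Fw fw] := fs s; case/eqP: s0; rewrite -fw; apply/f0 => //.
  have [b rb ->] := (IH w).1 Fw; have [d ->] := mast_generates mp ra ny rb.
  exact: submoduleZ.
have lpn : (plen p < n)%N.
  rewrite ltnNge; apply: contra nz => np; apply/eqP/F0; rewrite -(subnn n).
  by apply/key => //; apply/in_rad_radn/radn_path.
(* If [n] were larger, the term of [F] equal to J^(plen p + 1) x = 0 would still have a simple
   quotient. *)
apply/eqP; rewrite eqn_leq lpn andbT leqNgt; apply/negP => pn.
have pos : (0 < n - (plen p).+1)%N by rewrite subn_gt0.
have [|S sS [_ [f [_ fs f0]]]] := fac (n - (plen p).+1).-1.
  by rewrite prednK // leq_subr.
rewrite prednK // in fs f0 *.
have [e [s /presents_eps[s0 _ _]]] := simple_line sS.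
have [w Fw fw] := fs s; case/eqP: s0; rewrite -fw; apply/f0 => //.
have -> : w = 0 by apply/jl/key => //; apply: ltnW.
by apply: submodule0; apply: sF; rewrite (leq_trans (leq_pred _)) ?leq_subr.
Qed.

(** The definition only provides some y = a x not annihilated by [p]. As [p] annihilates J x, only
    the scalar part of [a] on [x] can survive, so p x is nonzero for every generator at a vertex. *)
Lemma mast_of_at p e x : mast_of pi p U -> generator e x -> mast_at p x.
Proof.
move=> [uU cl [y py]] gx; rewrite pthE in py; have [q mq] := uniserial_mast_at uU gx.
have elen : plen q = plen p by move/(mast_comp_length _ mq): cl => [].
have [_ _ _ kill] := mq; apply: (mast_change mq) => //; last by rewrite -elen.
have [ex _ gg] := gx; have [a ea] := gg y.
have [r rr er] := act_vx a ex; apply: contra_neq py => px0.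
rewrite ea er scalerDr scaleCl px0 scaler0 add0r scalerA kill // elen -addn1.
by apply: radnM => //; apply: radn_path.
Qed.

Lemma mast_at_of p x : mast_at p x -> mast_of pi p U.
Proof.
move=> mp; split; first exact: mast_uniserial mp.
  exact/(mast_comp_length _ mp).
by exists x; rewrite pthE; have [] := mp.
Qed.

Lemma mast_top p x : mast_of pi p U -> top_element pi x -> mast_at p x.
Proof.
move=> mp tx; have [uU _ _] := mp.
by have [e gx] := top_element_generator uU tx; apply: mast_of_at gx.
Qed.

Lemma uniserial_mast : uniserial U -> exists p x, mast_at p x.
Proof.
move=> uU; have [e [x gx]] := uniserial_generator uU.
by have [p mp] := uniserial_mast_at uU gx; exists p, x.
Qed.

Lemma mast_socle p x y : mast_at p x -> (socle y <-> in_rad x (plen p) y).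
Proof.
move=> mp; have [gx _ nz kill] := mp.
have sm : simple_sub (in_rad x (plen p)).
  split; first exact: in_rad_submodule.
    by exists (path_in p *: x) => //; apply/in_rad_radn/radn_path.
  move=> N sN Nj; have [i [hN ip]] := mast_submodule mp sN.
  have [lip|lip] := leqP i (plen p); [right|left] => z.
    by move=> h; apply/hN; apply: in_rad_le h.
  by move=> /hN[a ra ->]; apply: kill; apply: radn_le ra.
split=> [|h]; last by move=> N sN; apply; exists (in_rad x (plen p)).
apply; first exact: in_rad_submodule.
move=> z [N sN Nz]; have [sub [w Nw w0] minN] := sN.
have [i [hN ip]] := mast_submodule mp sub.
have lip : (i <= plen p)%N.
  rewrite leqNgt; apply: contra w0 => lip; apply/eqP.
  by have [a ra ->] := (hN w).1 Nw; apply: kill; apply: radn_le ra.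
have [v|v] := minN _ (in_rad_submodule x (plen p)) (fun z h => (hN z).2 (in_rad_le lip h)).
  by case/eqP: nz; apply: v; apply/in_rad_radn/radn_path.
exact: v.
Qed.

End Masts.

Lemma is_mastP p : is_mast pi p <-> exists (U : lmodType L) (x : U), mast_at p x.
Proof.
split=> [[U mU]|[U [x mx]]]; last by exists U; apply: mast_at_of mx.
have [uU _ _] := mU; have [e [x gx]] := uniserial_generator uU.
by exists U, x; apply: mast_of_at gx.
Qed.

(** * Masts of subquotients *)

(** [Q] is the submodule generated by u x modulo J^(plen t + 1) x. Thus segments of masts are masts,
    and (N) applies to them. *)
Lemma submast (U : lmodType L) (x : U) p w u t : mast_at p x -> pcomp w u = Some t ->
  right_subpath t p ->
  exists (Q : lmodType L) (z : Q),
    mast_at w z /\ presents z (fun b => in_rad x (plen t).+1 (b *: (path_in u *: x))).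
Proof.
move=> mp ew rt; have [[ex x0 gx] lay _ _] := mp.
have [et lt] := right_subpathE rt.
have ru := right_subpath_trans (pcomp_right_subpath ew) rt.
have [eu lu] := right_subpathE ru; have [e1 e2 _] := (pcomp_someP _ _ _).1 ew.
have lwt := plen_comp ew; set y := path_in u *: x.
have jy i b : radn i b -> in_rad x (plen u + i) (b *: y).
  by move=> rb; rewrite addnC; apply: in_radM => //; apply/in_rad_radn/radn_path.
have vecE i : (i <= plen w)%N ->
    path_in (pinit w i) *: y = path_in (pinit p (plen u + i)) *: x.
  by move=> iw; rewrite scalerA (path_in_comp (pinit_comp_add ew rt iw)).
have [Q [z pz]] : exists (Q : lmodType L) (z : Q),
    presents z (fun b => in_rad x (plen t).+1 (b *: y)).
  apply: presents_exists; have sj := in_rad_submodule x (plen t).+1.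
  split=> [|a b c hb hc]; first by rewrite scale0r; apply: submodule0.
  rewrite scalerDl; apply: (submoduleD sj) => //.
  by rewrite -[a *: b]/(a * b) -scalerA; apply: submoduleZ.
have [gz hz] := pz; exists Q, z; split=> //.
have same b c : in_rad x (plen t).+1 (b *: y - c *: y) -> b *: z = c *: z.
  by move=> h; apply/eqP; rewrite -subr_eq0 -scalerBl; apply/eqP/hz; rewrite scalerBl.
have y_notin : ~ in_rad x (plen t).+1 y.
  move/(in_rad_le (m := (plen u).+1)); rewrite lwt ltnS leq_addr => /(_ isT).
  by rewrite /y {2}eu; apply: mast_vec_notin.
split.
- split=> //.
    rewrite -{1}[z]scale1r; apply: same.
    rewrite scale1r scalerA vx_mull e1 eqxx subrr.
    by apply: submodule0; apply: in_rad_submodule.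
  by apply/eqP => z0; apply: y_notin; rewrite -[y]scale1r; apply/hz; rewrite scale1r.
- move=> i a iw ra; have lui : (plen u + i <= plen p)%N.
    by apply: leq_trans lt; rewrite lwt leq_add2l.
  have [b' rb' eb'] := jy i a ra.
  have [b eb] := lay _ _ lui rb'.
  exists b; rewrite scalerA; apply: same; rewrite -scalerA vecE // eb' eb subrr.
  by apply: submodule0; apply: in_rad_submodule.
- apply/eqP => /hz; rewrite scalerA (path_in_comp ew) et plen_pinit //.
  exact: mast_vec_notin.
move=> a ra; apply/hz; rewrite lwt -addnS; exact: jy.
Qed.

Lemma submast_is_mast p w u t : is_mast pi p -> pcomp w u = Some t ->
  right_subpath t p -> is_mast pi w.
Proof.
move=> /is_mastP[U [x mx]] ew rt; have [Q [z [mz _]]] := submast mx ew rt.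
by apply/is_mastP; exists Q, z.
Qed.

(** Every arrow is a mast because [I] has no terms of length one: [cf al] is well defined on [L],
    and by [epsM] and [cfM] its common kernel with [eps (src al)] is a left ideal. *)
Lemma arrow_mast_at al : exists (Q : lmodType L) (z : Q), mast_at (parrow al) z /\
  presents z (fun a => eps (src al) a = 0 /\ cf al a = 0).
Proof.
have [|Q [z pz]] := @presents_exists (fun a => eps (src al) a = 0 /\ cf al a = 0).
  split=> [|a x y [hx hx'] [hy hy']]; first by rewrite eps0 cf0.
  rewrite epsD cfD [a *: x]/((a : L) * x) epsM cfM hx hx' hy hy'.
  by rewrite !mulr0 !addr0.
have [gz hz] := pz; exists Q, z; split=> //.
have same b c : eps (src al) (b - c) = 0 -> cf al (b - c) = 0 -> b *: z = c *: z.
  by move=> h h'; apply/eqP; rewrite -subr_eq0 -scalerBl; apply/eqP/hz.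
split.
- split=> //.
    rewrite -{1}[z]scale1r; apply: same.
      by rewrite epsB eps_vx eps1 eqxx subrr.
    by rewrite cfB cf_vx cf1 subrr.
  apply/eqP => z0; have [] := (hz 1).1; first by rewrite z0 scaler0.
  by move/eqP; rewrite eps1 oner_eq0.
- move=> [|[|//]] a _ ra.
    exists a; have -> : pinit (parrow al) 0 = pvertex (src al) by apply: qpath_inj.
    rewrite scalerA; apply: same.
      by rewrite epsB epsM eps_vx eqxx mulr1 subrr.
    by rewrite cfB cfM cf_vx eps_vx eqxx mulr0 add0r mulr1 subrr.
  exists (cf al a)%:A; have -> : pinit (parrow al) 1 = parrow al by apply: qpath_inj.
  rewrite scalerA mulr_algl; apply: same.
    by rewrite epsB epsZ !eps_radn ?mulr0 ?subr0 //; apply: radn_path.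
  by rewrite cfB cfZ cf_path eqxx mulr1 subrr.
- apply/eqP => /hz[_ /eqP]; by rewrite cf_path eqxx oner_eq0.
move=> a ra; apply/hz; split; last exact: cf_radn.
by apply: eps_radn; apply: radn_le ra.
Qed.

(** * Condition (N) *)

(* The conclusion of (N) for the arrow al and the path p. *)
Definition absorbs al p : Prop :=
  (exists2 c', cycle_at (tgt al) c' & pcomp c' (parrow al) = Some p) \/
  (exists2 c, cycle_at (src al) c & pcomp (parrow al) c = Some p).

(** Let w be the segment of [p] from [u] to [v]. If w starts with [al], then [p] itself follows [al]
    after [u]; if w ends with [al], a cycle sits between [u] and [al]. *)
Lemma absorbs_detour p al u v : right_subpath u p -> right_subpath v p ->
  (plen u < plen v)%N -> src al = pend u ->
  (forall w, pcomp w u = Some v -> absorbs al w) ->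
  (exists2 au, pcomp (parrow al) u = Some au & right_subpath au p) \/
  (exists c cu, [/\ cycle_at (pend u) c, pcomp c u = Some cu &
     pcomp (parrow al) cu = Some v]).
Proof.
move=> ru rv luv es absw.
have /right_subpathP[w ew] := right_subpath_le ru rv (ltnW luv).
have [e1 e2 e3] := (pcomp_someP _ _ _).1 ew.
case: (absw w ew) => [[c _ ec]|[c [c1 c2] ec]]; last first.
  right; rewrite es in c1 c2.
  have [cu ecu] : exists cu, pcomp c u = Some cu by apply: pcomp_defined.
  exists c, cu; split=> //; have [_ u2 u3] := (pcomp_someP _ _ _).1 ecu.
  have [_ d2 d3] := (pcomp_someP _ _ _).1 ec.
  apply/pcomp_someP; split; first by rewrite (pend_comp ecu) c2.
    by rewrite e2 u2.
  by rewrite e3 d3 u3 catA.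
left.
have [au ea] : exists au, pcomp (parrow al) u = Some au by apply: pcomp_defined.
exists au => //; apply: right_subpath_trans rv.
have [_ a2 a3] := (pcomp_someP _ _ _).1 ea.
have [_ _ c3] := (pcomp_someP _ _ _).1 ec.
by rewrite /right_subpath a2 e2 eqxx a3 e3 c3 catA prefix_prefix.
Qed.

Section ConditionN.
Hypothesis N : condition_N pi.

(** An arrow parallel to [al] is a mast, and a path of length one leaves no room for a nontrivial
    cycle in (N). *)
Lemma N_no_double_arrows : no_double_arrows G.
Proof.
move=> al be es et; have mbe : is_mast pi (parrow be).
  by have [Q [z [mz _]]] := arrow_mast_at be; apply/is_mastP; exists Q, z.
have sz (c : qpath G) : size (parrows c) = 0%N -> parrows c = [::] by apply: size0nil.
case: (N mbe (isT : (0 < plen (parrow be))%N) (esym es) (esym et)) => -[c _ ec].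
  have [_ _ /= e3] := (pcomp_someP _ _ _).1 ec.
  by case: e3 => ->.
have [_ _ /= e3] := (pcomp_someP _ _ _).1 ec.
by case: (parrows c) e3 => [[]|? [|? ?]] //.
Qed.

(** A detour excludes the first alternative of [absorbs_detour], and also a trivial cycle in the
    second, as [v] would then be [al] after [u]. *)
Lemma N_detour p al u v : is_mast pi p -> detour p al u ->
  detour_target p al u v ->
  exists c cu, [/\ cycle_at (pend u) c, (0 < plen c)%N, pcomp c u = Some cu &
     pcomp (parrow al) cu = Some v].
Proof.
move=> mp /and3P[ru nr _] /and3P[rv luv /eqP ev].
case ew: (Defs.pcomp (parrow al) u) nr => [w|] // nr.
have [es _ _] := (pcomp_someP _ _ _).1 ew.
case: (absorbs_detour ru rv luv (esym es)) => [w' ew'|[au]|[c [cu [cyc ecu ev']]]].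
- apply: N; first exact: submast_is_mast ew' rv.
  + by move: luv; rewrite (plen_comp ew') -{1}[plen u]addn0 ltn_add2l.
  + by have [<- _ _] := (pcomp_someP _ _ _).1 ew'.
  + by rewrite -(pend_comp ew').
- by rewrite ew => -[<-]; rewrite (negPf nr).
exists c, cu; split=> //; rewrite lt0n; apply: contra nr => /eqP c0.
have [c1 c2] := cyc; move: ecu; rewrite (path_trivial c0) c1.
by rewrite pcomp_vertexl eqxx => -[eu]; move: ev'; rewrite -eu ew => -[->].
Qed.

(** (N) strips one copy of [g] from one of the ends, and the rest is again a mast at the same
    vertex. *)
Lemma N_loop g p : tgt g = src g -> is_mast pi p -> pstart p = src g ->
  pend p = src g -> exists m, parrows p = nseq m g.
Proof.
move=> lg; have [n] := ubnP (plen p); elim: n p => // n IHn p lp mp sp ep.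
have [p0|pp] := posnP (plen p); first by exists 0; apply: size0nil.
case: (N mp pp sp); rewrite ?lg // => -[c [c1 c2] ec].
  have mc : is_mast pi c.
    by apply: submast_is_mast mp ec _; rewrite /right_subpath eqxx prefix_refl.
  have [_ _ e3] := (pcomp_someP _ _ _).1 ec.
  have [||m em] := IHn c _ mc _ c2 => //.
    by move: lp; rewrite (plen_comp ec) add1n ltnS.
  by exists m.+1; rewrite e3 em.
have mc : is_mast pi c.
  apply: (submast_is_mast (u := pvertex (src g)) mp _ (pcomp_right_subpath ec)).
  by rewrite pcomp_vertexr c1 eqxx.
have [_ _ e3] := (pcomp_someP _ _ _).1 ec.
have [||m em] := IHn c _ mc c1 _ => //.
  by move: lp; rewrite (plen_comp ec) addn1 ltnS.
exists (m + 1)%N; rewrite e3 em nseqD //.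
Qed.

End ConditionN.

(** * Quivers without double arrows *)

Lemma mast_pend (U : lmodType L) (x : U) p i e a : mast_at p x -> (i <= plen p)%N ->
  radn i a -> vx e *: (a *: x) = a *: x -> ~ in_rad x i.+1 (a *: x) ->
  e = pend (pinit p i).
Proof.
move=> mp ip ra ea na; have [c [r [rr er]]] := mast_layer mp ip ra.
apply/eqP/negPn/negP => ne; apply: na; rewrite -ea er scalerDr scaleCl scalerA.
rewrite vx_mull eq_sym (negPf ne) scale0r scaler0 add0r.
by rewrite scalerA; apply/in_rad_radn/radnMl.
Qed.

(** Each initial part of [q] must survive in its own layer, so [q] runs through the vertices of the
    layers; without double arrows these determine it. *)
Lemma mast_path_notin (U : lmodType L) (x : U) p q : no_double_arrows G ->
  mast_at p x -> (plen q <= plen p)%N -> ~ in_rad x (plen q).+1 (path_in q *: x) ->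
  q = pinit p (plen q).
Proof.
move=> nd mp lq nq; apply: pend_path_eq => // [|i iq]; first by rewrite plen_pinit.
have ip := leq_trans iq lq.
rewrite pinit_take //; apply: (mast_pend (a := path_in (pinit q i)) mp) => //.
- by apply: radn_path; rewrite plen_pinit.
- by rewrite scalerA vx_mull eqxx.
move=> h; apply: nq; rewrite (vec_split q i) -(subnK iq) -addnS.
by apply: in_radM h; apply: radn_path; rewrite plen_pfinal.
Qed.

Lemma mast_unique (U : lmodType L) (x y : U) p q : no_double_arrows G ->
  mast_at p x -> mast_at q y -> p = q.
Proof.
move=> nd mp mq; have elen : plen p = plen q.
  by have := (mast_comp_length _ mp).1 ((mast_comp_length _ mq).2 erefl) => -[].
apply: pend_path_eq => // i ip; have [S lS] := line_exists (pend (pinit p i)).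
have iq : (i <= plen q)%N by rewrite -elen.
by have /(mast_factor_line _ mp ip)/(mast_factor_line _ mq iq) := lS; apply: line_uniq.
Qed.

Lemma uniserial_unique_mast (U : lmodType L) : no_double_arrows G ->
  uniserial U -> exists! p, mast_of pi p U.
Proof.
move=> nd uU; have [p [x mx]] := uniserial_mast uU.
exists p; split=> [|q mq]; first exact: mast_at_of mx.
have [e [y gy]] := uniserial_generator uU.
exact: mast_unique mx (mast_of_at mq gy).
Qed.

Lemma mast_other_arrow (U : lmodType L) (x : U) p i al be : no_double_arrows G ->
  mast_at p x -> (i < plen p)%N -> pcomp (parrow be) (pinit p i) = Some (pinit p i.+1) ->
  al != be -> in_rad x i.+2 (ar al *: (path_in (pinit p i) *: x)).
Proof.
move=> nd mp ip eb; apply: contra_neqP => nj; set y := path_in (pinit p i) *: x in nj.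
have [sb _ _] := (pcomp_someP _ _ _).1 eb; have tb := pend_comp eb.
have ev : y = vx (src be) *: y by rewrite scalerA vx_mull sb eqxx.
have aly0 : ar al *: y != 0.
  by apply/eqP => z; apply: nj; rewrite z; apply: submodule0; apply: in_rad_submodule.
apply: nd; first exact: path_in_src ev aly0.
transitivity (pend (pinit p i.+1)); last by rewrite tb.
rewrite scalerA in nj; apply: (mast_pend mp ip _ _ nj).
  rewrite -add1n; apply: radnM; first exact: radn_path.
  by apply: radn_path; rewrite plen_pinit // ltnW.
by rewrite scalerA mulrA vx_mull eqxx.
Qed.

(** The annihilator found here is that of [arrow_mast_at]: two consecutive layers form the module of
    length two attached to [be], whatever [p] and [i] are. *)
Lemma mast_two_layers (U : lmodType L) (x : U) p i be a : no_double_arrows G ->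
  mast_at p x -> (i < plen p)%N -> pcomp (parrow be) (pinit p i) = Some (pinit p i.+1) ->
  (in_rad x i.+2 (a *: (path_in (pinit p i) *: x)) <->
   eps (src be) a = 0 /\ cf be a = 0).
Proof.
move=> nd mp ip eb; set y := path_in (pinit p i) *: x.
have [sb _ _] := (pcomp_someP _ _ _).1 eb; have tb := pend_comp eb.
have ev : y = vx (src be) *: y by rewrite scalerA vx_mull sb eqxx.
have eby : ar be *: y = path_in (pinit p i.+1) *: x by rewrite scalerA (path_in_comp eb).
have sj := in_rad_submodule x i.+2.
(* [r] lies in J. In its expansion by last applied factors b al, only the term of [be] counts modulo
   J^(i+2) x, through the character at [tgt be] of its coefficient, and this value is [cf be a]. *)
pose r := a * vx (src be) - eps (src be) a *: vx (src be).
have er : a *: y = eps (src be) a *.: y + r *: y.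
  have -> : r *: y = a *: y - eps (src be) a *.: y.
    by rewrite scalerBl -scalerA -ev [X in _ - X]scaleZl -ev.
  by rewrite addrC subrK.
have cr : cf be r = cf be a.
  by rewrite cfB cfM cfZ cf_vx eps_vx eqxx !mulr0 mulr1 add0r subr0.
have [|b [_ eb']] := @radn_arrows 0 r.
  apply/radn1P => e; rewrite epsB epsM epsZ eps_vx.
  by case: eqP => [->|_]; rewrite ?subrr // !mulr0 subrr.
have cb : cf be r = eps (tgt be) (b be).
  rewrite eb' (bigD1 be) //= cfD cfM cf_path eqxx mulr1.
  rewrite [eps _ (ar be)]eps_radn ?mulr0 ?addr0; last exact: radn_path.
  rewrite [X in _ + X](_ : _ = 0) ?addr0 //.
  elim/big_rec: _ => [|al c ne h]; first exact: cf0.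
  rewrite cfD h addr0 cfM cf_path [eps _ (ar al)]eps_radn ?mulr0 ?addr0; last exact: radn_path.
  rewrite qpathE (_ : _ && _ = false) ?mulr0 //; apply/negbTE; rewrite negb_and.
  by apply/orP; right; apply: contra ne => /eqP[->].
have ry : in_rad x i.+2 (r *: y) <-> cf be a = 0.
  have rest : in_rad x i.+2 (r *: y - b be *: (ar be *: y)).
    rewrite eb' (bigD1 be) //= scalerDl scalerA addrAC subrr add0r scaler_suml.
    elim/big_rec: _ => [|al z ne jz]; first exact: submodule0.
    apply: submoduleD => //; rewrite -scalerA; apply: submoduleZ => //.
    exact: mast_other_arrow ne.
  rewrite eby in rest; rewrite -cr cb; have eps_b := mast_eps (b be) mp ip.
  rewrite tb in eps_b; rewrite -[tgt be]/(pend (parrow be)) -eps_b; split=> h.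
    by have := submoduleB sj h rest; rewrite opprB addrCA subrr addr0.
  by rewrite -[r *: y](subrK (b be *: (path_in (pinit p i.+1) *: x))); apply: submoduleD.
split=> [h|[z c0]]; last by rewrite er z !scale0r add0r; apply/ry.
have z : eps (src be) a = 0.
  rewrite -[src be]/(pstart (parrow be)) -sb; apply/(mast_eps a mp (ltnW ip)).
  by apply: in_rad_le h.
by split=> //; apply/ry; move: h; rewrite er z !scale0r add0r.
Qed.

(** * Modules of length two *)

Lemma linear_presents (M W : lmodType L) (x : M) (w : W) :
  (forall y, exists a : L, y = a *: x) -> (forall a : L, a *: x = 0 -> a *: w = 0) ->
  exists f : {linear M -> W}, f x = w.
Proof.
move=> gx h; pose f y : W := projT1 (cid (gx y)) *: w.
have fE a : f (a *: x) = a *: w.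
  rewrite /f; case: cid => b /= /eqP; rewrite -subr_eq0 -scalerBl => /eqP/h/eqP.
  by rewrite scalerBl subr_eq0 => /eqP.
have fl : linear f.
  move=> a y z; have [b ->] := gx y; have [c ->] := gx z.
  by rewrite scalerA -scalerDl !fE scalerDl scalerA.
pose F : {linear M -> W} := HB.pack f (GRing.isLinear.Build L M W *:%R f fl).
by exists F; rewrite /= -[x in LHS]scale1r fE scale1r.
Qed.

Section TopSocle.
Variables (U : lmodType L) (x : U) (p : qpath G).
Hypothesis mp : mast_at p x.

Lemma mast_top_eps a : in_rad x 1 (a *: x) <-> eps (pstart p) a = 0.
Proof. by have [gx _ _ _] := mp; apply: generator_notin_radE gx. Qed.

Lemma mast_soc_eps a : a *: (path_in p *: x) = 0 <-> eps (pend p) a = 0.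
Proof.
have := mast_eps a mp (leqnn _); rewrite pinit_all => <-; have [_ _ _ kill] := mp.
split=> [->|[b /kill -> //]]; exact: (submodule0 (in_rad_submodule _ _)).
Qed.

Lemma mast_soc y : in_rad x (plen p) y <-> exists a, y = a *: (path_in p *: x).
Proof.
have [gx lay _ _] := mp; rewrite -(rad_powE _ _ gx).
by rewrite (rad_pow_gen y mp (leqnn _)) pinit_all.
Qed.

Lemma mast_top_isom S : top_isom U S <-> line (pstart p) S.
Proof. by have := mast_factor_line S mp (leq0n _); rewrite pinit0. Qed.

Lemma mast_soc_isom S : soc_isom U S <-> line (pend p) S.
Proof.
have gX y : socle y <-> exists a, y = a *: (path_in p *: x).
  by rewrite (mast_socle y mp); apply: mast_soc.
split=> [fS|[s ps]].
  by have [s ps] := presents_factor_isom fS gX; exists s; apply: presents_eq ps mast_soc_eps.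
apply: (factor_isom_presents (submodule_zero U)) gX mast_soc_eps ps.
by move=> _ ->; apply: (submodule0 (generated_submodule _)).
Qed.

End TopSocle.

(** Lift a generator of the quotient to a vector at its vertex. If all arrows annihilated the lift,
    it would split the sequence; so some arrow maps it onto a generator of the kernel, and this
    arrow is a mast of the extension. *)
Lemma ext1_uniserial (S : lmodType L) : simple S -> ext1_nonzero S S ->
  exists W : lmodType L, [/\ uniserial W, comp_length W 2, top_isom W S & soc_isom W S].
Proof.
move=> /simple_line[e lS] [E [f [g [fi gs gf nosplit]]]]; have [s ps] := lS.
have [s0 gens act] := presents_eps ps; have [cs hs] := ps.
have [y0 gy0] := gs s; pose y := vx e *: y0.
have gy : g y = s by rewrite /y linearZ /= gy0 act eps_vx eqxx !scale1r.
have ey : y = vx e *: y by rewrite /y scalerA vx_vx eqxx.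
have actt a : a *: f s = eps e a *.: f s by rewrite -!linearZ /= act.
have kerg z : g z = 0 -> exists c, z = c *.: f s.
  by move=> /gf[t <-]; have [c ->] := gens t; exists c; rewrite linearZ /=.
have rady a : radn 1 a -> exists c, a *: y = c *.: f s.
  move=> ra; apply: kerg; rewrite linearZ /= gy act eps_radn //.
  by rewrite scale0r scale0r.
have [al nal] : exists al, ar al *: y != 0.
  apply: contrapT => /forallNP none; apply: nosplit.
  have [a h|h eh] := @linear_presents S E s y cs.
    have [r rr ->] := act_vx a ey; rewrite (hs a).1 // !scale0r add0r.
    have [|b [_ ->]] := @radn_arrows 0 r; first exact: rr.
    rewrite scaler_suml big1 // => al _; rewrite -scalerA.
    by have /negP/negPn/eqP-> := none al; rewrite scaler0.
  by exists h => z; have [c ->] := gens z; rewrite !linearZ /= eh gy.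
have [c ec] := rady _ (radn_path (isT : 1 <= plen (parrow al))%N).
have c0 : c != 0 by apply: contra_neq nal => c0; rewrite ec c0 scale0r scale0r.
have et : f s = c^-1 *.: (ar al *: y) by rewrite ec scaleVK.
have sal : src al = e by apply: path_in_src ey nal.
have tal : tgt al = e.
  apply/eqP; apply: contraNT nal => ne.
  have -> : ar al *: y = vx (tgt al) *: (ar al *: y) by rewrite scalerA vx_mull eqxx.
  by rewrite ec scaleCl actt eps_vx (negPf ne) scale0r scale0r scaler0.
have msE : mast_at (parrow al) y.
  split.
  - split; first by rewrite -[pstart _]/(src al) sal.
      by apply: contra_neq s0 => y00; rewrite -gy y00 raddf0.
    move=> z; have [d ed] := gens (g z); have [|d' ed'] := kerg (z - d *.: y).
      by rewrite linearB /= ed linearZ /= gy subrr.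
    exists (d%:A + d'%:A * (c^-1%:A * ar al)); rewrite scalerDl -!scalerA -et -ed'.
    by rewrite addrC subrK.
  - move=> [|[|//]] a _ ra.
      exists a; have -> : pinit (parrow al) 0 = pvertex (src al) by apply: qpath_inj.
      by rewrite sal -ey.
    have -> : pinit (parrow al) 1 = parrow al by apply: qpath_inj.
    have [d ->] := rady a ra; exists (d%:A * c^-1%:A).
    by rewrite -scalerA -et.
  - exact: nal.
  move=> a /radn_arrows[b [rb ->]]; rewrite scaler_suml big1 // => be _.
  have [d ed] := rady _ (radn_path (isT : 1 <= plen (parrow be))%N).
  by rewrite -scalerA ed scaleCl actt eps_radn // scale0r scale0r scaler0.
exists E; split.
- exact: mast_uniserial msE.
- exact/(mast_comp_length _ msE).
- by apply/(mast_top_isom msE); rewrite -[pstart _]/(src al) sal.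
- by apply/(mast_soc_isom msE); rewrite -[pend _]/(tgt al) tal.
Qed.

Lemma uniserial_ext1 (S W : lmodType L) : uniserial W -> comp_length W 2 -> top_isom W S ->
  soc_isom W S -> ext1_nonzero S S.
Proof.
move=> uW cW tW sW; have [p [w mw]] := uniserial_mast uW.
have [lp] := (mast_comp_length _ mw).1 cW.
have lS := (mast_top_isom mw S).1 tW; have lS' := (mast_soc_isom mw S).1 sW.
have sp := line_uniq lS lS'; have [s ps] := lS.
have [s0 gens act] := presents_eps ps; have [cs hs] := ps.
have [gw _ nz kill] := mw; have [_ _ cw] := gw.
have rp : radn 1 (path_in p) by apply: radn_path; rewrite -lp.
have [a /hs z|f ef] := @linear_presents S W s (path_in p *: w) cs.
  by apply/(mast_soc_eps mw); rewrite -sp.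
have [a z|g eg] := @linear_presents W S w s cw.
  by apply/hs/(mast_top_eps mw); rewrite z; apply: (submodule0 (in_rad_submodule _ _)).
exists W, f, g; split.
- move=> y z /eqP; rewrite -subr_eq0 -linearB => /eqP.
  have [c ec] := cs (y - z); rewrite ec linearZ /= ef => /(mast_soc_eps mw).
  by rewrite -sp => /hs; rewrite -ec => /eqP; rewrite subr_eq0 => /eqP.
- by move=> z; have [a ->] := cs z; exists (a *: w); rewrite linearZ /= eg.
- move=> y; have [a ->] := cw y; rewrite linearZ /= eg; split.
    move/hs/(mast_top_eps mw); rewrite lp => /(mast_soc mw)[b ->].
    by exists (b *: s); rewrite linearZ /= ef.
  case=> t; have [b ->] := cs t; rewrite linearZ /= ef => e.
  apply/hs/(mast_top_eps mw); rewrite -e lp; apply/(mast_soc mw).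
  by exists b.
(* A splitting sends [s] to a w, where a w still generates [w]; then p w is the image under [h] of
   an element of J s = 0. *)
case=> h gh; have [a ea] := cw (h s).
have ga : a *: s = s by rewrite -eg -linearZ /= -ea gh.
have eps_a : eps (pstart p) a != 0.
  by apply: contraNneq s0 => z; rewrite -ga act z scale0r scale0r.
have [ew _ _] := gw; have [b eb] := vx_generates ew eps_a.
case/eqP: nz; rewrite eb -ea -!linearZ /= [X in h X](_ : _ = 0) ?raddf0 //.
rewrite scalerA act eps_radn ?scale0r ?scale0r //; exact: radnMr.
Qed.

(** The mast of [W] is a loop, by [N_loop] the mast of [U] is a power of it, and [mast_two_layers]
    recognises [W] in each pair of consecutive layers. *)
Lemma uniserial_square (W U S : lmodType L) l i : condition_N pi ->
  uniserial W -> comp_length W 2 -> top_isom W S -> soc_isom W S ->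
  (2 <= l)%N -> uniserial U -> comp_length U l -> top_isom U S -> soc_isom U S ->
  (i <= l - 2)%N -> factor_isom (@rad_pow L U i) (@rad_pow L U i.+2) W.
Proof.
move=> N uW cW tW sW l2 uU cU tU sU il; have nd := N_no_double_arrows N.
have [q [w mw]] := uniserial_mast uW; have [p [x mx]] := uniserial_mast uU.
have [lq] := (mast_comp_length _ mw).1 cW; have elp := (mast_comp_length _ mx).1 cU.
have lW := (mast_top_isom mw S).1 tW.
have eq1 := line_uniq lW ((mast_soc_isom mw S).1 sW).
have sp : pstart p = pstart q := line_uniq ((mast_top_isom mx S).1 tU) lW.
have tp : pend p = pstart q := line_uniq ((mast_soc_isom mx S).1 sU) lW.
have [g eg] : exists g, pcomp (parrow g) (pinit q 0) = Some (pinit q 1).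
  by apply: pinit_succ; rewrite -lq.
have eq : q = parrow g.
  have [e1 e2 e3] := (pcomp_someP _ _ _).1 eg.
  rewrite -[q]pinit_all -lq; apply: qpath_inj; last by rewrite e3 pinit0.
  by rewrite -[RHS]e1 pinit0.
have lg : tgt g = src g by rewrite eq in eq1; exact: (esym eq1).
have sg : pstart q = src g by rewrite eq.
have [m em] : exists m, parrows p = nseq m g.
  apply: (N_loop N lg); rewrite ?sp ?tp //.
  by apply/is_mastP; exists U, x.
have ip : (i < plen p)%N.
  by move: il l2; rewrite elp; case: (plen p) => [|n] //; rewrite subSS subn1 ltnS.
have [be eb] := pinit_succ ip; have ebg : be = g.
  have [_ _ e3] := (pcomp_someP _ _ _).1 eb.
  have : be \in parrows (pinit p i.+1) by rewrite e3 mem_cat inE eqxx orbT.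
  by move/mem_take; rewrite em mem_nseq => /andP[_ /eqP].
rewrite ebg in eb; have [gx _ _ _] := mx.
apply: (factor_isom_presents (x := path_in (pinit p i) *: x) (w := w)
   (N := fun a => eps (src g) a = 0 /\ cf g a = 0)).
- exact: generated_submodule.
- by move=> y /(rad_powE _ _ gx) h; apply/(rad_powE _ _ gx); apply: in_rad_le h; rewrite ltnW.
- by move=> y; apply: rad_pow_gen mx (ltnW ip).
- by move=> a; rewrite (rad_powE _ _ gx); apply: mast_two_layers.
have [gw _ _ kill] := mw; have [ew _ cw] := gw.
split=> // a; have := mast_two_layers a nd mw (eq_leq lq) eg.
have -> : path_in (pinit q 0) *: w = w.
  by rewrite pinit0 -ew.
move=> <-; split=> [->|[b rb ->]]; first exact: (submodule0 (in_rad_submodule _ _)).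
by apply: kill; rewrite -lq.
Qed.

(** * The variety of a mast *)

Section Coordinates.
Variables (U : lmodType L) (x : U) (p : qpath G).
Hypothesis mp : mast_at p x.

Lemma mast_coord_uniq (c d : nat -> K) :
  \sum_(0 <= m < (plen p).+1) c m *.: vec p m x =
    \sum_(0 <= m < (plen p).+1) d m *.: vec p m x ->
  forall m, (m <= plen p)%N -> c m = d m.
Proof.
move=> e m lm; apply/eqP; rewrite -subr_eq0; apply/eqP.
apply: (@mast_indep U p x (plen p).+1 0 (fun m => c m - d m) mp (radn0 _)) => //.
rewrite scale0r; apply/esym/eqP; under eq_bigr => j _ do rewrite scalerBl scalerBl.
by rewrite sumrB subr_eq0; apply/eqP.
Qed.

Lemma mast_coord_end i a e : radn i a -> vx e *: (a *: x) = a *: x ->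
  exists c : nat -> K, a *: x = \sum_(0 <= m < (plen p).+1) c m *.: vec p m x /\
    forall m, c m != 0 -> (i <= m)%N /\ pend (pinit p m) = e.
Proof.
move=> ra ea; have [c ec] := mast_coord mp ra.
(* [mast_coord] says nothing about indices below [i], so they are set to 0; multiplication by the
   vertex [e] removes the basis vectors that end elsewhere. *)
exists (fun m => if (i <= m)%N && (pend (pinit p m) == e) then c m else 0); split.
  rewrite -ea ec scaler_sumr.
  have [ip|pi'] := leqP i (plen p).+1; last first.
    rewrite big_geq 1?ltnW // big_nat big1 // => m /andP[_ lm].
    by rewrite leqNgt (ltn_trans lm pi') /= scale0r scale0r.
  rewrite [RHS](big_cat_nat (n := i)) //= [X in _ = X + _](_ : _ = 0).
    rewrite add0r; apply: eq_big_nat => m /andP[im _].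
    rewrite im /= scaleCl scalerA vx_mull.
    by case: eqP => _; rewrite // scale0r scaler0 scale0C.
  rewrite big_nat big1 // => m /andP[_ mi].
  by rewrite leqNgt mi /= scale0C.
by move=> m; case: ifP => [/andP[im /eqP]|_]; rewrite ?eqxx.
Qed.

End Coordinates.

Lemma detourP p al j : (j <= plen p)%N -> reflect
  [/\ src al = pend (pinit p j),
     forall w, pcomp (parrow al) (pinit p j) = Some w -> ~~ right_subpath w p
   & exists m, [/\ (j < m)%N, (m <= plen p)%N & pend (pinit p m) = tgt al]]
  (detour p al (pinit p j)).
Proof.
move=> jp; rewrite /detour pinit_right_subpath andTb.
case ew: (Defs.pcomp (parrow al) (pinit p j)) => [w|]; last first.
  rewrite andFb; apply: (iffP idP) => // -[es _ _].
  by have [w] := @pcomp_defined _ (parrow al) (pinit p j) (esym es); rewrite ew.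
have [es _ _] := (pcomp_someP _ _ _).1 ew.
apply: (iffP andP) => [[nr /hasP[v rv /and3P[rv' lv /eqP ev]]]|[_ nr [m [jm lm em]]]].
  split; rewrite ?es //; first by move=> _ [<-].
  have [evp lvp] := right_subpathE rv'; exists (plen v); rewrite -evp ev.
  by split=> //; rewrite plen_pinit in lv.
split; first exact: nr.
apply/hasP; exists (pinit p m); first by rewrite mem_right_subpaths pinit_right_subpath.
by rewrite /detour_target pinit_right_subpath !plen_pinit // jm em eqxx.
Qed.

(** With [oapp k 0] it extends a point of V_p by zero to all positions [m], so that sums over detour
    targets become sums over the whole basis. *)
Definition detour_at p al u m : option (detour_index p) := insub (al, u, pinit p m).

Lemma detour_atP p al u m d : detour_at p al u m = Some d ->
  [/\ dt_arrow d = al, dt_base d = u & dt_target d = pinit p m].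
Proof.
rewrite /detour_at; case: insubP => // d' _ e [<-].
by rewrite /dt_arrow /dt_base /dt_target e.
Qed.

Lemma detour_index_target p (d : detour_index p) :
  [/\ detour p (dt_arrow d) (dt_base d),
      dt_target d = pinit p (plen (dt_target d)), (plen (dt_target d) <= plen p)%N
    & detour_at p (dt_arrow d) (dt_base d) (plen (dt_target d)) = Some d].
Proof.
have := valP d; have ed : val d = (dt_arrow d, dt_base d, dt_target d).
  by rewrite /dt_arrow /dt_base /dt_target; case: (val d) => [[? ?] ?].
rewrite {1}ed mem_detour_triples => /andP[dd /and3P[rd _ _]].
have [e1 e2] := right_subpathE rd; split=> //.
by rewrite /detour_at -e1 -ed valK.
Qed.

Lemma detour_sum (V : nmodType) p al u (F : detour_index p -> V) :
  \sum_(d : detour_index p | (dt_arrow d == al) && (dt_base d == u)) F d =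
  \sum_(0 <= m < (plen p).+1) oapp F 0 (detour_at p al u m).
Proof.
rewrite big_mkord.
rewrite (partition_big (fun d => inord (plen (dt_target d)) : 'I_(plen p).+1) xpredT) //=.
apply: eq_bigr => m _; case ed: (detour_at p al u m) => [d|] /=.
  have [e1 e2 e3] := detour_atP ed; rewrite (big_pred1 d) // => d' /=.
  apply/andP/eqP => [[/andP[/eqP a1 /eqP a2] /eqP em]|->]; last first.
    rewrite e1 e2 e3 !eqxx; split=> //.
    by apply/eqP/val_inj; rewrite /= plen_pinit ?inordK // -ltnS.
  have [_ t1 t2 t3] := detour_index_target d'.
  move: t3; rewrite a1 a2 -[plen (dt_target d')](@inordK (plen p)) ?ltnS // em ed.
  by case.
rewrite big_pred0 // => d; apply/negP => /andP[/andP[/eqP a1 /eqP a2] /eqP em].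
have [_ t1 t2 t3] := detour_index_target d.
by move: t3; rewrite a1 a2 -[plen (dt_target d)](@inordK (plen p)) ?ltnS // em ed.
Qed.

Definition rep p (k : {ffun detour_index p -> K}) (U : lmodType L) (x : U) : Prop :=
  mast_at p x /\ forall al u, detour p al u ->
    ar al *: (path_in u *: x) =
    \sum_(d : detour_index p | (dt_arrow d == al) && (dt_base d == u))
      (k d *: path_in (dt_target d)) *: x.

Lemma points_rep p (k : {ffun detour_index p -> K}) :
  @points K (var_of_path pi p) k <-> exists (U : lmodType L) (x : U), rep k x.
Proof.
rewrite /= pthE; split=> -[U [x]]; last first.
  move=> [mx hx]; exists U, x; split=> //; first exact: mast_at_of mx.
  by have [gx _ _ _] := mx; apply: generator_top_element gx.
move=> [mU tx hx]; exists U, x; split=> //; exact: mast_top.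
Qed.

Lemma rep_detour p (k : {ffun detour_index p -> K}) (U : lmodType L) (x : U) al u :
  rep k x -> detour p al u ->
  ar al *: (path_in u *: x) =
  \sum_(0 <= m < (plen p).+1) oapp k 0 (detour_at p al u m) *.: vec p m x.
Proof.
move=> [_ h] /h ->; rewrite detour_sum; apply: eq_bigr => m _.
case ed: detour_at => [d|] /=; last by rewrite scale0r scale0r.
by have [_ _ ->] := detour_atP ed; rewrite scaleZl.
Qed.

Lemma rep_exists p (U : lmodType L) (x : U) : mast_at p x -> exists k, rep (p := p) k x.
Proof.
move=> mp.
have ex al u : exists c : nat -> K, detour p al u ->
    ar al *: (path_in u *: x) = \sum_(0 <= m < (plen p).+1) c m *.: vec p m x /\
    forall m, c m != 0 -> (plen u < m)%N /\ pend (pinit p m) = tgt al.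
  case: (pselect (detour p al u)) => [du|]; last by exists (fun=> 0).
  have [] := mast_coord_end mp (i := (plen u).+1) (a := ar al * path_in u) (e := tgt al).
  - by rewrite -add1n; apply: radnM; apply: radn_path.
  - by rewrite scalerA mulrA vx_mull eqxx.
  by move=> c; rewrite -scalerA; exists c.
pose cc al u : nat -> K := projT1 (cid (ex al u)).
have ccP al u : detour p al u ->
    ar al *: (path_in u *: x) = \sum_(0 <= m < (plen p).+1) cc al u m *.: vec p m x /\
    forall m, cc al u m != 0 -> (plen u < m)%N /\ pend (pinit p m) = tgt al.
  by rewrite /cc; case: cid.
exists [ffun d => cc (dt_arrow d) (dt_base d) (plen (dt_target d))]; split=> // al u du.
have [-> sup] := ccP al u du; rewrite detour_sum; apply: eq_big_nat => m /andP[_ lm].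
case ed: (detour_at p al u m) => [d|] /=.
  by rewrite ffunE; have [-> -> ->] := detour_atP ed; rewrite plen_pinit // [RHS]scaleZl.
suff -> : cc al u m = 0 by rewrite scale0r scale0r.
apply/eqP/negPn/negP => /sup[um em]; move: ed; rewrite /detour_at insubT //.
rewrite mem_detour_triples du /detour_target pinit_right_subpath plen_pinit //.
by rewrite um em eqxx.
Qed.

Lemma rep_uniq p (k k' : {ffun detour_index p -> K}) (U : lmodType L) (x : U) :
  rep k x -> rep k' x -> k = k'.
Proof.
move=> rk rk'; apply/ffunP => d; have [dd _ ld ed] := detour_index_target d.
have := rep_detour rk' dd; rewrite (rep_detour rk dd) => /(mast_coord_uniq (proj1 rk)).
by move/(_ _ ld); rewrite ed.
Qed.

(** Four cases: [al] does not start where the j-th vector ends (zero); it continues along [p] (a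
    basis vector); it gives a detour (coordinates of the point); or no later vertex of [p] is its
    target (zero, since the image lies deeper). *)
Lemma arrow_coord p al j : (j <= plen p)%N ->
  exists f : nat -> {ffun detour_index p -> K} -> K, (forall m, regular (f m)) /\
    forall k (U : lmodType L) (x : U), rep k x ->
      ar al *: vec p j x = \sum_(0 <= m < (plen p).+1) f m k *.: vec p m x.
Proof.
move=> jp; set u := pinit p j.
have zero (h : forall k (U : lmodType L) (x : U), rep (p := p) k x ->
    ar al *: (path_in u *: x) = 0) :
  exists f : nat -> {ffun detour_index p -> K} -> K, (forall m, regular (f m)) /\
    forall k (U : lmodType L) (x : U), rep k x ->
      ar al *: vec p j x = \sum_(0 <= m < (plen p).+1) f m k *.: vec p m x.
  exists (fun _ _ => 0); split=> [m|k U x rk]; first exact: regular_cst.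
  by rewrite (h k) // big1 // => m _; rewrite scale0r scale0r.
have [es|ns] := eqVneq (src al) (pend u); last first.
  by apply: zero => k U x _; rewrite scalerA path_inM pcomp_undefined 1?eq_sym // scale0r.
have [w ew] := @pcomp_defined _ (parrow al) u (esym es).
have [rw|nr] := boolP (right_subpath w p).
  have [e1 e2] := right_subpathE rw.
  exists (fun m _ => (m == plen w)%:R); split=> [m|k U x _]; first exact: regular_cst.
  rewrite (bigD1_seq (plen w)) ?iota_uniq ?mem_index_iota //= eqxx scale1r scale1r.
  rewrite -e1 big1 ?addr0 => [|m /negPf->]; last by rewrite scale0r scale0r.
  by rewrite scalerA (path_in_comp ew).
have [du|nd] := boolP (detour p al u).
  exists (fun m k => oapp k 0 (detour_at p al u m)); split=> [m|k U x rk].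
    by case: detour_at => [d|] /=; [apply: regular_var | apply: regular_cst].
  exact: rep_detour rk du.
apply: zero => k U x [mp _].
have [] := mast_coord_end mp (i := j.+1) (a := ar al * path_in u) (e := tgt al).
- by rewrite -add1n; apply: radnM; apply: radn_path; rewrite ?plen_pinit.
- by rewrite scalerA mulrA vx_mull eqxx.
move=> c; rewrite -scalerA => -[-> sup]; rewrite big_nat big1 // => m /andP[_ lm].
suff -> : c m = 0 by rewrite scale0r scale0r.
apply/eqP/negPn/negP => /sup[jm em]; case/negP: nd; apply/(detourP _ jp).
split=> //; first by move=> w'; rewrite ew => -[<-].
by exists m.
Qed.

(** Along a path the matrices of [arrow_coord] multiply, so the coordinates remain polynomial in the
    point. *)
Lemma rep_coord p a :
  exists f : nat -> {ffun detour_index p -> K} -> K, (forall m, regular (f m)) /\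
    forall k (U : lmodType L) (x : U), rep k x ->
      a *: x = \sum_(0 <= m < (plen p).+1) f m k *.: vec p m x.
Proof.
move: a (radn_all a); apply: radn_ind => [|c a b [f [rf hf]] [g [rg hg]]|q _].
- exists (fun _ _ => 0); split=> [m|k U x _]; first exact: regular_cst.
  by rewrite scale0r big1 // => m _; rewrite scale0r scale0r.
- exists (fun m k => c * f m k + g m k); split=> [m|k U x rk].
    by apply: regularD => //; apply: regularM => //; apply: regular_cst.
  rewrite scalePl (hf k) // (hg k) // scaler_sumr -big_split; apply: eq_bigr => m _ /=.
  by rewrite scaleCD scaleCM.
have [n] := ubnP (plen q); elim: n q => // n IHn q; rewrite ltnS => lq.
have [q0|pq] := posnP (plen q).
  rewrite (path_trivial q0); move: (pstart q) => e.
  exists (fun m _ => ((m == 0%N) && (e == pstart p))%:R); split=> [m|k U x rk].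
    exact: regular_cst.
  rewrite big_ltn // pinit0 eqxx /= [X in _ + X]big_nat big1 ?addr0; last first.
    by move=> [|m] //= _; rewrite scale0r scale0r.
  have [[[ex _ _] _ _ _] _] := rk; rewrite -ex {1}ex scalerA vx_vx eq_sym.
  by case: (eqVneq e) => [->|_]; rewrite ?scale1r ?scale1r ?scale0r // scale0r.
have [j ej] : exists j, plen q = j.+1 by exists (plen q).-1; rewrite prednK.
have [al eal] := @pinit_succ _ q j (eq_leq (esym ej)).
rewrite -ej pinit_all in eal.
have [|f [rf hf]] := IHn (pinit q j).
  by rewrite plen_pinit ej // in lq *.
have arc (i : 'I_(plen p).+1) := arrow_coord al (ltn_ord i : (i <= plen p)%N).
pose g (i : 'I_(plen p).+1) := projT1 (cid (arc i)).
have gP i : (forall m, regular (g i m)) /\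
    forall k (U : lmodType L) (x : U), rep k x ->
      ar al *: vec p i x = \sum_(0 <= m < (plen p).+1) g i m k *.: vec p m x.
  by rewrite /g; case: cid.
exists (fun m k => \sum_(i < (plen p).+1) f i k * g i m k); split=> [m|k U x rk].
  by apply: regular_sum => i; apply: regularM => //; case: (gP i).
rewrite -(path_in_comp eal) -scalerA (hf k) // big_mkord scaler_sumr.
under [RHS]eq_bigr => m _ do rewrite scaler_suml scaler_suml.
rewrite exchange_big /=; apply: eq_bigr => i _.
rewrite scaleCl (proj2 (gP i) k U x rk) scaler_sumr; apply: eq_bigr => m _.
by rewrite scaleCM.
Qed.

Lemma rep_presents p (k : {ffun detour_index p -> K}) (U U' : lmodType L)
    (x : U) (x' : U') a : rep k x -> rep k x' -> a *: x = 0 -> a *: x' = 0.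
Proof.
move=> rk rk' ax; have [f [_ hf]] := rep_coord p a.
rewrite (hf k) // big_nat big1 // => m /andP[_ lm].
suff -> : f m k = 0 by rewrite scale0r scale0r.
apply: (@mast_coord_uniq U x p (proj1 rk) (fun m => f m k) (fun=> 0)) => //.
by rewrite -hf // ax big1 // => j _; rewrite scale0C.
Qed.

Lemma rep_isom p (k : {ffun detour_index p -> K}) (U U' : lmodType L)
    (x : U) (x' : U') : rep k x -> rep k x' -> isom U U'.
Proof.
move=> rk rk'; have [[[_ _ gx] _ _ _] _] := rk; have [[[_ _ gx'] _ _ _] _] := rk'.
apply: (isom_presents (x := x) (w := x') (N := fun a => a *: x = 0)); split=> // a.
by split; [apply: rep_presents rk' rk | apply: rep_presents rk rk'].
Qed.

(** * Halyards *)

Lemma in_rad_degree (U : lmodType L) (x y : U) p n : mast_at p x -> in_rad x n y -> y != 0 ->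
  exists i, [/\ (n <= i)%N, (i <= plen p)%N, in_rad x i y & ~ in_rad x i.+1 y].
Proof.
move=> mp jn y0; apply: contrapT => none; case/eqP: y0.
have [_ _ _ kill] := mp.
suff H i : in_rad x (n + i) y.
  have [a ra ->] := H (plen p).+1; apply: kill; apply: radn_le ra.
  exact: leq_addl.
elim: i => [|i IHi]; first by rewrite addn0.
rewrite addnS; apply: contrapT => nj; apply: none; exists (n + i)%N; split=> //.
  exact: leq_addr.
rewrite leqNgt; apply/negP => lt; apply: nj; have [a ra ey] := IHi.
suff -> : y = 0 by apply: (submodule0 (in_rad_submodule _ _)).
by rewrite ey; apply: kill; apply: radn_le ra.
Qed.

Lemma N_halyard p al u : condition_N pi -> halyard pi p al u -> circular pi p al u.
Proof.
move=> N [du [d [d1 d2 nv]]].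
have [k [[U [x rk]] kd]] : exists k, (exists (U : lmodType L) (x : U), rep k x) /\ k d != 0.
  apply: contrapT => none; apply: nv => k /points_rep pk.
  have -> : poly_eval (poly_var K d) k = k d.
    by rewrite /poly_eval /poly_var mpoly.mevalXU enum_rankK.
  by apply/eqP; apply: contrapT => /negP kd; apply: none; exists k.
have mx := proj1 rk; have [_ _ ld ed] := detour_index_target d.
have [gx lay nz kill] := mx.
have [ru _ _] := and3P du; have [eu lu] := right_subpathE ru.
pose y := ar al *: (path_in u *: x).
have y0 : y != 0.
  apply: contra_neq kd => y0; have := rep_detour rk du; rewrite -/y y0 => e.
  have := @mast_coord_uniq U x p mx (fun=> 0) (fun m => oapp k 0 (detour_at p al u m)) _ _ ld.
  rewrite -e d1 d2 in ed *; rewrite ed => ->//.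
  by rewrite big1 // => j _; rewrite scale0C.
have jy : in_rad x (plen u).+1 y.
  by rewrite -add1n; apply: in_radM; [apply: radn_path | apply/in_rad_radn/radn_path].
(* The layer in which y appears selects the target, which need not be that of [d]; y and the basis
   vector of this layer both generate J^i x. *)
have [i [ui ip ji nji]] := in_rad_degree mx jy y0.
have ey : y = (ar al * path_in u) *: x by rewrite -scalerA.
have ei : tgt al = pend (pinit p i).
  have [a ra ea] := ji; rewrite ea in nji; apply: (mast_pend mx ip ra _ nji).
  by rewrite -ea ey scalerA mulrA vx_mull eqxx.
have pm : is_mast pi p by apply/is_mastP; exists U, x.
have [|c [cu [cyc c0 ecu ev]]] := N_detour (v := pinit p i) N pm du.
  by rewrite /detour_target pinit_right_subpath plen_pinit // ui ei eqxx.
exists U, x, c, cu, (pinit p i); rewrite !pthE; split=> //.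
- by split; [apply: mast_at_of mx | apply: generator_top_element gx].
- by split=> //; apply: pinit_right_subpath.
have gv z : in_rad x i z <-> exists a, z = a *: vec p i x.
  by rewrite -(rad_powE _ _ gx); apply: rad_pow_gen.
have gy z : in_rad x i z <-> exists a, z = a *: y.
  split=> [[b rb ->]|[b ->]]; last exact: (submoduleZ _ (in_rad_submodule _ _)).
  have [a ra ea] := ji; rewrite ea in nji *; exact: mast_generates mx ra nji rb.
have -> : ar al *: (path_in c *: (path_in u *: x)) = vec p i x.
  by rewrite [path_in c *: _]scalerA (path_in_comp ecu) scalerA (path_in_comp ev).
by move=> z; rewrite -gy gv.
Qed.

Lemma comp_series_mast (U : lmodType L) (x : U) p n (S : 'I_n -> lmodType L) :
  mast_at p x -> (comp_series S U <->
    n = (plen p).+1 /\ forall i : 'I_n, line (pend (pinit p i)) (S i)).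
Proof.
move=> mp; rewrite /comp_series (mast_comp_length _ mp).
split=> -[en h]; split=> // i;
  have lip : (i <= plen p)%N by rewrite -ltnS -en.
  by apply/(mast_factor_line _ mp lip)/h.
by apply/(mast_factor_line _ mp lip); apply: h.
Qed.

Lemma lines_path_eq n (S : 'I_n -> lmodType L) p q : no_double_arrows G ->
  n = (plen p).+1 -> n = (plen q).+1 ->
  (forall i : 'I_n, line (pend (pinit p i)) (S i)) ->
  (forall i : 'I_n, line (pend (pinit q i)) (S i)) -> p = q.
Proof.
move=> nd np nq lp lq; apply: pend_path_eq => // [|i ip].
  by apply: succn_inj; rewrite -np.
have lin : (i < n)%N by rewrite np.
exact: line_uniq (lp (Ordinal lin)) (lq (Ordinal lin)).
Qed.

(** Without detours the ambient affine space has no coordinates, so V_p has at most one point. *)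
Lemma no_detour_isom (U U' : lmodType L) (x : U) (x' : U') p :
  (forall al u, ~~ detour p al u) -> mast_at p x -> mast_at p x' -> isom U U'.
Proof.
move=> nd mp mp'; have [k rk] := rep_exists mp; have [k' rk'] := rep_exists mp'.
have ek : k = k'.
  apply/ffunP => d; have [dd _ _ _] := detour_index_target d.
  by have := nd (dt_arrow d) (dt_base d); rewrite dd.
by rewrite -ek in rk'; apply: rep_isom rk rk'.
Qed.

Lemma N_repetition_free n (S : 'I_n -> lmodType L) (U U' : lmodType L) :
  condition_N pi -> (forall i j, i <> j -> ~ isom (S i) (S j)) ->
  uniserial U -> comp_series S U -> uniserial U' -> comp_series S U' -> isom U U'.
Proof.
move=> N inj uU cU uU' cU'; have nd := N_no_double_arrows N.
have [p [x mx]] := uniserial_mast uU; have [p' [x' mx']] := uniserial_mast uU'.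
have [np lp] := (comp_series_mast _ mx).1 cU; have [np' lp'] := (comp_series_mast _ mx').1 cU'.
have ep := lines_path_eq nd np np' lp lp'; rewrite -ep in mx'.
have pm : is_mast pi p by apply/is_mastP; exists U, x.
apply: no_detour_isom mx mx' => al u; apply/negP => du.
have [ru _ /hasP[v _ tv]] := and3P du; have [rv _ _] := and3P tv.
(* The cycle makes [p] return to the end of [u], against the absence of repetitions. *)
have [c [cu [[c1 c2] c0 ecu ev]]] := N_detour N pm du tv.
have rcu := right_subpath_trans (pcomp_right_subpath ev) rv.
have [eu lu] := right_subpathE ru; have [ecu' lcu] := right_subpathE rcu.
have lun : (plen u < n)%N by rewrite np.
have lcun : (plen cu < n)%N by rewrite np.
apply: (inj (Ordinal lun) (Ordinal lcun)).
  move=> /(congr1 (@nat_of_ord _)) /= e; move: c0.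
  by rewrite -(ltn_add2l (plen u)) addn0 -(plen_comp ecu) -e ltnn.
apply: (line_isom (e := pend u)); first by have := lp (Ordinal lun); rewrite /= -eu.
by have := lp (Ordinal lcun); rewrite /= -ecu' (pend_comp ecu) c2.
Qed.

(** * Normalised top elements *)

(** The character of 1 - k c at the vertex of [x] is 1, and c x lies at that vertex, so the shifted
    vector is again a top element. *)
Lemma mast_shift (U : lmodType L) (x : U) p c k : mast_at p x ->
  cycle_at (pstart p) c -> (0 < plen c)%N -> mast_at p (x - k *.: (path_in c *: x)).
Proof.
move=> mp [c1 c2] c0; have [gx _ _ _] := mp; have [ex _ _] := gx.
apply: (mast_of_at (mast_at_of mp) (e := pstart p)); apply: (generator_top gx).
  have -> : x - k *.: (path_in c *: x) = (1 - k *: path_in c) *: x.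
    by rewrite scalerBl scale1r [X in _ = _ - X]scaleZl.
  move/(generator_notin_radE _ gx)/eqP; rewrite epsB epsZ eps1 eps_radn ?mulr0 ?subr0.
    by rewrite oner_eq0.
  exact: radn_path.
by rewrite scalerBr -ex scaleCl scalerA vx_mull c2 eqxx.
Qed.

(* Subtracting a multiple of c x from x moves al x one layer down. *)
Lemma mast_normalise (U : lmodType L) (x : U) p al c j : mast_at p x -> (j <= plen p)%N ->
  cycle_at (pstart p) c -> (0 < plen c)%N -> pcomp (parrow al) c = Some (pinit p j) ->
  rad_pow j (ar al *: x) ->
  exists k, let x' := x - k *.: (path_in c *: x) in
    mast_at p x' /\ rad_pow j.+1 (ar al *: x').
Proof.
move=> mp jp cyc c0 ec; have [gx _ _ _] := mp; move=> /(rad_powE _ _ gx)[a ra ea].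
have [k [r [rr er]]] := mast_layer mp jp ra; exists k; split; first exact: mast_shift.
apply/(rad_powE _ _ gx); rewrite scalerBr ea er scaleCl scalerA (path_in_comp ec).
by rewrite addrAC subrr add0r; apply: in_rad_radn.
Qed.

(** One layer at a time: at most one arrow other than [al] can have a component in layer j, since
    that determines its ends. By (N) the basis vector of this layer is the arrow applied to c x, so
    a multiple of c x can be subtracted. *)
Lemma N_normalised (U : lmodType L) (x : U) p p1 al : condition_N pi -> mast_at p x ->
  pcomp p1 (parrow al) = Some p ->
  exists x' : U, mast_at p x' /\ forall be, be != al -> ar be *: x' = 0.
Proof.
move=> N mx ep; have nd := N_no_double_arrows N.
suff /(_ (plen p).+1)[x' [mx' h]] : forall j, exists x' : U, mast_at p x' /\
    forall be, be != al -> rad_pow j (ar be *: x').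
  exists x'; split=> // be /h; have [gx' _ _ kill] := mx'.
  by move/(rad_powE _ _ gx')=> [a /kill ->].
elim=> [|j [{mx}x [mx h]]]; first by exists x; split=> // be _.
have [all|] := pselect (forall be, be != al -> rad_pow j.+1 (ar be *: x)).
  by exists x.
move/existsNP=> [be /not_implyP[ne nj]]; have [gx _ _ kill] := mx.
have nin_rad : ~ in_rad x j.+1 (ar be *: x) by move/(rad_powE _ _ gx).
have nz : ar be *: x != 0.
  by apply/eqP => z; apply: nin_rad; rewrite z; apply: (submodule0 (in_rad_submodule _ _)).
have [ex _ _] := gx; have sbe := path_in_src ex nz.
have [a ra ea] := (rad_powE _ _ gx).1 (h be ne).
have jp : (j <= plen p)%N.
  rewrite leqNgt; apply/negP => pj; case/eqP: nz; rewrite ea; apply: kill.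
  exact: radn_le ra.
have j0 : (0 < j)%N.
  by case: (j) nin_rad => // -[]; apply/in_rad_radn/radn_path.
have tbe : tgt be = pend (pinit p j).
  rewrite ea in nin_rad; apply: (mast_pend mx jp ra _ nin_rad).
  by rewrite -ea scalerA vx_mull eqxx.
have pm : is_mast pi p by apply/is_mastP; exists U, x.
have e0 : pinit p 0 = pvertex (pstart p) := pinit0 p.
have [||c [cu [cyc c0 ecu ev]]] :=
    N_detour (p := p) (al := be) (u := pinit p 0) (v := pinit p j) N pm.
- apply/(detourP be (leq0n _)); rewrite e0; split=> //; last by exists j.
  have sbe' : pstart (parrow be) = pstart p by rewrite -[LHS]/(src be).
  move=> w; rewrite pcomp_vertexr sbe' eqxx => -[<-].
  have [_ s2 s3] := (pcomp_someP _ _ _).1 ep.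
  by rewrite /right_subpath s3 /= (negPf ne) andbF.
- by rewrite /detour_target pinit_right_subpath !plen_pinit // j0 tbe eqxx.
rewrite e0 in cyc ecu; have [c1 c2] := cyc.
move: ecu; rewrite pcomp_vertexr c1 [pend _]/(pstart p) eqxx => -[ec]; rewrite -ec in ev.
have lc : j = (plen c).+1 by have := plen_comp ev; rewrite plen_pinit // addn1.
have [k [mx' h']] := mast_normalise mx jp cyc c0 ev (h be ne).
exists (x - k *.: (path_in c *: x)); split=> // ga neg.
have [->|ngb] := eqVneq ga be; first exact: h'.
(* Any arrow with a component in layer [j] would share both ends with [be]; hence the shift does not
   disturb the other arrows. *)
have dif (b : L) : radn j (ar ga * b) -> src ga = pstart p ->
    in_rad x j.+1 ((ar ga * b) *: x).
  move=> rb sg; apply: contrapT => nb; case/eqP: ngb; apply: nd; first by rewrite sg.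
  by rewrite tbe; apply: (mast_pend mx jp rb _ nb); rewrite scalerA mulrA vx_mull eqxx.
apply/(rad_powE _ _ gx); rewrite scalerBr scaleCl.
have [sg|nsg] := eqVneq (src ga) (pstart p); last first.
  have z (y : U) : y = vx (pstart p) *: y -> ar ga *: y = 0.
    move=> ey; apply/eqP; apply: contraNT nsg => nzy.
    by rewrite (path_in_src ey nzy).
  rewrite !z ?scaler0 ?subr0 //; first exact: (submodule0 (in_rad_submodule _ _)).
  by rewrite scalerA vx_mull c2 eqxx.
apply: (submoduleB (in_rad_submodule _ _)); last first.
  apply: (submoduleZ _ (in_rad_submodule _ _)); rewrite scalerA; apply: dif => //.
  by rewrite lc -add1n; apply: radnM; apply: radn_path.
have [b rb eb] := (rad_powE _ _ gx).1 (h ga neg).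
apply: contrapT => nb; case/eqP: ngb; apply: nd; first by rewrite sg.
rewrite tbe; rewrite eb in nb; apply: (mast_pend mx jp rb _ nb).
by rewrite -eb scalerA vx_mull eqxx.
Qed.

(** * Sequences of simple modules *)

Lemma passes_throughP n (S : 'I_n -> lmodType L) p :
  passes_through pi S p <->
  n = (plen p).+1 /\ forall i : 'I_n, line (pend (pinit p i)) (S i).
Proof.
split=> -[en h]; split=> // i; have lip : (i <= plen p)%N by rewrite -ltnS ?en -?en.
  by have /simple_atP := h i; rewrite (pend_pinit (pstart p)).
by apply/simple_atP; rewrite -pend_pinit.
Qed.

Lemma var_of_seriesE n (S : 'I_n -> lmodType L) p : no_double_arrows G ->
  passes_through pi S p -> var_of_series pi S = var_of_path pi p.
Proof.
move=> nd tp; rewrite /var_of_series; case: pselect => [ex|[]]; last by exists p.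
case: cid => q tq /=; congr var_of_path.
have [nq lq] := (passes_throughP S q).1 tq; have [np lp] := (passes_throughP S p).1 tp.
exact: lines_path_eq nd nq np lq lp.
Qed.

Lemma comp_series_passes (U : lmodType L) (x : U) p n (S : 'I_n -> lmodType L) :
  mast_at p x -> (comp_series S U <-> passes_through pi S p).
Proof.
move=> mp; apply: (iff_trans (comp_series_mast S mp)).
by apply: iff_sym; apply: passes_throughP.
Qed.

(** An element annihilating a top element at e lies in J after multiplication by e, hence is a sum
    of terms ending in single arrows; on normalised vectors only the term of [al] acts. *)
Lemma normalised_ann (U U' : lmodType L) (x : U) (x' : U') p al b :
  mast_at p x -> mast_at p x' -> src al = pstart p ->
  (forall be, be != al -> ar be *: x = 0) -> (forall be, be != al -> ar be *: x' = 0) ->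
  (forall c, c *: (ar al *: x) = 0 -> c *: (ar al *: x') = 0) ->
  b *: x = 0 -> b *: x' = 0.
Proof.
move=> mp mp' sal nx nx' sub bx; have [gx _ _ _] := mp; have [gx' _ _ _] := mp'.
have [ex _ _] := gx; have [ex' _ _] := gx'.
have eb : eps (pstart p) b = 0.
  apply/(generator_notin_radE b gx); rewrite bx.
  exact: (submodule0 (in_rad_submodule _ _)).
have [|c [_ ec]] := @radn_arrows 0 (b * vx (pstart p)).
  apply/radn1P => f; rewrite epsM eps_vx.
  by case: eqP => [<-|_]; rewrite ?mulr0 // eb mul0r.
have dec (V : lmodType L) (y : V) : y = vx (pstart p) *: y ->
    (forall be, be != al -> ar be *: y = 0) -> b *: y = c al *: (ar al *: y).
  move=> ey ny; rewrite {1}ey scalerA ec scaler_suml (bigD1 al) //= -scalerA.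
  by rewrite big1 ?addr0 // => be /ny; rewrite -scalerA => ->; rewrite scaler0.
by rewrite (dec U' x') //; apply: sub; rewrite -(dec U x).
Qed.

Lemma N_finite_extension l (S : 'I_l.+1 -> lmodType L) : condition_N pi ->
  affine_finite (var_of_series pi (fun i : 'I_l => S (lift ord0 i))) ->
  finitely_many_up_to_isom (fun U : lmodType L => uniserial U /\ comp_series S U).
Proof.
move=> N fin; have nd := N_no_double_arrows N.
case: (pselect (exists p, passes_through pi S p)) => [[p tp]|none]; last first.
  exists 0%N, (fun=> L^o : lmodType L) => U [uU cU]; case: none.
  have [p [x mx]] := uniserial_mast uU; exists p; exact/(comp_series_passes _ mx).
have mastU (U : lmodType L) : uniserial U /\ comp_series S U -> exists x : U, mast_at p x.
  move=> [uU cU]; have [q [x mx]] := uniserial_mast uU; exists x.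
  have [nq lq] := (comp_series_mast _ mx).1 cU; have [np lp] := (passes_throughP S p).1 tp.
  by rewrite (lines_path_eq nd np nq lp lq).
have [[lp] lin] := (passes_throughP S p).1 tp.
have [p0|pp] := posnP (plen p).
  case: (pselect (exists U : lmodType L, uniserial U /\ comp_series S U)) => [[U0 h0]|none].
    exists 1%N, (fun=> U0) => U h; exists ord0.
    have [x mx] := mastU U h; have [x0 mx0] := mastU U0 h0.
    apply: no_detour_isom mx mx0 => al u; apply/negP => /and3P[_ _ /hasP[v _]].
    case/and3P=> rv luv _; have [_] := right_subpathE rv.
    by rewrite p0 leqNgt (leq_ltn_trans _ luv).
  by exists 0%N, (fun=> L^o : lmodType L) => U h; case: none; exists U.
have [al eal] := pinit_succ pp; pose p1 := pfinal p 1.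
have ep1 : pinit p 1 = parrow al.
  have [e1 e2 e3] := (pcomp_someP _ _ _).1 eal; rewrite pinit0 in e1 e3.
  by apply: qpath_inj => //; rewrite -[RHS]e1.
have ep : pcomp p1 (parrow al) = Some p by rewrite -ep1 pcomp_split.
have sal : src al = pstart p by rewrite -[LHS]/(pstart (parrow al)) -ep1.
have tp1 : passes_through pi (fun i : 'I_l => S (lift ord0 i)) p1.
  apply/passes_throughP; split; first by rewrite plen_pfinal subn1 prednK.
  move=> i.
  have := lin (lift ord0 i); rewrite [nat_of_ord (lift _ _)]/= /bump leq0n.
  have -> : pend (pinit p1 i) = pend (pinit p (1 + i)).
    rewrite -(pend_comp (@pinit_comp_add _ p1 (parrow al) p p i ep _ _)) //.
      by rewrite /right_subpath eqxx prefix_refl.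
    by rewrite plen_pfinal subn1 -ltnS prednK // -lp.
  by [].
rewrite (var_of_seriesE nd tp1) in fin; have [s hs] := fin.
(* The submodule generated by al x realises the point [k] for the mast without its first arrow; by
   [normalised_ann] this fixes the isomorphism class of [U]. *)
pose good (k : {ffun detour_index p1 -> K}) (U : lmodType L) := exists x : U,
  [/\ mast_at p x, forall be, be != al -> ar be *: x = 0
    & exists (Q : lmodType L) (z : Q), rep k z /\
        presents z (fun b => b *: (ar al *: x) = 0)].
(* Points realised by no normalised module get [L] as a default, to which no [U] is sent. *)
exists (size s), (fun i => if pselect (exists U, good (nth [ffun=> 0] s i) U) is left e
  then projT1 (cid e) else L^o : lmodType L) => U h.
have [x0 mx0] := mastU U h; have [x [mx nx]] := N_normalised N mx0 ep.
have [_ _ _ kill] := mx.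
have [|Q [z [mz pz]]] := submast mx ep; first by rewrite /right_subpath eqxx prefix_refl.
have {}pz : presents z (fun b => b *: (ar al *: x) = 0).
  apply: presents_eq pz _ => b; split=> [[c /kill -> //]|->].
  exact: (submodule0 (in_rad_submodule _ _)).
have [k rk] := rep_exists mz.
have ks : k \in s by apply/hs/points_rep; exists Q, z.
have gk : good k U by exists x; split=> //; exists Q, z.
have ik : (index k s < size s)%N by rewrite index_mem.
exists (Ordinal ik); case: pselect => [e|[]]; last by exists U; rewrite nth_index.
case: cid => U' /=; rewrite nth_index // => -[x' [mx' nx' [Q' [z' [rk' [gz' hz']]]]]].
have [gz hz] := pz; have [[_ _ gx] _ _ _] := mx; have [[_ _ gx'] _ _ _] := mx'.
apply: (isom_presents (x := x) (w := x') (N := fun a => a *: x = 0)); split=> // b.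
split; apply: (normalised_ann (p := p) (al := al)) => // c.
  by move/hz'/(rep_presents rk' rk)/hz.
by move/hz/(rep_presents rk rk')/hz'.
Qed.

(** * Finite uniserial type *)

Section Twist.
Variables (U : lmodType L) (x : U) (p : qpath G) (al : arrow G) (k0 : K).
Hypotheses (mp : mast_at p x) (p0 : (0 < plen p)%N).
Hypotheses (sp : pstart p = src al) (tp : pend p = tgt al) (np : p != parrow al).
Hypothesis al_x : ar al *: x = k0 *.: (path_in p *: x).

Let y := path_in p *: x.

(* The action of al on x is changed by t p x; the other arrows act as before. *)
Definition twist t (a : L) : U := a *: x + (t * cf al a) *.: y.

Let gx : generator (pstart p) x. Proof. by case: mp. Qed.

Let yE a : a *: y = eps (tgt al) a *.: y.
Proof.
apply/eqP; rewrite -subr_eq0 -scalerBl; apply/eqP/(mast_soc_eps mp).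
by rewrite -tp epsB epsZ eps1 mulr1 subrr.
Qed.

Let y_rad c : in_rad x 1 (c *.: y).
Proof. by apply: (submoduleZ _ (in_rad_submodule _ _)); apply/in_rad_radn/radn_path. Qed.

Lemma twist_eps t a : twist t a = 0 -> eps (src al) a = 0.
Proof.
move=> e; rewrite -sp; apply/(generator_notin_radE a gx).
rewrite -[a *: x](addrK ((t * cf al a) *.: y)) -/(twist t a) e sub0r.
exact: (submoduleN (in_rad_submodule _ _) (y_rad _)).
Qed.

Lemma twistD t a b : twist t (a + b) = twist t a + twist t b.
Proof. by rewrite /twist cfD mulrDr scaleCD scalerDl addrACA. Qed.

(** The condition on [eps] removes the second Leibniz term. It holds on the kernel of the twist by
    [twist_eps], which makes this kernel a left ideal. *)
Lemma twistM t a b : eps (src al) b = 0 -> twist t (a * b) = a *: twist t b.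
Proof.
move=> e; rewrite /twist cfM e mulr0 addr0 scalerDr scalerA; congr (_ + _).
by rewrite scaleCl yE -scaleCM mulrCA mulrC.
Qed.

Lemma twistZ t c a : twist t (c *: a) = c *.: twist t a.
Proof. by rewrite /twist cfZ scalerDr [(c *: a) *: x]scaleZl -scaleCM mulrCA. Qed.

Lemma twistB t a b : twist t (a - b) = twist t a - twist t b.
Proof. by rewrite twistD -[in LHS]scaleN1r twistZ scaleN1r scaleN1r. Qed.

Let cfp0 : cf al (path_in p) = 0.
Proof. by rewrite cf_path (negPf np). Qed.

(** p x is unchanged because [p] differs from [al], so [cf al] vanishes on it; J^(plen p + 1) still
    acts as zero because it lies in J^2. *)
Lemma twist_mast t : exists (Q : lmodType L) (z : Q),
  mast_at p z /\ presents z (fun a => twist t a = 0).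
Proof.
have [|Q [z pz]] := @presents_exists (fun a => twist t a = 0).
  split=> [|a b c hb hc]; first by rewrite /twist cf0 mulr0 scale0C scale0r addr0.
  by rewrite twistD [a *: b]/((a : L) * b) twistM ?hb ?hc ?scaler0 ?addr0 //; apply: twist_eps hb.
have [gz hz] := pz; exists Q, z; split=> //.
have same a b : twist t (a - b) = 0 -> a *: z = b *: z.
  by move=> h; apply/eqP; rewrite -subr_eq0 -scalerBl; apply/eqP/hz.
have [[ex x0 _] lay nz kill] := mp.
have lay0 i a : (i <= plen p)%N -> radn i a ->
    exists b, a *: x = b *: (path_in (pinit p i) *: x) by apply: lay.
split.
- split=> //.
    rewrite -{1}[z]scale1r; apply: same.
    by rewrite /twist cfB cf1 cf_vx subrr mulr0 scale0C addr0 scalerBl scale1r -ex subrr.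
  apply/eqP => z0; have := (hz 1).1; rewrite z0 scaler0 => /(_ erefl).
  by rewrite /twist cf1 mulr0 scale0C addr0 scale1r => /eqP; rewrite (negPf x0).
- move=> i a ip ra; have [b eb] := lay0 i a ip ra.
  set v := path_in (pinit p i) in eb *.
  (* [b] settles the untwisted action; the remaining error is a multiple of p x, reached from the
     i-th vector along the rest of [p]. *)
  exists (b + (t * cf al (a - b * v)) *: path_in (pfinal p i)); rewrite scalerA.
  have vp : path_in (pfinal p i) * v = path_in p by rewrite (path_in_comp (pcomp_split p i)).
  apply: same; rewrite mulrDl -scalerAl vp opprD addrA twistB twistZ.
  have -> : twist t (path_in p) = y by rewrite /twist cfp0 mulr0 scale0C addr0.
  by rewrite {1}/twist scalerBl -[(b * v) *: x]scalerA -eb subrr add0r subrr.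
- apply/eqP => /hz; rewrite /twist cfp0 mulr0 scale0C addr0.
  exact/eqP.
move=> a ra; apply/hz; rewrite /twist kill // cf_radn ?mulr0 ?scale0C ?addr0 //.
by apply: radn_le ra; rewrite ltnS.
Qed.

(* The vector al r x has no component at p x, which spans the socle. *)
Hypothesis nosoc : forall r : L, radn 1 r -> exists c : nat -> K,
  ar al *: (r *: x) = \sum_(0 <= m < (plen p).+1) c m *.: (path_in (pinit p m) *: x) /\
  c (plen p) = 0.

Lemma twist_inj (M : lmodType L) (m m' : M) t s :
  presents m (fun a => twist t a = 0) -> presents m' (fun a => twist s a = 0) -> t = s.
Proof.
move=> [gm hm] [gm' hm']; have [b eb] := gm' m.
have [_ _ nz kill] := mp.
have epsb : eps (src al) b != 0.
  apply/eqP => z; have [d ed] := gm m'.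
  have : twist s (1 - d * b) = 0.
    by apply/hm'; rewrite scalerBl scale1r -scalerA -eb -ed subrr.
  move/twist_eps/eqP; rewrite epsB eps1 epsM z mulr0 subr0 oner_eq0 //.
(* After the twist by [t], [al] acts on the generator as k0 + t times [p]; so [a] annihilates [m],
   which is b m'. *)
pose a := ar al - (k0 + t) *: path_in p.
have a0 : twist t a = 0.
  rewrite /twist /a cfB cfZ cfp0 mulr0 subr0 cf_path eqxx mulr1 scalerBl al_x.
  by rewrite [X in _ - X]scaleZl scaleCD opprD addrA subrr add0r addNr.
have := (hm a).2 a0; rewrite eb scalerA => /hm'.
pose r := (b - (eps (src al) b)%:A) * vx (src al).
have rr : radn 1 r.
  apply/radn1P => f; rewrite epsM eps_vx; case: eqP => [<-|_]; last by rewrite mulr0.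
  by rewrite epsB epsZ eps1 !mulr1 subrr.
have [ex _ _] := gx; rewrite sp in ex.
have bx : b *: x = eps (src al) b *.: x + r *: x.
  by rewrite -scalerA -ex -scalerDl addrC subrK.
have cfab : cf al (a * b) = eps (src al) b.
  rewrite cfM [eps _ a]eps_radn ?mul0r ?add0r; last first.
    by apply: radnB; [apply: radn_path | apply/radnZ/radn_path].
  by rewrite cfB cfZ cfp0 cf_path eqxx mulr0 subr0 mul1r.
have [c [ec cl]] := nosoc rr.
rewrite /twist cfab -[(a * b) *: x]scalerA bx scalerDr scaleCl.
have -> : a *: x = - (t *.: y).
  rewrite scalerBl al_x [X in _ - X]scaleZl scaleCD opprD addrA subrr add0r //.
have -> : a *: (r *: x) = ar al *: (r *: x).
  rewrite scalerBl [X in _ - X]scaleZl (_ : path_in p *: (r *: x) = 0) ?scaler0 ?subr0 //.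
  by rewrite scalerA; apply: kill; rewrite -addn1; apply: radnM => //; apply: radn_path.
rewrite ec scalerN -scaleCM addrAC -scaleNr => e.
(* The relation has coordinate [eps (src al) b] times s - t at p x, because al r x contributes
   nothing there by [nosoc]. *)
pose c' m := c m + (m == plen p)%:R * (eps (src al) b * (s - t)).
have := @mast_coord_uniq U x p mp c' (fun=> 0) _ (plen p) (leqnn _).
rewrite [c' (plen p)]/c' cl eqxx mul1r add0r => /(_ _)/eqP.
rewrite mulf_eq0 (negPf epsb) subr_eq0.
suff h : \sum_(0 <= m < (plen p).+1) c' m *.: (path_in (pinit p m) *: x) =
    \sum_(0 <= m < (plen p).+1) 0 *.: (path_in (pinit p m) *: x).
  by move=> /(_ h)/eqP.
rewrite [RHS]big1 => [|j _]; last by rewrite scale0C.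
under eq_bigr => j _ do rewrite scaleCD.
rewrite big_split /= -[RHS]e addrC; congr (_ + _).
rewrite (bigD1_seq (plen p)) ?iota_uniq ?mem_index_iota //= eqxx mul1r pinit_all.
rewrite big1 ?addr0 => [|j /negPf->]; last by rewrite mul0r scale0C.
rewrite -[in RHS]scaleNr -scaleCD; congr (_%:A *: _).
by rewrite mulrBr [s * _]mulrC addrC.
Qed.

End Twist.

Lemma infinite_uniq n : (forall s : seq K, exists x, x \notin s) ->
  exists s : seq K, uniq s /\ size s = n.
Proof.
move=> inf; elim: n => [|n [s [us <-]]]; first by exists [::].
by have [x xs] := inf s; exists (x :: s); rewrite /= xs us.
Qed.

(** * A violation of (N) of minimal length *)

Section MinimalCounterexample.
Variables (U : lmodType L) (x : U) (p : qpath G) (al : arrow G).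
Hypotheses (mp : mast_at p x) (sp : pstart p = src al) (tp : pend p = tgt al).
Hypothesis bad : ~ absorbs al p.
Hypothesis minimal : forall w, is_mast pi w -> (0 < plen w < plen p)%N ->
  pstart w = src al -> pend w = tgt al -> absorbs al w.

Let pm : is_mast pi p. Proof. by apply/is_mastP; exists U, x. Qed.

Let al_notin au : pcomp (parrow al) (pvertex (pstart p)) = Some au ->
  ~ right_subpath au p.
Proof.
rewrite pcomp_vertexr; case: eqP => // _ [<-] /right_subpathP[c ec].
apply: bad; left; exists c => //; have [c1 _ _] := (pcomp_someP _ _ _).1 ec.
by split; [rewrite -c1 | rewrite -(pend_comp ec)].
Qed.

Lemma minimal_absorbs u v w : right_subpath v p -> pcomp w u = Some v ->
  (0 < plen w < plen p)%N -> src al = pend u -> tgt al = pend v -> absorbs al w.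
Proof.
move=> rv ew lw es et; apply: minimal.
- exact: submast_is_mast ew rv.
- exact: lw.
- by have [<- _ _] := (pcomp_someP _ _ _).1 ew; rewrite es.
- by rewrite -(pend_comp ew) et.
Qed.

(** A component of al x in a layer j below [plen p] makes the initial subpath of length j a shorter
    mast with the ends of [al], to which (N) applies. It cannot start with [al], as [p] would too;
    so it is al c, and subtracting a multiple of c x removes the component. *)
Lemma minimal_normalised : exists (x' : U) k0,
  mast_at p x' /\ ar al *: x' = k0 *.: (path_in p *: x').
Proof.
suff /(_ (plen p) (leqnn _))[x' [mx' h]] : forall j, (j <= plen p)%N ->
    exists x' : U, mast_at p x' /\ rad_pow j (ar al *: x').
  exists x'; have [gx _ _ kill] := mx'; move/(rad_powE _ _ gx): h => [a ra ea].
  have [k [r [rr er]]] := mast_layer mx' (leqnn _) ra.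
  by exists k; split=> //; rewrite ea er (kill r rr) addr0 pinit_all.
elim=> [_|j IHj jp]; first by exists x.
have [x1 [mx h]] := IHj (ltnW jp); have [gx _ _ kill] := mx.
have [|nj] := pselect (rad_pow j.+1 (ar al *: x1)); first by exists x1.
have nin_rad : ~ in_rad x1 j.+1 (ar al *: x1) by move/(rad_powE _ _ gx).
have j0 : (0 < j)%N.
  by case: (j) nin_rad => // -[]; apply/in_rad_radn/radn_path.
have tbe : tgt al = pend (pinit p j).
  have [a ra ea] := (rad_powE _ _ gx).1 h.
  rewrite ea in nin_rad; apply: (mast_pend mx (ltnW jp) ra _ nin_rad).
  by rewrite -ea scalerA vx_mull eqxx.
have rv := pinit_right_subpath p j; pose u : qpath G := pvertex (pstart p).
have ru : right_subpath u p by rewrite /u -pinit0; apply: pinit_right_subpath.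
have [||w ew|[au]|[c [cu [cyc ecu ev]]]] := @absorbs_detour p al u (pinit p j) ru rv.
- by rewrite plen_pinit // ltnW.
- by rewrite -sp.
- have lw := plen_comp ew; rewrite plen_pinit 1?ltnW // add0n in lw.
  by apply: (minimal_absorbs rv ew); rewrite -?lw ?j0 // -sp.
- by move/al_notin.
have [c1 c2] := cyc.
move: ecu; rewrite pcomp_vertexr c1 [pend _]/(pstart p) eqxx => -[ec]; rewrite -ec in ev.
have c0 : (0 < plen c)%N.
  rewrite lt0n; apply/eqP => c0; rewrite (path_trivial c0) c1 in ev.
  by apply: (al_notin ev).
have [k [mx' h']] := mast_normalise mx (ltnW jp) cyc c0 ev h.
by exists (x1 - k *.: (path_in c *: x1)).
Qed.

(** If [al] applied to the j-th vector had a component at p x, the rest of [p] after position j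
    would be a shorter mast with the ends of [al]; under either alternative of (N) for it, [p]
    itself would end in [al]. *)
Lemma minimal_nosoc (r : L) : radn 1 r -> exists c : nat -> K,
  ar al *: (r *: x) = \sum_(0 <= m < (plen p).+1) c m *.: vec p m x /\
  c (plen p) = 0.
Proof.
move=> rr; have [_ _ nz kill] := mp.
have step j : (0 < j)%N -> (j < (plen p).+1)%N -> exists c : nat -> K,
    ar al *: vec p j x = \sum_(0 <= m < (plen p).+1) c m *.: vec p m x /\
    c (plen p) = 0.
  rewrite ltnS => j0 jp.
  have [es|ns] := eqVneq (src al) (pend (pinit p j)); last first.
    exists (fun=> 0); split=> //.
    rewrite scalerA path_inM pcomp_undefined 1?eq_sym // scale0r.
    by rewrite big1 // => m _; rewrite scale0C.
  have [] := mast_coord_end mp (i := j.+1) (a := ar al * path_in (pinit p j)) (e := tgt al).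
  - by rewrite -add1n; apply: radnM; apply: radn_path; rewrite ?plen_pinit.
  - by rewrite scalerA mulrA vx_mull eqxx.
  move=> c; rewrite -scalerA => -[ec sup]; exists c; split=> //.
  apply/eqP/negPn/negP => ncl; have [jl _] := sup _ ncl.
  have rv : right_subpath p p by rewrite /right_subpath eqxx prefix_refl.
  have ru := pinit_right_subpath p j.
  have [||w ew|[au eau /right_subpathE[e1 e2]]|[c' [cu [[c1 c2] ecu ev]]]] :=
      @absorbs_detour p al (pinit p j) p ru rv.
  - by rewrite plen_pinit.
  - exact: es.
  - apply: (minimal_absorbs rv ew) => //.
    have := plen_comp ew; rewrite plen_pinit // => lw.
    have w0 : (0 < plen w)%N by move: jl; rewrite lw -{1}[j]addn0 ltn_add2l.
    by rewrite w0 lw -{1}[plen w]add0n ltn_add2r.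
  - have := ec; rewrite scalerA (path_in_comp eau) {1}e1.
    have ej : plen au = j.+1 by rewrite (plen_comp eau) plen_pinit // addn1.
    rewrite ej; have -> : vec p j.+1 x =
        \sum_(0 <= m < (plen p).+1) (m == j.+1)%:R *.: vec p m x.
      rewrite (bigD1_seq j.+1) ?iota_uniq ?mem_index_iota //= eqxx !scale1r.
      by rewrite big1 ?addr0 // => m /negPf->; rewrite scale0C.
    move/(@mast_coord_uniq U x p mp (fun m => (m == j.+1)%:R) c) => /(_ _ (leqnn _)).
    case: eqP => [lp _|_ /eqP]; last by rewrite eq_sym (negPf ncl).
    apply: bad; right; exists (pinit p j); first by split; [exact: sp | exact: (esym es)].
    by rewrite eau e1 ej -lp pinit_all.
  apply: bad; right; exists cu => //; have [_ u2 _] := (pcomp_someP _ _ _).1 ecu.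
  by split; [rewrite u2 -sp | rewrite (pend_comp ecu) c2 es].
have [d ->] := mast_coord mp rr; rewrite scaler_sumr big_nat.
elim/big_rec: _ => [|j z /andP[j0 jp] [c [-> c0]]].
  by exists (fun=> 0); split=> //; rewrite big1 // => m _; rewrite scale0C.
have [c' [ec' c0']] := step j j0 jp; exists (fun m => d j * c' m + c m).
rewrite c0 c0' mulr0 addr0; split=> //; rewrite scaleCl ec' scaler_sumr -big_split.
by apply: eq_bigr => m _; rewrite scaleCD scaleCM.
Qed.

End MinimalCounterexample.

Lemma finite_type_N : (forall s : seq K, exists x, x \notin s) ->
  finite_uniserial_type L -> condition_N pi.
Proof.
move=> inf [n [M hM]] al p; have [m] := ubnP (plen p).
elim: m p => // m IHm p; rewrite ltnS => lp pm p0 sp tp.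
apply: contrapT => bad.
have min w : is_mast pi w -> (0 < plen w < plen p)%N ->
    pstart w = src al -> pend w = tgt al -> absorbs al w.
  by move=> mw /andP[w0 lw] sw tw; apply: IHm => //; apply: leq_trans lp.
have [U [x0 mx0]] := (is_mastP p).1 pm.
have [x [k0 [mx ex]]] := minimal_normalised mx0 sp tp bad min.
have np : p != parrow al.
  apply/eqP => ep; apply: bad; left; exists (pvertex (tgt al)) => //.
  by rewrite pcomp_vertexl ep eqxx.
have key t : exists i, exists w : M i, presents w (fun a => twist x p al t a = 0).
  have [Q [z [mz pz]]] := twist_mast mx p0 sp tp np t.
  have [i iQ] := hM _ (mast_uniserial mz); exists i.
  have [gz hz] := pz; have [w pw] := presents_isom iQ gz.
  by exists w; apply: presents_eq pw hz.
pose f t := projT1 (cid (key t)).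
have fP t : exists w : M (f t), presents w (fun a => twist x p al t a = 0).
  by rewrite /f; case: cid.
have finj : injective f.
  move=> t s e; have [w pw] := fP t; have := fP s; rewrite -e => -[w' pw'].
  apply: (twist_inj mx p0 sp np ex _ pw pw') => r.
  exact: minimal_nosoc.
(* One more value of the parameter than there are isomorphism classes. *)
have [s [us ss]] := infinite_uniq n.+1 inf.
have := max_card (mem (map f s)); rewrite (card_uniqP _) ?map_inj_uniq //.
by rewrite size_map ss card_ord ltnn.
Qed.

(** * Change of basis *)

(** By [mast_path_notin] only the path [pinit p i] reaches layer [i], so its coefficient in an
    expression of [a] by paths serves for all modules at once. *)
Lemma leading_coord p i a : no_double_arrows G -> (i <= plen p)%N -> radn i a ->
  exists d, forall (U : lmodType L) (x : U), mast_at p x ->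
    in_rad x i.+1 (a *: x - d *.: vec p i x).
Proof.
move=> nd ip; move: a; apply: radn_ind => [|c a b [d hd] [d' hd']|q iq].
- exists 0 => U x _; rewrite !scale0r subr0.
  exact: (submodule0 (in_rad_submodule _ _)).
- exists (c * d + d') => U x mp; rewrite scalePl scaleCD scaleCM opprD addrACA -scalerBr.
  apply: (submoduleD (in_rad_submodule _ _)) (hd' U x mp).
  exact: (submoduleZ _ (in_rad_submodule _ _) (hd U x mp)).
exists (q == pinit p i)%:R => U x mp; have [->|ne] := eqVneq q (pinit p i).
  by rewrite !scale1r subrr; apply: (submodule0 (in_rad_submodule _ _)).
rewrite scale0C subr0; move: iq; rewrite leq_eqVlt => /orP[/eqP ei|lt]; last first.
  by apply/in_rad_radn/radn_path.
apply: contrapT; rewrite {1}ei => nj; case/eqP: ne.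
by rewrite ei; apply: mast_path_notin nd mp _ nj; rewrite -ei.
Qed.

(** Elimination in a triangular system: the constant diagonal can be divided out within polynomials,
    and the single vector [x0] certifies that it has no zero entry. *)
Lemma basis_change p (b : nat -> L) (U0 : lmodType L) (x0 : U0) a :
  no_double_arrows G -> (forall i, (i <= plen p)%N -> radn i (b i)) ->
  mast_at p x0 -> (forall i, (i <= plen p)%N -> ~ in_rad x0 i.+1 (b i *: x0)) ->
  exists f : nat -> {ffun detour_index p -> K} -> K, (forall m, regular (f m)) /\
    forall k (U : lmodType L) (x : U), rep k x ->
      a *: x = \sum_(0 <= m < (plen p).+1) f m k *.: (b m *: x).
Proof.
move=> nd rb m0 nb.
pose span i (y : forall U : lmodType L, U -> {ffun detour_index p -> K} -> U) :=
  exists f : nat -> {ffun detour_index p -> K} -> K, (forall m, regular (f m)) /\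
    forall k (U : lmodType L) (x : U), rep k x ->
      y U x k = \sum_(i <= m < (plen p).+1) f m k *.: (b m *: x).
suff H i : (i <= (plen p).+1)%N -> forall c : nat -> {ffun detour_index p -> K} -> K,
    (forall m, regular (c m)) ->
    span i (fun U x k => \sum_(i <= m < (plen p).+1) c m k *.: vec p m x).
  have [c [rc hc]] := rep_coord p a; have [f [rf hf]] := H 0%N (leq0n _) c rc.
  by exists f; split=> // k U x rk; rewrite (hc k) // hf.
have [n] := ubnP ((plen p).+1 - i); elim: n i => // n IHn i; rewrite ltnS => lt.
rewrite leq_eqVlt => /orP[/eqP ei|ip] c rc.
  exists (fun _ _ => 0); split=> [m|k U x _]; first exact: regular_cst.
  by rewrite ei !big_geq.
rewrite ltnS in ip; have [d hd] := leading_coord nd ip (rb i ip).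
have d0 : d != 0.
  apply/eqP => d0; apply: (nb i ip); have := hd U0 x0 m0.
  by rewrite d0 scale0C subr0.
have [g [rg hg]] := rep_coord p (b i).
have gE k (U : lmodType L) (x : U) : rep k x ->
    b i *: x = d *.: vec p i x + \sum_(i.+1 <= m < (plen p).+1) g m k *.: vec p m x.
  move=> rk; have mp := proj1 rk; have [a' ra' ea'] := hd U x mp.
  have [e ee] := mast_coord mp ra'.
  rewrite -[LHS](subrK (d *.: vec p i x)) ea' addrC; congr (_ + _).
  rewrite ee; apply: eq_big_nat => m /andP[im lm]; congr (_%:A *: _).
  (* The coordinates of b_i x over the full basis: zero before [i], [d] at [i], then those of the
     remainder. *)
  pose e' m := if (m < i)%N then 0 else if m == i then d else e m.
  have := @mast_coord_uniq U x p mp e' (fun m => g m k) _ m lm.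
  rewrite /e' ltnNge (ltnW im) /= gtn_eqF // => -> //.
  rewrite -(hg k U x rk) -[RHS](subrK (d *.: vec p i x)) ea' ee addrC.
  rewrite (big_cat_nat (n := i)) ?(leqW ip) //= big_nat big1 ?add0r; last first.
    by move=> j /andP[_ ->]; rewrite scale0C.
  rewrite big_ltn ?ltnS // ltnn eqxx; congr (_ + _).
  by apply: eq_big_nat => j /andP[ij _]; rewrite ltnNge (ltnW ij) /= gtn_eqF.
(* Subtracting c_i / d times b_i x removes the i-th basis vector and changes the later coefficients
   by -(c_i / d) g_m. *)
pose c' m k := c m k + - (c i k * d^-1) * g m k.
have rc' m : regular (c' m).
  apply: regularD => //; apply: regularM => //.
  apply: (@regular_eq _ _ (fun k => c i k * - d^-1)); last by move=> k; rewrite mulrN.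
  by apply: regularM => //; apply: regular_cst.
have [||f [rf hf]] := IHn i.+1 _ _ c' rc'.
- by rewrite subSS; move: lt; rewrite subSn.
- by rewrite ltnS.
exists (fun m k => if m == i then c i k * d^-1 else f m k); split=> [m|k U x rk].
  by case: eqP => // _; apply: regularM => //; apply: regular_cst.
rewrite [RHS]big_ltn // eqxx.
have -> : \sum_(i.+1 <= m < (plen p).+1) (if m == i then c i k / d else f m k) *.: (b m *: x)
  = \sum_(i.+1 <= m < (plen p).+1) f m k *.: (b m *: x).
  by apply: eq_big_nat => m /andP[im _]; rewrite gtn_eqF.
rewrite -hf // (gE k) // scalerDr -scaleCM mulfVK // big_ltn // -addrA; congr (_ + _).
rewrite scaler_sumr -big_split; apply: eq_bigr => m _ /=.
by rewrite scaleCD -scaleCM addrCA -scaleCD mulNr subrr scale0C addr0.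
Qed.

(** In length two a detour would need a second arrow parallel to the mast. *)
Lemma comp_series_isom2 (S : 'I_2 -> lmodType L) (U U' : lmodType L) :
  no_double_arrows G -> uniserial U -> comp_series S U ->
  uniserial U' -> comp_series S U' -> isom U U'.
Proof.
move=> nd uU cU uU' cU'.
have [p [x mx]] := uniserial_mast uU; have [p' [x' mx']] := uniserial_mast uU'.
have [np lp] := (comp_series_mast _ mx).1 cU; have [np' lp'] := (comp_series_mast _ mx').1 cU'.
have ep := lines_path_eq nd np np' lp lp'; rewrite -ep in mx'.
have lp1 : plen p = 1%N by case: np.
apply: no_detour_isom mx mx' => al u; apply/negP => du.
have [ru _ /hasP[v _ /and3P[rv luv /eqP ev]]] := and3P du.
have [eu lu] := right_subpathE ru; have [ev' lv] := right_subpathE rv.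
have u0 : plen u = 0%N by apply/eqP; rewrite -leqn0 -ltnS -lp1; apply: leq_trans lv.
have v1 : plen v = plen p by apply/eqP; rewrite eqn_leq lv lp1 (leq_ltn_trans _ luv).
rewrite v1 pinit_all in ev'; rewrite u0 in eu; rewrite eu in du.
have [es nr _] := detourP al (leq0n _) du.
have [be eb] := @pinit_succ _ p 0 (eq_leq (esym lp1)).
have ab : al = be.
  apply: nd; first by have [e1 _ _] := (pcomp_someP _ _ _).1 eb; rewrite es e1.
  by rewrite -ev ev' -[tgt be]/(pend (parrow be)) -(pend_comp eb) -lp1 pinit_all.
by have := nr (pinit p 1); rewrite ab eb pinit_right_subpath => /(_ erefl).
Qed.

End Presentation.

(** * Two presentations of the same algebra *)

Section TwoPresentations.
Variables (K : fieldType) (L : algType K).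
Variables (G : quiver) (I : path_algebra K G -> Prop).
Variables (G' : quiver) (I' : path_algebra K G' -> Prop).
Variables (pi : {rmorphism path_algebra K G -> L}).
Variables (pi' : {rmorphism path_algebra K G' -> L}).
Hypotheses (adm : admissible I) (quo : quotient_map I pi).
Hypotheses (adm' : admissible I') (quo' : quotient_map I' pi').

(** The Jacobson radical does not depend on the presentation; the reverse inclusion follows by
    exchanging the two. *)
Lemma radn_change n (a : L) : radn pi' n a -> radn pi n a.
Proof.
elim: n a => [|n IHn] a; first by move=> _; apply: radn_all quo _.
move/(radn_arrows quo')=> [b [rb ->]]; elim/big_rec: _ => [|al c _ rc]; first exact: radn0.
apply: (radnD quo) rc; rewrite -addn1; apply: (radnM quo); first exact: IHn.
by apply/(jacobsonP adm quo)/(jacobsonP adm' quo')/(radn_path pi').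
Qed.

Lemma in_rad_change (U : lmodType L) (x x' : U) e e' n y :
  generator pi e x -> generator pi' e' x' -> (in_rad pi x n y <-> in_rad pi' x' n y).
Proof.
by move=> gx gx'; rewrite -(rad_powE adm quo n y gx) (rad_powE adm' quo' n y gx').
Qed.

(** Parallel arrows of [G'] give two modules of length two with equal composition series, isomorphic
    by [comp_series_isom2] over [G]; yet one of the arrows annihilates the first module and not the
    second. *)
Lemma no_double_arrows_change : no_double_arrows G -> no_double_arrows G'.
Proof.
move=> nd al be es et; apply: contrapT => /eqP ne.
have [M [z [mz [gz hz]]]] := arrow_mast_at adm' quo' al.
have [M' [z' [mz' [gz' hz']]]] := arrow_mast_at adm' quo' be.
have [S lS] := line_exists adm' quo' (src al).
have [T lT] := line_exists adm' quo' (tgt al).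
pose ST (i : 'I_2) := if val i == 0%N then S else T.
have cS (V : lmodType L) (v : V) ga : src ga = src al -> tgt ga = tgt al ->
    mast_at pi' (parrow ga) v -> comp_series ST V.
  move=> sg tg mv; apply/(comp_series_mast adm' quo' _ mv); split=> //.
  move=> [[|[|//]] i2]; rewrite /ST /=; first by rewrite pinit0 -[pend _]/(src ga) sg.
  by rewrite -[1%N]/(plen (parrow ga)) pinit_all -[pend _]/(tgt ga) tg.
have iMM : isom M M'.
  apply: (comp_series_isom2 adm quo (S := ST) nd).
  - exact: (mast_uniserial adm' quo' mz).
  - exact: cS mz.
  - exact: (mast_uniserial adm' quo' mz').
  - exact: cS mz'.
have [w [gw hw]] := presents_isom iMM gz.
have be_w : pth pi' (parrow be) *: w = 0.
  apply/hw/hz; rewrite cf_path qpathE eps_radn; last exact: radn_path.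
  split=> //; rewrite (_ : _ && _ = false) //; apply/negbTE; rewrite negb_and.
  by apply/orP; right; apply: contra ne => /eqP[->].
have [b eb] := gw z'; have [c ec] := gz' w.
have : pth pi' (parrow be) *: (c *: z') = 0 by rewrite -ec.
rewrite scalerA => /hz'[_]; rewrite cfM cf_path eqxx mul1r.
rewrite [eps _ _ _ (pth _ _)]eps_radn ?mul0r ?add0r; last exact: radn_path.
move=> c0; have : (1 - b * c) *: z' = 0.
  by rewrite scalerBl scale1r -scalerA -ec -eb subrr.
by case/hz' => /eqP; rewrite epsB epsM c0 mulr0 subr0 eps1 oner_eq0.
Qed.

(** The point of g x is read off from the vectors al u g x, expanded in the basis v' g x by
    [basis_change]. *)
Lemma rep_change p p' (g : L) : no_double_arrows G ->
  (forall (U : lmodType L) (x : U), mast_at pi p x -> mast_at pi' p' (g *: x)) ->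
  exists F : detour_index p' -> poly_on K (detour_index p),
    forall k (U : lmodType L) (x : U), rep pi k x -> rep pi' (poly_map F k) (g *: x).
Proof.
move=> nd hg.
have [[U0 [x0 m0]]|none] :=
  pselect (exists (U : lmodType L) (x : U), mast_at pi p x); last first.
  (* No pair has mast [p], so any polynomials will do. *)
  exists (fun=> projT1 (cid (regular_cst (detour_index p) (0 : K)))) => k U x [mx _].
  by case: none; exists U, x.
have lp : plen p' = plen p.
  have := (mast_comp_length adm quo _ m0).1 ((mast_comp_length adm' quo' _ (hg _ _ m0)).2 erefl).
  by case.
pose b m := pth pi' (pinit p' m) * g.
have rb i : (i <= plen p)%N -> radn pi i (b i).
  move=> ip; apply: (radnMr quo); apply: radn_change; apply: radn_path.
  by rewrite plen_pinit ?lp.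
have nb i : (i <= plen p)%N -> ~ in_rad pi x0 i.+1 (b i *: x0).
  move=> ip; have m0' := hg _ _ m0; have [g0 _ _ _] := m0; have [g0' _ _ _] := m0'.
  move/(in_rad_change _ _ g0 g0'); rewrite -scalerA.
  by apply: (mast_vec_notin quo' m0'); rewrite lp.
have bc al u := basis_change adm quo (pth pi' (parrow al) * (pth pi' u * g)) nd rb m0 nb.
pose f al u := projT1 (cid (bc al u)).
have fP al u : (forall m, regular (f al u m)) /\ forall k (U : lmodType L) (x : U),
    rep pi k x -> (pth pi' (parrow al) * (pth pi' u * g)) *: x =
      \sum_(0 <= m < (plen p).+1) f al u m k *.: (b m *: x).
  by rewrite /f; case: cid.
pose F (d : detour_index p') :=
  projT1 (cid ((fP (dt_arrow d) (dt_base d)).1 (plen (dt_target d)))).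
have FE d k : poly_eval (F d) k = f (dt_arrow d) (dt_base d) (plen (dt_target d)) k.
  by rewrite /F; case: cid.
exists F => k U x rk; have mx' := hg _ _ (proj1 rk).
have [k' rk'] := rep_exists adm' quo' mx'; suff -> : poly_map F k = k' by [].
apply/ffunP => d; rewrite ffunE FE.
have [dd _ ld ed] := detour_index_target d; have := rep_detour rk' dd.
have := (fP (dt_arrow d) (dt_base d)).2 k U x rk; rewrite -!scalerA => ->.
under eq_bigr => m _ do rewrite -scalerA.
rewrite -lp => /(@mast_coord_uniq _ _ _ _ _ quo' _ _ _ mx'
  (fun m => f (dt_arrow d) (dt_base d) m k)
  (fun m => oapp k' 0 (detour_at p' (dt_arrow d) (dt_base d) m))).
by move/(_ _ ld); rewrite ed.
Qed.

(** h g = e forces the character of [g] at e to be nonzero, so g x stays outside J U. *)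
Lemma top_change n (S : 'I_n -> lmodType L) p p' (g h : L) : no_double_arrows G' ->
  passes_through pi S p -> passes_through pi' S p' ->
  g = pth pi' (pvertex (pstart p')) * g -> h * g = pth pi (pvertex (pstart p)) ->
  forall (U : lmodType L) (x : U), mast_at pi p x -> mast_at pi' p' (g *: x).
Proof.
move=> nd' tp tp' vg hg U x mx; have cU := (comp_series_passes adm quo S mx).2 tp.
have uU := mast_uniserial adm quo mx.
have [q [y my]] := uniserial_mast adm' quo' uU.
have eq : q = p'.
  have [nq lq] := (passes_throughP adm' quo' S q).1
    ((comp_series_passes adm' quo' S my).1 cU).
  have [np lp] := (passes_throughP adm' quo' S p').1 tp'.
  exact: lines_path_eq nd' nq np lq lp.
rewrite eq in my; have [gx _ _ _] := mx; have [gy _ _ _] := my.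
apply: (mast_of_at adm' quo' (mast_at_of adm' quo' my) (e := pstart p')).
apply: (generator_top adm' quo' gy); last by rewrite scalerA -vg.
move/(in_rad_change _ _ gx gy)/(generator_notin_radE adm quo g gx) => z.
have := epsM adm quo (pstart p) h g; rewrite hg z mulr0 eps_vx eqxx => /eqP.
by rewrite oner_eq0.
Qed.

(* Right multiplications by g and h are mutually inverse isomorphisms between
   L e' and L e. *)
Lemma idempotents_equivalent e e' S : line adm quo e S -> line adm' quo' e' S ->
  exists g h : L, [/\ g = pth pi' (pvertex e') * g, h = pth pi (pvertex e) * h,
    h * g = pth pi (pvertex e) & g * h = pth pi' (pvertex e')].
Proof.
move=> [s ps] [s' ps']; have [s0 gs act] := presents_eps ps.
have [s0' _ act'] := presents_eps ps'.
set v := pth pi (pvertex e); set v' := pth pi' (pvertex e').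
have vv : v * v = v by rewrite vx_vx eqxx.
have vv' : v' * v' = v' by rewrite vx_vx eqxx.
(* Both characters describe the action on the same one-dimensional module [S]. *)
have epsE a : eps adm quo e a = eps adm' quo' e' a.
  have [c ec] := gs s'; have := act' a; rewrite {1}ec scaleCl act -scaleCl -ec.
  move/eqP; rewrite -subr_eq0 -!scalerBl.
  have [->|ne] := eqVneq (eps adm quo e a) (eps adm' quo' e' a); first by [].
  move/eqP=> z; case/eqP: s0'; rewrite -[s'](scaleVK (c := eps adm quo e a - eps adm' quo' e' a)).
    by rewrite z scaler0.
  by rewrite subr_eq0.
have ev : eps adm quo e v = 1 by rewrite eps_vx eqxx.
have ev' : eps adm quo e v' = 1 by rewrite epsE eps_vx eqxx.
(* [r] measures the failure of e e' e to be e. It lies in J, so 1 - r has a geometric series as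
   inverse, which corrects e e' to a left inverse of e' e. *)
pose r := v - v * v' * v.
have vr : v * r = r by rewrite mulrBr !mulrA vv.
have rv : r * v = r by rewrite mulrBl -[v * v' * v * v]mulrA vv.
have rr : radn pi 1 r.
  apply/(radn1P adm quo) => f; have [->|ne] := eqVneq f e.
    by rewrite epsB !epsM ev ev' !mulr1 subrr.
  by rewrite -vr epsM eps_vx eq_sym (negPf ne) mul0r.
have [n rn] := radn_nilpotent adm quo.
pose q := \sum_(i < n) r ^+ i.
have qE : q * (1 - r) = 1.
  by rewrite geometric_sum (rn (r ^+ n)) ?subr0 //; apply: (radnX quo).
pose g := v' * v; pose h := q * v * v'.
have vq : v * q * v = q * v.
  rewrite mulr_sumr !mulr_suml; apply: eq_bigr => i _.
  case: (nat_of_ord i) => [|j]; first by rewrite expr0 mulr1 mul1r vv.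
  by rewrite exprS mulrA vr.
have hg : h * g = v.
  have -> : h * g = q * (v * v' * v) by rewrite /h /g !mulrA -[_ * v' * v']mulrA vv'.
  have -> : v * v' * v = (1 - r) * v by rewrite mulrBl mul1r rv /r opprB addrC subrK.
  by rewrite mulrA qE mul1r.
have vh : v * h = h by rewrite /h !mulrA vq.
have hv' : h * v' = h by rewrite /h -mulrA vv'.
have vg : v' * g = g by rewrite /g mulrA vv'.
exists g, h; split=> //.
have [n' rn'] := radn_nilpotent adm' quo'.
(* The defect of the other composite is an idempotent in J, hence zero by nilpotency. *)
pose w := v' - g * h.
have ww : w * w = w.
  rewrite mulrBl !mulrBr vv' [v' * (g * h)]mulrA vg -[g * h * v']mulrA hv'.
  have -> : g * h * (g * h) = g * h.
    by rewrite mulrA -[g * h * g]mulrA hg -mulrA vh.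
  by rewrite subrr subr0.
have rw : radn pi' 1 w.
  apply/(radn1P adm' quo') => f; have [->|ne] := eqVneq f e'; last first.
    have -> : w = v' * w by rewrite mulrBr vv' mulrA vg.
    by rewrite epsM eps_vx eq_sym (negPf ne) mul0r.
  by rewrite epsB -!epsE epsM mulrC -epsM hg ev ev' subrr.
have w0 : w = 0.
  have wX m : w ^+ m.+1 = w by elim: m => [|m IHm]; rewrite ?expr1 // exprS IHm.
  rewrite -(wX n'); apply: rn'; apply: (radn_le (leqnSn _)); exact: (radnX quo').
by apply/eqP; rewrite eq_sym -subr_eq0 -/w w0.
Qed.

End TwoPresentations.

Lemma affine_isom_empty (K : fieldType) (V W : affine_set K) :
  (forall k, ~ @points K V k) -> (forall k, ~ @points K W k) -> affine_isom V W.
Proof.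
move=> nV nW; pose z (T : finType) : poly_on K T := projT1 (cid (regular_cst T (0 : K))).
by exists (fun=> z _), (fun=> z _); split=> k; [move/nV | move/nW | move/nV | move/nW].
Qed.

Lemma var_of_series_points (K : fieldType) (L : algType K) (G : quiver)
    (I : path_algebra K G -> Prop) (pi : {rmorphism path_algebra K G -> L})
    n (S : 'I_n -> lmodType L) k : admissible I -> quotient_map I pi ->
  @points K (var_of_series pi S) k ->
  exists U : lmodType L, uniserial U /\ comp_series S U.
Proof.
move=> adm quo; move: k; rewrite /var_of_series; case: pselect => // ex.
case: cid => p tp /= k /(points_rep adm quo)[U [x [mx _]]]; exists U.
by split; [apply: (mast_uniserial adm quo mx) | apply/(comp_series_passes adm quo S mx)].
Qed.

Lemma var_of_series_isom (K : fieldType) (L : algType K)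
    (G : quiver) (I : path_algebra K G -> Prop)
    (G' : quiver) (I' : path_algebra K G' -> Prop)
    (pi : {rmorphism path_algebra K G -> L}) (pi' : {rmorphism path_algebra K G' -> L})
    n (S : 'I_n -> lmodType L) :
  admissible I -> quotient_map I pi -> admissible I' -> quotient_map I' pi' ->
  no_double_arrows G -> affine_isom (var_of_series pi S) (var_of_series pi' S).
Proof.
move=> adm quo adm' quo' nd; have nd' := no_double_arrows_change adm quo adm' quo' nd.
(* If no uniserial module realises [S], both varieties are empty; otherwise one such module provides
   the masts for both presentations. *)
case: (pselect (exists U : lmodType L, uniserial U /\ comp_series S U)) => [|none]; last first.
  apply: affine_isom_empty => k pk; apply: none.
    exact: var_of_series_points adm quo pk.
  exact: var_of_series_points adm' quo' pk.
move=> [U0 [u0 c0]]; have [p [x0 m0]] := uniserial_mast adm quo u0.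
have [p' [x0' m0']] := uniserial_mast adm' quo' u0.
have tp := (comp_series_passes adm quo S m0).1 c0.
have tp' := (comp_series_passes adm' quo' S m0').1 c0.
rewrite (var_of_seriesE adm quo nd tp) (var_of_seriesE adm' quo' nd' tp').
have [T lT] := line_exists adm quo (pstart p).
have lT' : line adm' quo' (pstart p') T.
  by apply/(mast_top_isom adm' quo' m0')/(mast_top_isom adm quo m0).
have [g [h [vg vh hg gh]]] := idempotents_equivalent lT lT'.
have hgh := top_change adm quo adm' quo' nd' tp tp' vg hg.
have hhg := top_change adm' quo' adm quo nd tp' tp vh gh.
have [F hF] := rep_change adm quo adm' quo' nd hgh.
have [H hH] := rep_change adm' quo' adm quo nd' hhg.
exists F, H; split=> k.
- move=> /(points_rep adm quo)[U [x rk]]; apply/(points_rep adm' quo').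
  by exists U, (g *: x); apply: hF.
- move=> /(points_rep adm' quo')[U [x rk]]; apply/(points_rep adm quo).
  by exists U, (h *: x); apply: hH.
- move=> /(points_rep adm quo)[U [x rk]]; have [[[ex _ _] _ _ _] _] := rk.
  have := hH _ _ _ (hF _ _ _ rk); rewrite scalerA hg -ex => rk'.
  exact: (rep_uniq quo rk' rk).
- move=> /(points_rep adm' quo')[U [x rk]]; have [[[ex _ _] _ _ _] _] := rk.
  have := hF _ _ _ (hH _ _ _ rk); rewrite scalerA gh -ex => rk'.
  exact: (rep_uniq quo' rk' rk).
Qed.

Theorem theorem3p3
    (K : fieldType) (G : quiver) (I : path_algebra K G -> Prop)
    (L : algType K) (pi : {rmorphism path_algebra K G -> L})
    (K_infinite : forall s : seq K, exists x, x \notin s)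
    (I_admissible : admissible I)
    (pi_quotient : quotient_map I pi) :
  (finite_uniserial_type L -> condition_N pi)
  /\
  (condition_N pi ->
   [/\
     (* (a) *)
     [/\ no_double_arrows G,
         (forall U : lmodType L, uniserial U -> exists! p, mast_of pi p U)
       & (forall (G' : quiver) (I' : path_algebra K G' -> Prop)
            (pi' : {rmorphism path_algebra K G' -> L}),
            admissible I' -> quotient_map I' pi' ->
            forall (n : nat) (S : 'I_n -> lmodType L),
              (forall i, simple (S i)) ->
              affine_isom (var_of_series pi S) (var_of_series pi' S))],
     (* (b) *)
     (forall p, is_mast pi p ->
        forall a u, halyard pi p a u -> circular pi p a u)
     /\
     (forall (n : nat) (S : 'I_n -> lmodType L),
        (forall i, simple (S i)) ->
        (forall i j, i <> j -> ~ isom (S i) (S j)) ->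
        forall U U' : lmodType L,
          uniserial U -> comp_series S U ->
          uniserial U' -> comp_series S U' -> isom U U'),
     (* (c) *)
     (forall (g : arrow G) (p : qpath G),
        tgt g = src g -> is_mast pi p ->
        pstart p = src g -> pend p = src g ->
        exists m, parrows p = nseq m g)
     /\
     (forall S : lmodType L, simple S ->
        ((exists W : lmodType L,
            [/\ uniserial W, comp_length W 2, top_isom W S & soc_isom W S])
         <-> ext1_nonzero S S)
        /\
        (forall W : lmodType L,
           uniserial W -> comp_length W 2 -> top_isom W S -> soc_isom W S ->
           forall (U : lmodType L) (l : nat),
             (2 <= l)%N -> uniserial U -> comp_length U l ->
             top_isom U S -> soc_isom U S ->
             forall i, (i <= l - 2)%N ->
               factor_isom (rad_pow (M := U) i) (rad_pow (M := U) i.+2) W))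
     (* (d) *)
   & (forall (l : nat) (S : 'I_l.+1 -> lmodType L),
        (forall i, simple (S i)) ->
        affine_finite (var_of_series pi (fun i : 'I_l => S (lift ord0 i))) ->
        finitely_many_up_to_isom
          (fun U : lmodType L => uniserial U /\ comp_series S U))]).
Proof.
split=> [|N]; first exact: (finite_type_N I_admissible pi_quotient K_infinite).
have nd := N_no_double_arrows I_admissible pi_quotient N.
split.
- split=> // [U|G' I' pi' adm' quo' n S _].
    exact: (uniserial_unique_mast I_admissible pi_quotient).
  exact: (var_of_series_isom S I_admissible pi_quotient adm' quo' nd).
- split=> [p _ a u|n S _ ni U U' uU cU uU' cU']; first exact: (N_halyard I_admissible pi_quotient).
  exact: (N_repetition_free I_admissible pi_quotient N ni uU cU uU' cU').
- split=> [g p lg mp sp tp|S sS]; first exact: (N_loop I_admissible pi_quotient N lg).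
  split; first split; [| exact: (ext1_uniserial I_admissible pi_quotient) |].
    by move=> [W [uW cW tW sW]]; apply: (uniserial_ext1 I_admissible pi_quotient uW).
  move=> W uW cW tW sW U l l2 uU cU tU sU i il.
  exact: (uniserial_square I_admissible pi_quotient N uW cW tW sW l2 uU cU tU sU il).
- by move=> l S _ fin; apply: (N_finite_extension I_admissible pi_quotient).
Qed.
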